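(* Let $\gamma>1$, $\mu_0>0$, and let $a\in C^1_b([0,\infty)\times\mathbb{R})$ be a function with $a(t,x)\ge0$ for all $(t,x)$, for which there exist non-negative functions $a_1\in C^1_b([0,\infty))$ and $a_2\in C^1_b(\mathbb{R})$ such that $$|a(t,x)-\mu_0|+|a_x(t,x)|+|a_t(t,x)|\le a_1(t)+a_2(x)\quad\text{for all }(t,x)\in[0,\infty)\times\mathbb{R},$$ $$\int_0^\infty a_1(t)\,dt+\int_{-\infty}^\infty a_2(x)\,dx=C_a<\infty,\qquad x\,\frac{d}{dx}a_2(x)\le 0\quad\text{for all }x\in\mathbb{R}.$$ Let $\varphi,\psi\in C^1_b(\mathbb{R})$. Then there exist a number $\varepsilon_1=\varepsilon_1(\|\varphi\|_{C^1_b},\|\psi\|_{C^1_b})>0$ and a constant $C>0$ independent of $\varepsilon$ such that, for every $0<\varepsilon\le\varepsilon_1$, the Cauchy problem $$u_t-v_x=0,\qquad v_t+p(u)_x=-a(t,x)v,\qquad (u(0,x),v(0,x))=(1+\varepsilon\varphi(x),\varepsilon\psi(x)),\qquad p(u)=\frac{u^{-\gamma}}{\gamma},$$ has a global and unique $C^1_b$-solution $(u,v)$ on $[0,\infty)\times\mathbb{R}$ such that $$\|(u-1,v)\|_{L^\infty([0,\infty)\times\mathbb{R})}+\|(u_t,v_t)\|_{L^\infty([0,\infty)\times\mathbb{R})}+\|(u_x,v_x)\|_{L^\infty([0,\infty)\times\mathbb{R})}\le C\varepsilon$$ and $\|p'(u)\|_{L^\infty([0,\infty)\times\mathbb{R})}\le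 C$.
   Context: $C^1_b(\Omega)$ is the set of bounded continuous functions on $\Omega$ whose first partial derivatives are also bounded (and continuous), with norm $\|f\|_{C^1_b(\Omega)}=\|f\|_{L^\infty(\Omega)}+\|\nabla f\|_{L^\infty(\Omega)}$; $\|\cdot\|_{C^1_b}$ without a domain means $\Omega=\mathbb{R}$. Here $x\in\mathbb{R}$, $t\ge0$, $u,v$ are real-valued unknowns, and $\varepsilon>0$ is a small parameter. It is assumed throughout that the initial data satisfy $u(0,x)\ge\delta_0$ for all $x$, for some constant $\delta_0>0$ (automatic for small $\varepsilon$); solutions are understood to satisfy $u>0$. For given $\gamma$ and $a$, $\varepsilon_1$ depends on the initial data only through the two indicated norms. *)

(* Defs.v *)
From HB Require Import structures.
From mathcomp Require Import all_boot all_order all_algebra.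
From mathcomp Require Import all_classical all_reals all_analysis.
Set Implicit Arguments.
Unset Strict Implicit.
Unset Printing Implicit Defensive.
Import Order.TTheory GRing.Theory Num.Theory.
Import numFieldNormedType.Exports.
Local Open Scope classical_set_scope.
Local Open Scope ring_scope.

Section derivatives.
Context {R : realType} {V : normedModType R}.

(* Increments h with p + h e outside A are discarded, so that on the boundary
   line t = 0 of [0, +oo) x R the time derivative is one-sided.  Only meant for
   domains A in which 0 is a limit point of the remaining increments. *)
Definition diff_quot (f : V -> R) (p e : V) (h : R) : R :=
  h^-1 * (f (h *: e + p) - f p).

Definition increments (A : set V) (p e : V) : set_system R :=
  within [set h : R | A (h *: e + p)] (0^').

Definition derivable_within (A : set V) (e : V) (f : V -> R) (p : V) : Prop :=
  cvg (diff_quot f p e @ increments A p e).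

Definition derive_within (A : set V) (e : V) (f : V -> R) (p : V) : R :=
  lim (diff_quot f p e @ increments A p e).

Lemma incrementsT (p e : V) : increments setT p e = 0^'.
Proof.
rewrite /increments; apply/seteqP; split => X; rewrite /within /=.
  by apply: filterS => h; apply.
by apply: filterS => h Xh _.
Qed.

Lemma derivable_withinT (e : V) (f : V -> R) (p : V) :
  derivable_within setT e f p = derivable f p e.
Proof. by rewrite /derivable_within incrementsT. Qed.

Lemma derive_withinT (e : V) (f : V -> R) (p : V) :
  derive_within setT e f p = 'D_e f p.
Proof. by rewrite /derive_within incrementsT. Qed.

Definition Cb (A : set V) (f : V -> R) : Prop :=
  {within A, continuous f} /\ [bounded f p | p in A].

Definition has_Cb_derive (A : set V) (e : V) (f : V -> R) : Prop :=
  (forall p, A p -> derivable_within A e f p) /\ Cb A (derive_within A e f).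

End derivatives.

Definition C1b {R : realType} (A : set R) (f : R -> R) : Prop :=
  Cb A f /\ has_Cb_derive A 1 f.

Section halfplane.
Context {R : realType}.

Definition time_halfline : set R := `[0, +oo[.

(* points are pairs (t, x) *)
Definition halfplane : set (R * R) := [set p | 0 <= p.1].

Definition d_t : (R * R -> R) -> R * R -> R := derive_within halfplane (1, 0).
Definition d_x : (R * R -> R) -> R * R -> R := derive_within halfplane (0, 1).

Definition C1b_halfplane (f : R * R -> R) : Prop :=
  [/\ Cb halfplane f, has_Cb_derive halfplane (1, 0) f
    & has_Cb_derive halfplane (0, 1) f].

End halfplane.

Section norms.
Context {R : realType}.
Local Open Scope ereal_scope.

Definition C1b_norm (f : R -> R) : \bar R :=
  'N[lebesgue_measure]_+oo[(fun x : measurableTypeR R => (f x)%:E)] +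
  'N[lebesgue_measure]_+oo[(fun x : measurableTypeR R => (derive1 f x)%:E)].

Definition lebesgue_measure2 :
    {measure set (measurableTypeR R * measurableTypeR R) -> \bar R} :=
  (@lebesgue_measure R \x @lebesgue_measure R)%E.

(* L^oo([0, +oo) x R)-norm of f, as the L^oo(R^2)-norm of its extension by 0;
   for pairs, `|_| is the maximum norm. *)
Definition Linfty_halfplane {W : normedModType R} (f : R * R -> W) : \bar R :=
  'N[lebesgue_measure2]_+oo[(fun p => `|f p|%:E) \_ halfplane].

End norms.

Section p_system.
Context {R : realType}.

Definition pressure (gamma u : R) : R := u `^ (- gamma) / gamma.

Definition damped_p_system (gamma : R) (a u v : R * R -> R) : Prop :=
  forall p, halfplane p ->
    d_t u p - d_x v p = 0 /\
    d_t v p + d_x (pressure gamma \o u) p = - a p * v p.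

Definition C1b_solution (gamma : R) (a : R * R -> R) (u0 v0 : R -> R)
    (u v : R * R -> R) : Prop :=
  [/\ C1b_halfplane u /\ C1b_halfplane v,
      forall p, halfplane p -> 0 < u p,
      damped_p_system gamma a u v
    & forall x, u (0, x) = u0 x /\ v (0, x) = v0 x].

Definition admissible_damping (mu0 : R) (a : R * R -> R) : Prop :=
  [/\ C1b_halfplane a,
      forall p, halfplane p -> 0 <= a p
    & exists (a1 a2 : R -> R) (Ca : R),
      [/\ C1b time_halfline a1 /\ C1b setT a2,
          (forall t, 0 <= t -> 0 <= a1 t) /\ (forall x, 0 <= a2 x),
          forall t x, 0 <= t ->
            `|a (t, x) - mu0| + `|d_x a (t, x)| + `|d_t a (t, x)|
              <= a1 t + a2 x,
          (\int[lebesgue_measure]_(t in time_halfline) (a1 t)%:E +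
           \int[lebesgue_measure]_x (a2 x)%:E = Ca%:E)%E
        & forall x, x * derive1 a2 x <= 0]].

End p_system.

(* Main.v *)
Require Import Defs.
From HB Require Import structures.
From mathcomp Require Import all_boot all_order all_algebra.
From mathcomp Require Import all_classical all_reals all_analysis.
From mathcomp Require Import measurable_realfun ess_sup_inf.
From mathcomp Require Import ring lra.
Import Order.TTheory GRing.Theory Num.Theory.
Import numFieldNormedType.Exports.
Local Open Scope classical_set_scope.
Local Open Scope ring_scope.

(** With k = (gamma - 1) / 2, c = u^(-(k+1)) and eta the integral of c from 1 to
    u, the Riemann invariants r = v - eta and s = v + eta satisfy
      r_t + c r_x = - a v,    s_t - c s_x = - a v,    v = (r + s) / 2.
    As a >= 0, max(|r|, |s|) does not grow.  The derivative p = r_x obeys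
      p' = - (a/2) (p + q) + O(eps) + O(p^2 + q^2)
    along its characteristics, where q = s_x is not damped by this equation; but
    eta' = c q along them, so Y = p + a eta / 2 satisfies
    Y' = - (a/2) Y + O(eps) + O(p^2 + q^2).  Since |a - mu0| <= a1(t) + a2(x), with
    integrable a1 and a2 and |dx/dt| = c bounded below, a/2 acts up to a bounded
    factor like the constant mu0/2 > 0, and p, q stay O(eps) for all times.

    Solutions are limits of the semi-Lagrangian scheme that damps and then
    transports along straight approximate characteristics.  Discretely the
    estimate of Y has an error governed by the moduli of continuity of p and q,
    which the scheme propagates on backward cones; for a small time step both
    bounds therefore hold by one induction up to any given time.  Schemes with
    step h and h/2 differ by O(h), and the derivatives are equicontinuous, so
    the limit is C^1.  Uniqueness is a maximum principle for the difference of
    two solutions on short time strips. *)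

(** * Elementary bounds *)

(** The obstacle is the infinite time interval: a Gronwall bound for the quadratic terms lasts only
    for a time of order 1 / eps. The bound becomes global because all sources of Y have the size of
    m0, the bound of the data: if m1 = C2 m0 bounds p and q, and m1^2 <= m0, the source of Y is at
    most a multiple of L^2 m0, which an effective damping rate mu0 / 4 balances for all times. The
    condition m1^2 <= m0 is where eps has to be small. The initial derivatives are continuous but
    perhaps not uniformly so; their moduli exist on bounded sets only and must be followed on cones.
    These moduli grow exponentially in time, which makes the admissible time step depend on the
    cone, while m0 and m1 do not depend on it. *)

Section norm_bounds.
Context {R : realType}.
Implicit Types x y X Y : R.

Lemma le_normD x y X Y : `|x| <= X -> `|y| <= Y -> `|x + y| <= X + Y.
Proof. by move=> hx hy; rewrite (le_trans (ler_normD _ _))// lerD. Qed.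

Lemma le_normB x y X Y : `|x| <= X -> `|y| <= Y -> `|x - y| <= X + Y.
Proof. by move=> hx hy; rewrite (le_trans (ler_normB _ _))// lerD. Qed.

Lemma le_normM x y X Y : `|x| <= X -> `|y| <= Y -> `|x * y| <= X * Y.
Proof. by move=> hx hy; rewrite normrM ler_pM. Qed.

Lemma le_normMl x y X : 0 <= x -> `|y| <= X -> `|x * y| <= x * X.
Proof. by move=> x0 hy; rewrite normrM (ger0_norm x0) ler_wpM2l. Qed.

(** The splitting asks for a bound on one factor of each product only, x in the first and y' in the
    second. *)
Lemma le_normMB x x' y y' X Y dX dY :
  `|x| <= X -> `|y'| <= Y -> `|x - x'| <= dX -> `|y - y'| <= dY ->
  `|x * y - x' * y'| <= X * dY + dX * Y.
Proof.
move=> hx hy dx dy.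
have -> : x * y - x' * y' = x * (y - y') + (x - x') * y' by ring.
by apply: le_normD; apply: le_normM.
Qed.

(** The conclusion on |z - x| keeps the intermediate point close enough to x for a modulus of
    continuity of [df] to apply there. *)
Lemma mean_value_itv (f df : R -> R) (lo hi x y : R) :
  (forall z : R, lo <= z <= hi -> is_derive z 1 f (df z)) ->
  lo <= x <= hi -> lo <= y <= hi ->
  exists z, [/\ lo <= z <= hi, `|z - x| <= `|y - x| & f y - f x = df z * (y - x)].
Proof.
move=> fd /andP[x1 x2] /andP[y1 y2].
have within (u v : R) : lo <= u -> v <= hi -> {within `[u, v], continuous f}.
  move=> ru vr; apply/continuous_in_subspaceT => z; rewrite inE/= in_itv/= => /andP[z1 z2].
  apply/differentiable_continuous/derivable1_diffP.
  by apply: (@ex_derive _ _ _ _ _ _ _ (fd z _)); lra.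
have [xy|yx] := leP x y.
  have [|z] := @MVT_segment R f df x y xy _ (within _ _ x1 y2); last first.
    by rewrite in_itv/= => /andP[z1 z2] e; exists z; split=> //; rewrite ?ger0_norm ?subr_ge0; lra.
  by move=> z; rewrite in_itv/= => /andP[z1 z2]; apply: fd; lra.
have [|z] := @MVT_segment R f df y x (ltW yx) _ (within _ _ y1 x2); last first.
  rewrite in_itv/= => /andP[z1 z2] e; exists z; split=> //; try lra.
  by rewrite !ler0_norm; lra.
by move=> z; rewrite in_itv/= => /andP[z1 z2]; apply: fd; lra.
Qed.

Lemma mean_value (f df : R -> R) (r x y : R) :
  (forall z : R, `|z| <= r -> is_derive z 1 f (df z)) -> `|x| <= r -> `|y| <= r ->
  exists z, [/\ `|z| <= r, `|z - x| <= `|y - x| & f y - f x = df z * (y - x)].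
Proof.
move=> fd; rewrite !ler_norml => xr yr.
have [z zr|z [zr zx e]] := @mean_value_itv f df (- r) r x y _ xr yr.
  by apply: fd; rewrite ler_norml.
by exists z; rewrite ler_norml.
Qed.

Lemma lipschitz_itv (f df : R -> R) (lo hi m x y : R) :
  (forall z : R, lo <= z <= hi -> is_derive z 1 f (df z)) ->
  (forall z, lo <= z <= hi -> `|df z| <= m) ->
  lo <= x <= hi -> lo <= y <= hi -> `|f y - f x| <= m * `|y - x|.
Proof.
move=> fd fm xr yr; have [z [zr _ ->]] := mean_value_itv _ _ _ _ _ _ fd xr yr.
by rewrite normrM ler_wpM2r// fm.
Qed.

Lemma lipschitz_of_derive (f df : R -> R) (r m x y : R) :
  (forall z : R, `|z| <= r -> is_derive z 1 f (df z)) ->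
  (forall z, `|z| <= r -> `|df z| <= m) ->
  `|x| <= r -> `|y| <= r -> `|f y - f x| <= m * `|y - x|.
Proof.
move=> fd fm xr yr; have [z [zr _ ->]] := mean_value _ _ _ _ _ fd xr yr.
by rewrite normrM ler_wpM2r// fm.
Qed.

End norm_bounds.

(** * One step of the scheme *)

Section riemann_invariants.
Context {R : realType}.
Implicit Types (st dst : bool -> R -> R) (b : bool) (t h x y : R).

(* [true] labels the invariant v - eta, carried with speed c; [false] labels
   v + eta, carried with speed - c. *)
Definition sg b : R := if b then 1 else -1.

Lemma sgM b : sg b * sg b = 1.
Proof. by rewrite /sg; case: b; ring. Qed.

Lemma norm_sg b : `|sg b| = 1.
Proof. by rewrite /sg; case: b; rewrite ?normrN1 ?normr1. Qed.

Lemma le_norm_sg b x X : `|x| <= X -> `|sg b * x| <= X.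
Proof. by rewrite normrM norm_sg mul1r. Qed.

Definition vel st x := (st true x + st false x) / 2.
Definition eta st x := (st false x - st true x) / 2.

(** Here and in [etaE] the pair is seen from family b, with [~~ b] as the other one, so that one
    computation serves both families. *)
Lemma velE st b x : vel st x = (st b x + st (~~ b) x) / 2.
Proof. by rewrite /vel; case: b => //=; ring. Qed.

Lemma etaE st b x : eta st x = sg b * (st (~~ b) x - st b x) / 2.
Proof. by rewrite /eta /sg; case: b => /=; ring. Qed.

Lemma le_vel st x X : (forall b, `|st b x| <= X) -> `|vel st x| <= X.
Proof.
move=> H; move: (H true) (H false); rewrite /vel !ler_norml.
by move=> /andP[? ?] /andP[? ?]; lra.
Qed.

Lemma le_eta st x X : (forall b, `|st b x| <= X) -> `|eta st x| <= X.
Proof.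
move=> H; move: (H true) (H false); rewrite /eta !ler_norml.
by move=> /andP[? ?] /andP[? ?]; lra.
Qed.

Lemma le_velB st st' x y X :
  (forall b, `|st b x - st' b y| <= X) -> `|vel st x - vel st' y| <= X.
Proof.
move=> H; move: (H true) (H false); rewrite /vel !ler_norml.
by move=> /andP[? ?] /andP[? ?]; lra.
Qed.

Lemma le_etaB st st' x y X :
  (forall b, `|st b x - st' b y| <= X) -> `|eta st x - eta st' y| <= X.
Proof.
move=> H; move: (H true) (H false); rewrite /eta !ler_norml.
by move=> /andP[? ?] /andP[? ?]; lra.
Qed.

End riemann_invariants.

Section one_step.
Context {R : realType}.
Variables (a ax : R -> R -> R) (c dc : R -> R) (L eta0 : R).
Implicit Types (st dst : bool -> R -> R) (b : bool) (t h x y : R).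

(* Damping is evaluated at the foot, so that a step takes convex combinations
   of values of the two invariants. *)
Definition foot h st b x := x - sg b * h * c (eta st x).
Definition damp h t st b y := st b y - h * (a t y * vel st y).
Definition ddamp h t st dst b y :=
  dst b y - h * (ax t y * vel st y + a t y * vel dst y).
Definition jac h st dst b x := 1 - sg b * h * (dc (eta st x) * eta dst x).

Definition step h t st b x := damp h t st b (foot h st b x).
Definition dstep h t st dst b x :=
  ddamp h t st dst b (foot h st b x) * jac h st dst b x.

(* Along characteristics eta grows at rate c times the derivative of the other
   invariant, so the term a eta / 2 absorbs the undamped coupling. *)
Definition dampedY t st dst b x : R := dst b x + a t x * eta st x / 2.

(** A single L for all coefficients and Lipschitz constants keeps every error a multiple of a power
    of L. The radius eta0 confines the speed to [1/2, 2]: the upper bound fixes the opening of the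
    cones, the lower one lets characteristics cross the mass of a2. *)
Record coef_bounds : Prop := CoefBounds {
  coef_L : 1 <= L;
  coef_eta0 : eta0 <= 1;
  coef_cd : forall z : R, `|z| <= eta0 -> is_derive z 1 c (dc z);
  coef_c : forall z, `|z| <= eta0 -> 1 / 2 <= c z <= 2;
  coef_dc : forall z, `|z| <= eta0 -> `|dc z| <= L;
  coef_dc_lip : forall y z, `|y| <= eta0 -> `|z| <= eta0 ->
    `|dc y - dc z| <= L * `|y - z|;
  coef_c0 : c 0 = 1;
  coef_a : forall t x, 0 <= t -> 0 <= a t x <= L;
  coef_ax : forall t x, 0 <= t -> `|ax t x| <= L;
  coef_a_lip : forall t x t' x', 0 <= t -> 0 <= t' ->
    `|a t x - a t' x'| <= L * (`|t - t'| + `|x - x'|);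
  coef_ad : forall t (x : R), 0 <= t -> is_derive x 1 (a t) (ax t x)
}.

(** The values are bounded on the whole line, because the maximum principle is global; the
    derivatives are bounded on a section |x| <= r of a backward cone. *)
Record state_bounds (m0 m1 r : R) st dst : Prop := StateBounds {
  state_m0 : m0 <= eta0;
  state_m01 : m0 <= m1;
  state_m1 : m1 <= 1;
  state_bnd : forall b x, `|st b x| <= m0;
  state_d : forall b (x : R), is_derive x 1 (st b) (dst b x);
  state_dbnd : forall b x, `|x| <= r -> `|dst b x| <= m1
}.

Hypothesis coefs : coef_bounds.
Let L1 := coef_L coefs.
Let cd := coef_cd coefs.
Let c_bnd := coef_c coefs.
Let dc_bnd := coef_dc coefs.
Let dc_lip := coef_dc_lip coefs.
Let c0 := coef_c0 coefs.
Let a_bnd := coef_a coefs.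
Let ax_bnd := coef_ax coefs.
Let a_lip := coef_a_lip coefs.
Let ad := coef_ad coefs.

Section max_principle.
Variables (h t m0 : R) (st : bool -> R -> R).
Hypotheses (h0 : 0 <= h) (hL : h * L <= 1) (t0 : 0 <= t) (m0_le : m0 <= eta0).
Hypothesis st_bnd : forall b x, `|st b x| <= m0.

Lemma eta_bnd x : `|eta st x| <= eta0.
Proof. by rewrite (le_trans _ m0_le)// le_eta. Qed.

Lemma damp_bnd b y : `|damp h t st b y| <= m0.
Proof.
have /andP[a0 aL] := a_bnd t y t0.
have ha : 0 <= h * a t y <= 1.
  by rewrite mulr_ge0//= (le_trans _ hL)// ler_wpM2l.
rewrite /damp (velE _ b).
(* The weights are non-negative since h a <= h L <= 1, and they sum to 1. The other invariant enters
   with a minus sign, so the quantity preserved is the common bound of both absolute values. *)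
have -> : st b y - h * (a t y * ((st b y + st (~~ b) y) / 2)) =
  (1 - h * a t y / 2) * st b y + (h * a t y / 2) * - st (~~ b) y by field.
have -> : m0 = (1 - h * a t y / 2) * m0 + (h * a t y / 2) * m0 by ring.
by apply: le_normD; apply: le_normMl; rewrite ?normrN//; lra.
Qed.

Lemma step_bnd b x : `|step h t st b x| <= m0.
Proof. exact: damp_bnd. Qed.

Lemma foot_near b x : `|foot h st b x - x| <= 2 * h.
Proof.
rewrite /foot addrAC subrr sub0r normrN !normrM norm_sg mul1r ger0_norm//.
have /andP[c1 c2] := c_bnd _ (eta_bnd x).
by rewrite ger0_norm 1?mulrC ?ler_wpM2r//; lra.
Qed.

Lemma foot_in b x r : `|x| <= r - 2 * h -> `|foot h st b x| <= r.
Proof.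
move=> xr; have -> : foot h st b x = x + (foot h st b x - x) by ring.
by have -> : r = (r - 2 * h) + 2 * h; [ring | apply: le_normD => //; exact: foot_near].
Qed.

Variable dst : bool -> R -> R.
Hypothesis std : forall b (x : R), is_derive x 1 (st b) (dst b x).

Lemma vel_derive (x : R) : is_derive x 1 (vel st) (vel dst x).
Proof.
have H1 := std true x; have H2 := std false x.
rewrite /vel [X in is_derive _ _ X _](_ : _ = 2^-1 *: (st true + st false)); last first.
  by apply/funext => z /=; rewrite mulrC.
by apply: is_derive_eq; rewrite /GRing.scale/= mulrC.
Qed.

Lemma eta_derive (x : R) : is_derive x 1 (eta st) (eta dst x).
Proof.
have H1 := std true x; have H2 := std false x.
rewrite /eta [X in is_derive _ _ X _](_ : _ = 2^-1 *: (st false - st true)); last first.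
  by apply/funext => z /=; rewrite mulrC.
by apply: is_derive_eq; rewrite /GRing.scale/= mulrC.
Qed.

Lemma foot_derive b (x : R) : is_derive x 1 (foot h st b) (jac h st dst b x).
Proof.
have H1 := eta_derive x; have H2 := cd _ (eta_bnd x).
have H3 := is_derive1_comp H2 H1.
rewrite /foot /jac [X in is_derive _ _ X _](_ : _ =
  id - (sg b * h) *: (c \o eta st)); last by apply/funext.
by apply: is_derive_eq; rewrite /GRing.scale/=; ring.
Qed.

Lemma damp_derive b (x : R) : is_derive x 1 (damp h t st b) (ddamp h t st dst b x).
Proof.
have H1 := vel_derive x; have H2 := ad _ x t0; have H3 := std b x.
rewrite /damp /ddamp [X in is_derive _ _ X _](_ : _ =
  st b - h *: (a t * vel st)); last by apply/funext.
by apply: is_derive_eq; rewrite /GRing.scale/=; ring.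
Qed.

Lemma step_derive b (x : R) : is_derive x 1 (step h t st b) (dstep h t st dst b x).
Proof.
have H1 := foot_derive b x; have H2 := damp_derive b (foot h st b x).
exact: is_derive1_comp H2 H1.
Qed.

End max_principle.

Section local_bounds.
Variables (h t m0 m1 r : R) (st dst : bool -> R -> R).
Hypotheses (h0 : 0 <= h) (hL : h * L <= 1) (t0 : 0 <= t).
Hypothesis stP : state_bounds m0 m1 r st dst.
Let m0_le := state_m0 _ _ _ _ _ stP.
Let m01 := state_m01 _ _ _ _ _ stP.
Let m1_le1 := state_m1 _ _ _ _ _ stP.
Let st_bnd := state_bnd _ _ _ _ _ stP.
Let std := state_d _ _ _ _ _ stP.
Let dst_bnd := state_dbnd _ _ _ _ _ stP.
Let m00 : 0 <= m0. Proof. exact: le_trans (normr_ge0 _) (st_bnd true 0). Qed.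
Let m10 : 0 <= m1. Proof. exact: le_trans m01. Qed.
Let L0 : 0 <= L. Proof. exact: le_trans L1. Qed.

Local Ltac lra_ctx := have ? := h0; have ? := m01; have ? := m1_le1;
  have ? := m00; have ? := m10; have ? := L1; lra.
Local Ltac nra_ctx := have ? := h0; have ? := m01; have ? := m1_le1;
  have ? := m00; have ? := m10; have ? := L1; nra.

Lemma st_lip b x y : `|x| <= r -> `|y| <= r ->
  `|st b x - st b y| <= m1 * `|x - y|.
Proof.
move=> xr yr; apply: (@lipschitz_of_derive _ (st b) (dst b) r) => //.
exact: dst_bnd.
Qed.

Lemma c_eta_lip x y : `|x| <= r -> `|y| <= r ->
  `|c (eta st x) - c (eta st y)| <= L * m1 * `|x - y|.
Proof.
move=> xr yr.
apply: (@le_trans _ _ (L * `|eta st x - eta st y|)).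
  apply: (@lipschitz_of_derive _ c dc eta0) => //; exact: eta_bnd m0_le st_bnd _.
by rewrite -mulrA ler_wpM2l// le_etaB// => b; exact: st_lip.
Qed.

Lemma c_eta_near1 x : `|c (eta st x) - 1| <= L * m0.
Proof.
have ex := eta_bnd _ _ m0_le st_bnd x.
apply: (@le_trans _ _ (L * `|eta st x - 0|)).
  rewrite -c0; apply: (@lipschitz_of_derive _ c dc eta0) => //.
  by rewrite normr0 (le_trans _ ex).
by rewrite subr0 ler_wpM2l// le_eta.
Qed.

Lemma av_bnd t' x : 0 <= t' -> `|a t' x * vel st x| <= L * m0.
Proof.
move=> t'0; apply: le_normM; last exact: le_vel.
by have /andP[? ?] := a_bnd t' x t'0; rewrite ger0_norm.
Qed.

Lemma a_norm t' x : 0 <= t' -> `|a t' x| <= L.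
Proof. by move=> t'0; have /andP[? ?] := a_bnd t' x t'0; rewrite ger0_norm. Qed.

Lemma ddamp_bnd b x : `|x| <= r -> `|ddamp h t st dst b x| <= m1 + h * (L * m0 + L * m1).
Proof.
move=> xr; apply: le_normB; first exact: dst_bnd.
apply: le_normMl => //; apply: le_normD; apply: le_normM.
- exact: ax_bnd.
- exact: le_vel.
- exact: a_norm.
- by apply: le_vel => b'; exact: dst_bnd.
Qed.

Lemma jac_near1 b x : `|x| <= r -> `|jac h st dst b x - 1| <= h * (L * m1).
Proof.
move=> xr; rewrite /jac addrAC subrr sub0r normrN -mulrA; apply: le_norm_sg.
apply: le_normMl => //; apply: le_normM.
  exact/dc_bnd/(eta_bnd _ _ m0_le st_bnd).
by apply: le_eta => b'; exact: dst_bnd.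
Qed.

Let hm : h * (L * m0 + L * m1) <= 2 * m1.
Proof.
have -> : h * (L * m0 + L * m1) = (h * L) * (m0 + m1) by ring.
apply: (@le_trans _ _ (m0 + m1)); last by rewrite mulr_natl mulr2n lerD2r.
by rewrite ler_piMl// addr_ge0.
Qed.

Lemma ddamp_bnd3 b x : `|x| <= r -> `|ddamp h t st dst b x| <= 3 * m1.
Proof. by move=> /(ddamp_bnd b) H; move: hm; lra_ctx. Qed.

Lemma av_lip t' x y : 0 <= t' -> `|x| <= r -> `|y| <= r ->
  `|a t x * vel st x - a t' y * vel st y| <= L * (m1 + m0) * `|x - y| + L * m0 * `|t - t'|.
Proof.
move=> t'0 xr yr.
have -> : L * (m1 + m0) * `|x - y| + L * m0 * `|t - t'| =
  L * (m1 * `|x - y|) + L * (`|t - t'| + `|x - y|) * m0 by ring.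
apply: le_normMB.
- exact: a_norm.
- exact: le_vel.
- exact: a_lip.
- by apply: le_velB => b; exact: st_lip.
Qed.

(** Followed to its foot, the derivative moves by O(h) without any modulus of continuity. Regularity
    in time is deduced from regularity in x by this. *)
Lemma dstep_foot b x : `|x| <= r - 2 * h ->
  `|dstep h t st dst b x - dst b (foot h st b x)| <= 5 * L * h.
Proof.
move=> xr.
have fr := foot_in _ _ _ h0 m0_le st_bnd b _ _ xr.
have xr' : `|x| <= r by lra_ctx.
set y := foot h st b x in fr *.
have -> : dstep h t st dst b x - dst b y =
  ddamp h t st dst b y * (jac h st dst b x - 1)
  - h * (ax t y * vel st y + a t y * vel dst y).
  by rewrite /dstep -/y /ddamp; ring.
apply: (@le_trans _ _ (3 * m1 * (h * (L * m1)) + h * (L * m0 + L * m1))).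
  apply: le_normB.
    by apply: le_normM; [exact: ddamp_bnd3 | exact: jac_near1].
  apply: le_normMl => //; apply: le_normD; apply: le_normM.
  - exact: ax_bnd.
  - exact: le_vel.
  - exact: a_norm.
  - by apply: le_vel => b'; exact: dst_bnd.
have hL0 : 0 <= h * L by rewrite mulr_ge0.
have -> : 3 * m1 * (h * (L * m1)) + h * (L * m0 + L * m1) = (h * L) * (3 * m1 * m1 + m0 + m1) by ring.
have -> : 5 * L * h = (h * L) * 5 by ring.
by apply: ler_wpM2l => //; nra_ctx.
Qed.

Lemma step_time b x : `|x| <= r - 2 * h -> `|step h t st b x - st b x| <= 3 * L * h.
Proof.
move=> xr.
have fr := foot_in _ _ _ h0 m0_le st_bnd b _ _ xr.
have xr' : `|x| <= r by lra_ctx.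
have fn := foot_near _ _ _ h0 m0_le st_bnd b x.
rewrite /step /damp addrAC.
apply: (@le_trans _ _ (m1 * (2 * h) + h * (L * m0))).
  apply: le_normB; last by apply: le_normMl => //; exact: av_bnd.
  by apply: (le_trans (st_lip b _ _ fr xr')); rewrite ler_wpM2l.
have hL0 : 0 <= h * L by rewrite mulr_ge0.
by have : h <= h * L by [rewrite ler_peMr]; nra_ctx.
Qed.

Section with_modulus.
(** The derivatives vary by at most e over distances d. Since d <= e, displacements of size d are
    absorbed in e as well. *)
Variables d e : R.
Hypothesis de : d <= e.
Hypothesis dst_mod : forall b x y, `|x| <= r -> `|y| <= r -> `|x - y| <= d ->
  `|dst b x - dst b y| <= e.

(** Consistency with the transport equation: the mean value point lies within 2 h <= d of x, so
    replacing the derivative there by the one at x costs e. *)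
Lemma step_increment b x : `|x| <= r - 2 * h -> 2 * h <= d ->
  `|step h t st b x - st b x
    - h * (- (sg b * c (eta st x) * dst b x) - a t x * vel st x)|
  <= 4 * L * h * (e + h).
Proof.
move=> xr hd.
have fr := foot_in _ _ _ h0 m0_le st_bnd b _ _ xr.
have xr' : `|x| <= r by lra_ctx.
have fn := foot_near _ _ _ h0 m0_le st_bnd b x.
have [z [zr zx E]] := mean_value _ _ _ _ _ (fun z _ => std b z) xr' fr.
have /andP[c1 c2] := c_bnd _ (eta_bnd _ _ m0_le st_bnd x).
have yx : foot h st b x - x = - (sg b * h * c (eta st x)) by rewrite /foot; ring.
set y := foot h st b x in fr fn E zx yx *.
have -> : step h t st b x - st b x
    - h * (- (sg b * c (eta st x) * dst b x) - a t x * vel st x) =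
  h * (- (sg b * (c (eta st x) * (dst b z - dst b x))))
  - h * (a t y * vel st y - a t x * vel st x).
  have E' : st b y = st b x + dst b z * - (sg b * h * c (eta st x)).
    by rewrite -yx -E; ring.
  by rewrite /step -/y /damp E'; ring.
have e0 : 0 <= e by apply: le_trans de; apply: le_trans hd; rewrite mulr_ge0.
apply: (@le_trans _ _ (h * (2 * e) + h * (L * (m1 + m0) * (2 * h)))).
  apply: le_normB; apply: le_normMl => //.
    rewrite normrN; apply: le_norm_sg; apply: le_normM; first by rewrite ger0_norm; lra_ctx.
    by apply: dst_mod => //; lra_ctx.
  apply: (le_trans (av_lip t _ _ t0 fr xr')).
  rewrite subrr normr0 mulr0 addr0 ler_wpM2l// mulr_ge0//; lra_ctx.
have hL0 : 0 <= h * L by rewrite mulr_ge0.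
have hh : h * e <= h * L * e by rewrite ler_wpM2r// ler_peMr.
have : (h * L) * h * (m1 + m0) <= (h * L) * h * 2.
  by rewrite ler_wpM2l ?mulr_ge0//; lra_ctx.
by nra_ctx.
Qed.

Hypothesis d0 : 0 <= d.
Hypothesis e_ax : forall x y, `|x| <= r -> `|y| <= r -> `|x - y| <= d ->
  `|ax t x - ax t y| <= e.

Lemma ddamp_modulus b x y : `|x| <= r -> `|y| <= r -> `|x - y| <= d ->
  `|ddamp h t st dst b x - ddamp h t st dst b y| <= e * (1 + 4 * L * h).
Proof.
move=> xr yr xy.
have e0 : 0 <= e by exact: le_trans de.
have -> : ddamp h t st dst b x - ddamp h t st dst b y = (dst b x - dst b y)
  - h * ((ax t x * vel st x - ax t y * vel st y)
         + (a t x * vel dst x - a t y * vel dst y)) by rewrite /ddamp; ring.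
apply: (@le_trans _ _ (e + h * ((L * (m1 * d) + e * m0) + (L * e + L * d * m1)))).
  apply: le_normB; first exact: dst_mod.
  apply: le_normMl => //; apply: le_normD; apply: le_normMB.
  - exact: ax_bnd.
  - exact: le_vel.
  - exact: e_ax.
  - apply: le_velB => b'; apply: (le_trans (st_lip b' _ _ xr yr)).
    by rewrite ler_wpM2l.
  - exact: a_norm.
  - by apply: le_vel => b'; exact: dst_bnd.
  - by rewrite (le_trans (a_lip _ _ _ _ t0 t0))// subrr normr0 add0r ler_wpM2l.
  - by apply: le_velB => b'; exact: dst_mod.
have md : m1 * d <= e by rewrite (le_trans _ de)// ler_piMl.
have em0 : e * m0 <= L * e by rewrite mulrC ler_wpM2r//; lra_ctx.
have ? : L * (m1 * d) <= L * e by rewrite ler_wpM2l.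
have ? : L * d * m1 <= L * e by rewrite -mulrA [d * _]mulrC ler_wpM2l.
have -> : e * (1 + 4 * L * h) = e + h * (4 * (L * e)) by ring.
by rewrite lerD2l ler_wpM2l//; lra_ctx.
Qed.

Lemma jac_modulus b x y : `|x| <= r -> `|y| <= r -> `|x - y| <= d ->
  `|jac h st dst b x - jac h st dst b y| <= 2 * L * h * e.
Proof.
move=> xr yr xy.
have e0 : 0 <= e by exact: le_trans de.
have -> : jac h st dst b x - jac h st dst b y = - (sg b * (h *
  (dc (eta st x) * eta dst x - dc (eta st y) * eta dst y))) by rewrite /jac; ring.
rewrite normrN; apply: le_norm_sg.
have -> : 2 * L * h * e = h * (L * e + (L * e) * 1) by ring.
apply: le_normMl => //; apply: le_normMB.
- exact/dc_bnd/(eta_bnd _ _ m0_le st_bnd).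
- by apply: le_eta => b'; apply: le_trans m1_le1; exact: dst_bnd.
- rewrite (le_trans (dc_lip _ _ _ _)) ?(eta_bnd _ _ m0_le st_bnd)// ler_wpM2l//.
  apply: le_etaB => b'; rewrite (le_trans (st_lip _ _ _ xr yr))//.
  by apply: le_trans de; apply: le_trans xy; rewrite ler_piMl.
- by apply: le_etaB => b'; exact: dst_mod.
Qed.

(** The foot map stretches distances by at most 1 + L h, hence the smaller distance in the
    hypothesis. The modulus itself grows by a factor 1 + O(L h), so both losses stay bounded by
    exponentials of L n h after n steps. *)
Lemma dstep_modulus b x y : `|x| <= r - 2 * h -> `|y| <= r - 2 * h ->
  `|x - y| <= d / (1 + L * h) ->
  `|dstep h t st dst b x - dstep h t st dst b y| <= e * (1 + 15 * L * h).
Proof.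
move=> xr yr xy.
have e0 : 0 <= e by exact: le_trans de.
have hL0 : 0 <= L * h by rewrite mulr_ge0.
have xr' : `|x| <= r by lra_ctx.
have yr' : `|y| <= r by lra_ctx.
have fx := foot_in _ _ _ h0 m0_le st_bnd b _ _ xr.
have fy := foot_in _ _ _ h0 m0_le st_bnd b _ _ yr.
have xyd : `|x - y| <= d.
  by rewrite (le_trans xy)// ler_pdivrMr ?ler_peMr//; lra_ctx.
have fxy : `|foot h st b x - foot h st b y| <= d.
  have -> : foot h st b x - foot h st b y =
    (x - y) - sg b * (h * (c (eta st x) - c (eta st y))) by rewrite /foot; ring.
  apply: (@le_trans _ _ (`|x - y| + h * (L * `|x - y|))).
    apply: le_normB => //; apply: le_norm_sg; apply: le_normMl => //.
    apply: (le_trans (c_eta_lip _ _ xr' yr')); rewrite -mulrA ler_wpM2l//.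
    by rewrite ler_piMl.
  have -> : `|x - y| + h * (L * `|x - y|) = `|x - y| * (1 + L * h) by ring.
  by rewrite -ler_pdivlMr//; lra_ctx.
apply: (@le_trans _ _ (3 * (2 * L * h * e) + (e * (1 + 4 * L * h)) * (1 + h * L))).
  apply: le_normMB.
  - by apply: (le_trans (ddamp_bnd3 _ _ fx)); lra_ctx.
  - have -> : jac h st dst b y = 1 + (jac h st dst b y - 1) by ring.
    apply: le_normD; first by rewrite normr1.
    by apply: (le_trans (jac_near1 _ _ yr')); rewrite ler_wpM2l// ler_piMr.
  - exact: ddamp_modulus.
  - exact: jac_modulus.
have : (h * L) * (h * L) <= h * L by rewrite ler_piMl// mulr_ge0.
move=> H; have : e * ((h * L) * (h * L)) <= e * (h * L) by rewrite ler_wpM2l.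
by nra_ctx.
Qed.

(** Discrete form of Y' = - (a/2) Y + small terms. The increment of a eta / 2 contains h a q / 2,
    with q the derivative of the other invariant, and this cancels the coupling - h a q / 2 produced
    by the damping of the derivative. *)
Lemma dampedY_step b x : `|x| <= r - 2 * h -> 4 * h <= d ->
  `|dampedY (t + h) (step h t st) (dstep h t st dst) b x| <=
  (1 - h * a t (foot h st b x) / 2) * `|dampedY t st dst b (foot h st b x)|
  + h * (4 * L ^+ 2 * (m0 + m1 ^+ 2 + e + h)).
Proof.
move=> xr hd.
have e0 : 0 <= e by exact: le_trans de.
have xr' : `|x| <= r by lra_ctx.
have fr := foot_in _ _ _ h0 m0_le st_bnd b _ _ xr.
have fr2 := foot_in _ _ _ h0 m0_le st_bnd (~~ b) _ _ xr.
have fn := foot_near _ _ _ h0 m0_le st_bnd b x.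
have fn2 := foot_near _ _ _ h0 m0_le st_bnd (~~ b) x.
have [z [zr zx E]] := mean_value _ _ _ _ _ (fun z _ => std (~~ b) z) fr fr2.
have /andP[c1 c2] := c_bnd _ (eta_bnd _ _ m0_le st_bnd x).
have cc := c_eta_near1 x.
have x21 : foot h st (~~ b) x - foot h st b x = 2 * sg b * h * c (eta st x).
  by rewrite /foot /sg; case: (b) => /=; ring.
set y := foot h st b x in fr fn E zx x21 *.
set y2 := foot h st (~~ b) x in fr2 fn2 E zx x21 *.
have y21 : `|y2 - y| <= 4 * h.
  have -> : y2 - y = (y2 - x) - (y - x) by ring.
  by apply: (le_trans (le_normB _ _ _ _ fn2 fn)); lra_ctx.
have /andP[a0 aL] := a_bnd t y t0.
pose v w := a t w * vel st w.
(* Three errors in eta' = q: the speed differs from 1, q is taken at an intermediate point, and the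
   two invariants are damped at different feet. *)
pose E3 := (c (eta st x) - 1) * dst (~~ b) z + (dst (~~ b) z - dst (~~ b) y)
  - sg b / 2 * (v y2 - v y).
(* The two invariants meeting at x come from feet 2 h c apart. Moving the other one to the foot y by
   the mean value theorem yields h c q after halving: the discrete version of eta' = c q. *)
have etaS : eta (step h t st) x = eta st y + h * (dst (~~ b) y + E3).
  have E' : st (~~ b) y2 = st (~~ b) y + dst (~~ b) z * (2 * sg b * h * c (eta st x)).
    by rewrite -x21 -E; ring.
  rewrite (etaE _ b) (etaE _ b y) /step -/y -/y2 /damp E' /E3 /v.
  have := sgM (R := R) b; set s := sg b => ss.
  set C := c _; set Q := dst _ z; set q := dst _ y; set V := a t y * _; set V2 := a t y2 * _.
  apply/eqP; rewrite -subr_eq0; apply/eqP.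
  by transitivity ((s * s - 1) * (h * C * Q)); [field | rewrite ss subrr mul0r].
have E3_le : `|E3| <= L * m0 * m1 + e + 4 * L * h.
  apply: (@le_trans _ _ (L * m0 * m1 + e + 1 / 2 * (L * (m1 + m0) * (4 * h)))).
    apply: le_normB.
      apply: le_normD; first by apply: le_normM => //; exact: dst_bnd.
      by apply: dst_mod => //; rewrite (le_trans zx)// (le_trans y21).
    apply: le_normM.
      by rewrite normrM norm_sg ger0_norm ?invr_ge0// mul1r mul1r.
    apply: (le_trans (av_lip t _ _ t0 fr2 fr)).
    by rewrite subrr normr0 mulr0 addr0 ler_wpM2l// mulr_ge0//; lra_ctx.
  rewrite lerD2l; have : L * h * (m1 + m0) <= L * h * 2.
    by rewrite ler_wpM2l ?mulr_ge0//; lra_ctx.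
  by lra_ctx.
pose E4 := a (t + h) x - a t y.
have E4_le : `|E4| <= L * (3 * h).
  rewrite (le_trans (a_lip _ _ _ _ _ t0))// ?addr_ge0// ler_wpM2l//.
  rewrite addrAC subrr add0r ger0_norm// (distrC x).
  by lra_ctx.
pose E1 := ddamp h t st dst b y * (jac h st dst b x - 1) - h * (ax t y * vel st y).
have E1_le : `|E1| <= 3 * m1 * (h * (L * m1)) + h * (L * m0).
  apply: le_normB.
    by apply: le_normM; [exact: ddamp_bnd3 | exact: jac_near1].
  by apply: le_normMl => //; apply: le_normM; [exact: ax_bnd | exact: le_vel].
have eta1 : `|eta (step h t st) x| <= m0.
  by apply: le_eta => b'; apply: step_bnd.
(* Completing the factor of (1 - h a / 2) to Y leaves a^2 eta / 4. The other remainders are E3, the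
   Jacobian and a_x in E1, and in E4 the change of a between the foot and the new point. *)
have -> : dampedY (t + h) (step h t st) (dstep h t st dst) b x =
    (1 - h * a t y / 2) * dampedY t st dst b y
  + (h * (a t y * a t y * eta st y / 4) + h * (a t y / 2 * E3) + E1
     + E4 * eta (step h t st) x / 2).
  rewrite /dampedY.
  have -> : a (t + h) x * eta (step h t st) x / 2 =
    a t y * eta (step h t st) x / 2 + E4 * eta (step h t st) x / 2.
    by rewrite /E4; ring.
  rewrite [X in a t y * X / 2]etaS /E1.
  have -> : dstep h t st dst b x =
    ddamp h t st dst b y + ddamp h t st dst b y * (jac h st dst b x - 1).
    by rewrite /dstep -/y; ring.
  by rewrite {1}/ddamp (velE dst b); field.
have ha : h * a t y <= 1 by rewrite (le_trans _ hL)// ler_wpM2l.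
apply: le_normD; first by apply: le_normMl => //; lra_ctx.
apply: (@le_trans _ _ (h * (L * L * m0 / 4) + h * (L / 2 * (L * m0 * m1 + e + 4 * L * h))
   + (3 * m1 * (h * (L * m1)) + h * (L * m0)) + L * (3 * h) * m0 / 2)).
  apply: le_normD; last first.
    by apply: le_normM; [exact: le_normM | rewrite ger0_norm// invr_ge0].
  apply: le_normD => //; apply: le_normD; apply: le_normMl => //.
    apply: le_normM; last by rewrite ger0_norm// invr_ge0.
    apply: le_normM; last exact: le_eta.
    by apply: le_normM; exact: a_norm.
  by apply: le_normM => //; rewrite ger0_norm ?ler_wpM2r ?invr_ge0 ?divr_ge0.
set LHS := (X in X <= _).
have -> : LHS = h * (L ^+ 2 * m0 / 4 + 5 / 2 * (L * m0) + L ^+ 2 * (m0 * m1) / 2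
  + 3 * (L * m1 ^+ 2) + L * e / 2 + 2 * L ^+ 2 * h) by rewrite /LHS; field.
rewrite ler_wpM2l//.
have LL : L <= L ^+ 2 by rewrite expr2 ler_peMr.
have L20 : 0 <= L ^+ 2 by rewrite exprn_ge0.
have q1 : L * m0 <= L ^+ 2 * m0 by rewrite ler_wpM2r.
have q2 : L ^+ 2 * (m0 * m1) <= L ^+ 2 * m1 ^+ 2.
  by rewrite ler_wpM2l// expr2 ler_wpM2r.
have q3 : L * m1 ^+ 2 <= L ^+ 2 * m1 ^+ 2 by rewrite ler_wpM2r// exprn_ge0.
have q4 : L * e <= L ^+ 2 * e by rewrite ler_wpM2r.
have q5 : 0 <= L ^+ 2 * h by rewrite mulr_ge0.
have q6 : 0 <= L ^+ 2 * e by rewrite mulr_ge0.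
have q7 : 0 <= L ^+ 2 * m0 by rewrite mulr_ge0.
have q8 : 0 <= L ^+ 2 * m1 ^+ 2 by rewrite mulr_ge0// exprn_ge0.
by lra_ctx.
Qed.

End with_modulus.
End local_bounds.
End one_step.

Arguments step_bnd {R a ax c dc L eta0}.
Arguments foot_near {R a ax c dc L eta0} _ {h m0 st}.
Arguments foot_in {R a ax c dc L eta0} _ {h m0 st}.
Arguments step_derive {R a ax c dc L eta0} _ {h t m0 st}.
Arguments st_lip {R eta0 m0 m1 r st dst}.
Arguments c_eta_lip {R a ax c dc L eta0} _ {m0 m1 r st dst}.
Arguments av_lip {R a ax c dc L eta0} _ {t m0 m1 r st dst}.
Arguments step_time {R a ax c dc L eta0} _ {h t m0 m1 r st dst}.
Arguments step_increment {R a ax c dc L eta0} _ {h t m0 m1 r st dst}.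
Arguments dstep_foot {R a ax c dc L eta0} _ {h t m0 m1 r st dst}.
Arguments dstep_modulus {R a ax c dc L eta0} _ {h t m0 m1 r st dst}.
Arguments dampedY_step {R a ax c dc L eta0} _ {h t m0 m1 r st dst}.
Arguments eta_bnd {R eta0 m0 st}.
Arguments le_normMB {R x x' y y' X Y dX dY}.

(** * Local error of one step against two half steps *)

Section step_halving.
Context {R : realType}.
Variables (a ax : R -> R -> R) (c dc : R -> R) (L eta0 : R).
Hypothesis coefs : coef_bounds a ax c dc L eta0.

(** Feet and damping terms differ by h times O(h + E), which gives a local error O(h^2) and growth 1
    + O(h) of the old error. Derivative bounds are required of [g] alone: differences of [st] are
    routed through [g]. *)
Lemma two_half_steps (h t m0 m1 r E : R) (g dg st : bool -> R -> R) :
  0 <= h -> h * L <= 1 -> 0 <= t -> state_bounds eta0 m0 m1 r g dg ->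
  (forall b x, `|st b x| <= m0) -> 0 <= E ->
  (forall b x, `|x| <= r -> `|g b x - st b x| <= E) ->
  forall b x, `|x| <= r - 2 * h ->
  `|step a c (h / 2) (t + h / 2) (step a c (h / 2) t g) b x - step a c h t st b x|
    <= E * (1 + 10 * L ^+ 2 * h) + 10 * L ^+ 2 * h ^+ 2.
Proof.
move=> h0 hL t0 gP st_bnd E0 gst b x xr.
have [m0_le m01 m1_le1 g_bnd gd dg_bnd] := gP.
have L1 := coef_L _ _ _ _ _ _ coefs.
have L0 : 0 <= L by lra.
have m00 : 0 <= m0 by exact: le_trans (normr_ge0 _) (g_bnd true 0).
have m10 : 0 <= m1 by lra.
have h20 : 0 <= h / 2 by lra.
have hL2 : h / 2 * L <= 1 by have : 0 <= h * L; [rewrite mulr_ge0 | lra].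
have th0 : 0 <= t + h / 2 by lra.
have aL s y : 0 <= s -> `|a s y| <= L.
  by move=> s0; have /andP[? ?] := coef_a _ _ _ _ _ _ coefs s y s0; rewrite ger0_norm.
set g1 := step a c (h / 2) t g.
have g1_bnd b' y : `|g1 b' y| <= m0 by exact: (step_bnd coefs).
have g1g b' y : `|y| <= r - h -> `|g1 b' y - g b' y| <= 3 / 2 * L * h.
  move=> yr; have := step_time coefs h20 t0 gP b' y.
  rewrite (_ : r - 2 * (h / 2) = r - h); last by field.
  by rewrite (_ : 3 * L * (h / 2) = 3 / 2 * L * h); [exact | field].
have c_lip y z : `|y| <= eta0 -> `|z| <= eta0 -> `|c y - c z| <= L * `|y - z|.
  move=> yr zr; apply: (lipschitz_of_derive _ dc eta0) => //.
    exact: coef_cd coefs.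
  exact: coef_dc coefs.
pose x' := foot c h st b x.
pose z := foot c (h / 2) g1 b x.
pose y := foot c (h / 2) g b z.
have zx : `|z - x| <= h.
  by have := foot_near coefs h20 m0_le g1_bnd b x; rewrite -/z mulrCA divff ?mulr1 ?pnatr_eq0.
have yz : `|y - z| <= h.
  by have := foot_near coefs h20 m0_le g_bnd b z; rewrite -/y mulrCA divff ?mulr1 ?pnatr_eq0.
have x'x : `|x' - x| <= 2 * h by exact: (foot_near coefs h0 m0_le st_bnd).
have xr0 : `|x| <= r by lra.
have zr : `|z| <= r - h.
  by have := le_normD _ _ _ _ xr zx; rewrite [x + _]addrC subrK; lra.
have yr : `|y| <= r.
  by have := le_normD _ _ _ _ zr yz; rewrite [z + _]addrC subrK; lra.
have x'r : `|x'| <= r by exact: (foot_in coefs h0 m0_le st_bnd).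
(* Both feet are x displaced by h times a speed. Each half-step speed is compared with c (eta st x)
   by way of g at x, at a cost O(h) for moving and L E for changing the state. *)
have yx' : `|y - x'| <= h * L * E + 5 / 4 * L ^+ 2 * h ^+ 2.
  have -> : y - x' = - (sg b * (h / 2 *
     (((c (eta g1 x) - c (eta g x)) + (c (eta g x) - c (eta st x))) +
      ((c (eta g z) - c (eta g x)) + (c (eta g x) - c (eta st x)))))).
    by rewrite /y /foot -/(foot c (h / 2) g1 b x) -/z {1}/z /x' /foot; field.
  rewrite normrN; apply: le_norm_sg.
  apply: (@le_trans _ _ (h / 2 * ((L * (3 / 2 * L * h) + L * E) + (L * h + L * E)))).
    apply: le_normMl => //; apply: le_normD; apply: le_normD.
    - rewrite (le_trans (c_lip _ _ _ _)) ?(eta_bnd m0_le)// ler_wpM2l//.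
      by apply: le_etaB => b'; apply: g1g; lra.
    - rewrite (le_trans (c_lip _ _ _ _)) ?(eta_bnd m0_le)// ler_wpM2l//.
      by apply: le_etaB => b'; apply: gst.
    - rewrite (le_trans (c_eta_lip coefs gP _ _ _ _))//; first by lra.
      by rewrite -mulrA ler_wpM2l// (le_trans _ zx)// ler_piMl.
    - rewrite (le_trans (c_lip _ _ _ _)) ?(eta_bnd m0_le)// ler_wpM2l//.
      by apply: le_etaB => b'; apply: gst.
  have : L * h ^+ 2 <= L ^+ 2 * h ^+ 2 by rewrite ler_wpM2r ?exprn_ge0// expr2 ler_peMl.
  by lra.
have yx'4 : `|y - x'| <= 4 * h.
  have -> : y - x' = (y - z) + (z - x) - (x' - x) by ring.
  by apply: (le_trans (le_normB _ _ _ _ (le_normD _ _ _ _ yz zx) x'x)); lra.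
have zx' : `|z - x'| <= 3 * h.
  have -> : z - x' = (z - x) - (x' - x) by ring.
  by apply: (le_trans (le_normB _ _ _ _ zx x'x)); lra.
have gl b' u w : `|u| <= r -> `|w| <= r -> `|g b' u - g b' w| <= `|u - w|.
  by move=> ur wr; rewrite (le_trans (st_lip gP b' _ _ ur wr))// ler_piMl.
have -> : step a c (h / 2) (t + h / 2) g1 b x - step a c h t st b x =
   ((g b y - g b x') + (g b x' - st b x'))
   - (h / 2 * (a t y * vel g y - a t x' * vel st x')
      + h / 2 * (a (t + h / 2) z * vel g1 z - a t x' * vel st x')).
  by rewrite {1}/step -/z {1}/damp {1}/g1 {1}/step -/y /damp /step -/x' /damp; field.
apply: (@le_trans _ _ (((h * L * E + 5 / 4 * L ^+ 2 * h ^+ 2) + E) +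
  (h / 2 * (L * (4 * h + E) + L * (4 * h) * m0) +
   h / 2 * (L * (3 / 2 * L * h + (3 * h + E)) + L * (h / 2 + 3 * h) * m0)))).
  apply: le_normB.
    by apply: le_normD; [apply: (le_trans _ yx'); exact: gl | exact: gst].
  apply: le_normD; apply: le_normMl => //; apply: le_normMB; do ?exact: aL.
  - exact: le_vel.
  - rewrite (le_trans (coef_a_lip _ _ _ _ _ _ coefs _ _ _ _ t0 t0))//.
    by rewrite subrr normr0 add0r ler_wpM2l.
  - apply: le_velB => b'.
    have -> : g b' y - st b' x' = (g b' y - g b' x') + (g b' x' - st b' x') by ring.
    by apply: le_normD; [apply: (le_trans _ yx'4); exact: gl | exact: gst].
  - exact: le_vel.
  - rewrite (le_trans (coef_a_lip _ _ _ _ _ _ coefs _ _ _ _ th0 t0))// ler_wpM2l//.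
    by rewrite addrAC subrr add0r ger0_norm// lerD2l.
  - apply: le_velB => b'.
    have -> : g1 b' z - st b' x' = (g1 b' z - g b' z) + ((g b' z - g b' x') + (g b' x' - st b' x')) by ring.
    apply: le_normD; first exact: g1g.
    by apply: le_normD; [apply: (le_trans _ zx'); apply: gl => //; lra | exact: gst].
have LL : L <= L ^+ 2 by rewrite expr2 ler_peMr.
have m0_1 : m0 <= 1 by exact: le_trans m1_le1.
have q1 : L * h * E <= L ^+ 2 * h * E by rewrite ler_wpM2r// ler_wpM2r.
have q2 : L * h ^+ 2 <= L ^+ 2 * h ^+ 2 by rewrite ler_wpM2r// exprn_ge0.
have q3 : L * h ^+ 2 * m0 <= L * h ^+ 2 by rewrite ler_piMr// mulr_ge0// exprn_ge0.
have q4 : 0 <= L ^+ 2 * h * E by rewrite !mulr_ge0// exprn_ge0.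
have q5 : 0 <= L ^+ 2 * h ^+ 2 by rewrite mulr_ge0// exprn_ge0.
set LHS := (X in X <= _).
have -> : LHS = E + 2 * (L * h * E) + 5 / 4 * (L ^+ 2 * h ^+ 2)
  + 7 / 2 * (L * h ^+ 2) + 3 / 4 * (L ^+ 2 * h ^+ 2) + 15 / 4 * (L * h ^+ 2 * m0).
  by rewrite /LHS; field.
by lra.
Qed.

End step_halving.

(** * A priori bounds and equicontinuity *)

Section iteration.
Context {R : realType}.
Variables (a ax : R -> R -> R) (c dc : R -> R) (L eta0 : R).
Variables (init dinit : bool -> R -> R) (w : bool -> R -> R -> R).
Variables (m0 m1 mu N W h1 : R).
Implicit Types (b : bool) (h t x y T X e : R) (n j : nat).

Fixpoint scheme h n : (bool -> R -> R) * (bool -> R -> R) :=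
  if n is n'.+1 then
    let s := scheme h n' in
    (step a c h (n'%:R * h) s.1, dstep a ax c dc h (n'%:R * h) s.1 s.2)
  else (init, dinit).

Definition approx h n := (scheme h n).1.
Definition dapprox h n := (scheme h n).2.

(* radius at step n of the truncated cone over [-X, X] at time T: the
   characteristic speeds are at most 2 *)
Definition radius h T X n := X + 2 * (T - n%:R * h).

(** The invariant of the iteration is |Y| <= w N, with a weight w between W^-1 and W. [data_N0]
    gives it at time 0, [data_N1] makes the decay h mu / 4 absorb the source 16 L^2 m0, [data_WN]
    recovers the derivative from Y, and [data_m12] bounds the quadratic term by m0. [data_step] says
    that w is a discrete supersolution along every admissible slope: in the weight w, the variable
    damping a / 2 acts at least like mu / 4. *)
Record data_bounds : Prop := DataBounds {
  data_m0 : 0 < m0;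
  data_eta0 : m0 <= eta0;
  data_m1 : m1 <= 1;
  data_m12 : m1 ^+ 2 <= m0;
  data_N0 : 2 * L * m0 * W <= N;
  data_N1 : 64 * L ^+ 2 * m0 * W <= mu * N;
  data_WN : W * N + L * m0 <= m1;
  data_init : forall b x, `|init b x| <= m0;
  data_dinit : forall b x, `|dinit b x| <= m0;
  data_d : forall b (x : R), is_derive x 1 (init b) (dinit b x);
  data_mod : forall X e, 0 < e -> exists2 d : R, 0 < d & forall b x y,
    `|x| <= X -> `|y| <= X -> `|x - y| <= d -> `|dinit b x - dinit b y| <= e;
  data_ax_mod : forall T X e, 0 < e -> exists2 d : R, 0 < d & forall t x y, 0 <= t <= T ->
    `|x| <= X -> `|y| <= X -> `|x - y| <= d -> `|ax t x - ax t y| <= e;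
  data_W : 0 < W;
  data_w : forall b t x, 0 <= t -> W^-1 <= w b t x <= W;
  data_h1 : 0 < h1;
  data_mu : 0 < mu;
  data_step : forall h b t x k, 0 < h <= h1 -> 0 <= t -> 1 / 2 <= k <= 2 ->
    (1 - h * a t (x - sg b * h * k) / 2) * w b t (x - sg b * h * k) <=
    (1 - h * mu / 4) * w b (t + h) x
}.

Hypothesis coefs : coef_bounds a ax c dc L eta0.
Hypothesis data : data_bounds.

Let L1 : 1 <= L. Proof. exact: coef_L coefs. Qed.
Let L0 : 0 <= L. Proof. exact: le_trans L1. Qed.
Let m00 : 0 <= m0. Proof. exact: ltW (data_m0 data). Qed.
Let W0 : 0 < W. Proof. exact: data_W data. Qed.

Lemma natS_mul n h : n.+1%:R * h = n%:R * h + h.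
Proof. by rewrite -natr1 mulrDl mul1r. Qed.

Lemma radiusS h T X n : radius h T X n.+1 = radius h T X n - 2 * h.
Proof. by rewrite /radius natS_mul; ring. Qed.

Lemma U_bnd h n : 0 <= h -> h * L <= 1 -> forall b x, `|approx h n b x| <= m0.
Proof.
move=> h0 hL; elim: n => [|n IH] b x; first exact: data_init.
by apply: (step_bnd coefs) => //; rewrite mulr_ge0.
Qed.

Lemma U_derive h n : 0 <= h -> h * L <= 1 ->
  forall b (x : R), is_derive x 1 (approx h n b) (dapprox h n b x).
Proof.
move=> h0 hL; elim: n => [|n IH] b x; first exact: data_d.
apply: (step_derive coefs _ (data_eta0 data) (U_bnd h n h0 hL)) => //.
by rewrite mulr_ge0.
Qed.

Lemma expr1D_le_expR (u T : R) n h : 0 <= u -> 0 <= h -> n%:R * h <= T ->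
  (1 + u * h) ^+ n <= expR (u * T).
Proof.
move=> u0 h0 nh; apply: (@le_trans _ _ (expR (u * h) ^+ n)).
  rewrite lerXn2r ?nnegrE ?expR_ge0 ?expR_ge1Dx//.
  by rewrite addr_ge0// mulr_ge0.
by rewrite -expRM_natl ler_expR mulrCA ler_wpM2l.
Qed.

Lemma Y_P_bnd h n b x : 0 <= h -> h * L <= 1 ->
  `|dampedY a (n%:R * h) (approx h n) (dapprox h n) b x| <= w b (n%:R * h) x * N ->
  `|dapprox h n b x| <= m1.
Proof.
move=> h0 hL HY.
have nh0 : 0 <= n%:R * h by rewrite mulr_ge0.
have -> : dapprox h n b x = dampedY a (n%:R * h) (approx h n) (dapprox h n) b x
   - a (n%:R * h) x * eta (approx h n) x / 2 by rewrite /dampedY; ring.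
apply: (le_trans _ (data_WN data)); apply: le_normB.
  apply: (le_trans HY); have /andP[_ ?] := data_w data b _ x nh0.
  rewrite ler_wpM2r//; apply: le_trans (data_N0 data).
  by rewrite !mulr_ge0//; exact: ltW.
have /andP[? ?] := coef_a _ _ _ _ _ _ coefs _ x nh0.
apply: (@le_trans _ _ (L * m0 / 2)); last by rewrite ler_pdivrMr// ler_peMr ?mulr_ge0// ler1n.
apply: le_normM; last by rewrite ger0_norm.
apply: le_normM; first by rewrite ger0_norm.
by apply: le_eta => b'; exact: U_bnd.
Qed.

(** The modulus enters the source of Y, and the bound of Y enters the growth of the modulus; hence a
    single induction for both. The modulus starts at a value so small that its growth up to time T
    leaves it below e. *)
Lemma cone_bounds T X e : 0 <= T -> 0 <= X -> 0 < e ->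
  exists hs d : R, [/\ 0 < hs, hs * L <= 1, 0 < d, d <= e & forall h n, 0 < h <= hs ->
    n%:R * h <= T ->
    state_bounds eta0 m0 m1 (radius h T X n) (approx h n) (dapprox h n) /\
    forall b x y, `|x| <= radius h T X n -> `|y| <= radius h T X n -> `|x - y| <= d ->
      `|dapprox h n b x - dapprox h n b y| <= e].
Proof.
move=> T0 X0 ep.
have m0p := data_m0 data; have h1p := data_h1 data.
have mup := data_mu data.
(* With e1 <= m0 the modulus adds no more than m0 to the source of Y. *)
pose e1 := Num.min e m0.
have e1p : 0 < e1 by rewrite lt_min ep.
have [e1e e1m] : e1 <= e /\ e1 <= m0 by rewrite !ge_min !lexx orbT.
(* Total growth of the modulus and total stretching of distances up to time T, from the factors 1 +
   15 L h and 1 + L h of one step. *)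
pose K := expR (15 * L * T); pose K' := expR (L * T).
have Kp : 0 < K := expR_gt0 _; have K'p : 0 < K' := expR_gt0 _.
pose e0 := e1 / K.
have e0p : 0 < e0 by rewrite divr_gt0.
have [da da0 da_mod] := data_mod data (X + 2 * T) _ e0p.
have [db db0 db_mod] := data_ax_mod data T (X + 2 * T) _ e0p.
pose d0 := Num.min e0 (Num.min da db).
have d0p : 0 < d0 by rewrite !lt_min e0p da0.
have [d0e [d0a d0b]] : d0 <= e0 /\ (d0 <= da /\ d0 <= db).
  by rewrite !ge_min !lexx !orbT.
pose d := d0 / K'.
have dp : 0 < d by rewrite divr_gt0.
(* L^-1 is for the convex combinations, d / 4 because the feet of the two families are up to 4 h
   apart, and m0 to make the consistency error h one of the four terms of size m0. *)
pose hs := Num.min h1 (Num.min L^-1 (Num.min (d / 4) m0)).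
have hsp : 0 < hs by rewrite !lt_min h1p m0p invr_gt0 (lt_le_trans _ L1)//= divr_gt0.
have [hs1 [hs2 [hs3 hs4]]] : hs <= h1 /\ (hs <= L^-1 /\ (hs <= d / 4 /\ hs <= m0)).
  by rewrite !ge_min !lexx !orbT.
have Lp : 0 < L by exact: lt_le_trans L1.
have hsL : hs * L <= 1 by rewrite -ler_pdivlMr// div1r.
have K1 : 1 <= K by rewrite -expR0 ler_expR !mulr_ge0.
have K'1 : 1 <= K' by rewrite -expR0 ler_expR !mulr_ge0.
have e0e1 : e0 <= e1 by rewrite ler_pdivrMr// ler_peMr// ltW.
exists hs, d; split => //.
  apply: (@le_trans _ _ d0); first by rewrite ler_pdivrMr// ler_peMr// ltW.
  by lra.
move=> h n /andP[hp hhs]; have h0 := ltW hp.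
have hL : h * L <= 1 by apply: le_trans hsL; rewrite ler_wpM2r.
have Lh0 : 0 <= L * h by rewrite mulr_ge0.
pose en k := e0 * (1 + 15 * L * h) ^+ k.
pose dn k := d0 / (1 + L * h) ^+ k.
have en_le k : k%:R * h <= T -> en k <= e1.
  move=> kh; have -> : e1 = e0 * K by rewrite /e0 divfK// gt_eqF.
  rewrite ler_wpM2l ?(ltW e0p)//; apply: expr1D_le_expR => //.
  by rewrite mulr_ge0.
have dn_ge k : k%:R * h <= T -> d <= dn k.
  move=> kh; rewrite ler_wpM2l ?(ltW d0p)// lef_pV2 ?posrE ?exprn_gt0 ?ltr_wpDr//.
  exact: expr1D_le_expR.
have dn_d0 k : dn k <= d0.
  rewrite ler_pdivrMr ?exprn_gt0 ?ltr_wpDr//.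
  by rewrite ler_peMr ?(ltW d0p)// exprn_ege1// lerDl.
have dn_ge0 k : 0 <= dn k by rewrite divr_ge0 ?(ltW d0p)// exprn_ge0// addr_ge0.
have dnen k : dn k <= en k.
  apply: (le_trans (dn_d0 k)); apply: (le_trans d0e).
  by rewrite ler_peMr ?(ltW e0p)// exprn_ege1// lerDl !mulr_ge0.
have radle k : 0 <= k%:R * h -> radius h T X k <= X + 2 * T.
  by move=> ?; rewrite /radius; lra.
have Jst k : (forall b x, `|x| <= radius h T X k ->
      `|dampedY a (k%:R * h) (approx h k) (dapprox h k) b x| <= w b (k%:R * h) x * N) ->
    state_bounds eta0 m0 m1 (radius h T X k) (approx h k) (dapprox h k).
  move=> HY; split.
  - exact: data_eta0 data.
  - apply: (le_trans _ (data_WN data)).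
    have : m0 <= L * m0 by rewrite ler_peMl.
    have : 0 <= W * N.
      rewrite mulr_ge0 ?(ltW W0)//; apply: le_trans (data_N0 data).
      by rewrite !mulr_ge0// ltW.
    by lra.
  - exact: data_m1 data.
  - exact: U_bnd.
  - exact: U_derive.
  - by move=> b x /(HY b); apply: Y_P_bnd.
have J : n%:R * h <= T ->
  (forall b x, `|x| <= radius h T X n ->
      `|dampedY a (n%:R * h) (approx h n) (dapprox h n) b x| <= w b (n%:R * h) x * N) /\
  (forall b x y, `|x| <= radius h T X n -> `|y| <= radius h T X n -> `|x - y| <= dn n ->
      `|dapprox h n b x - dapprox h n b y| <= en n).
  elim: n => [|n IH] nT.
    split=> b x.
      move=> xr; rewrite mul0r /dampedY.
      have Nw : 2 * L * m0 <= w b 0 x * N.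
        have /andP[w1 _] := data_w data b 0 x (lexx _).
        apply: (@le_trans _ _ (W^-1 * N)); first by rewrite [W^-1 * N]mulrC ler_pdivlMr// (data_N0 data).
        rewrite ler_wpM2r//; apply: le_trans (data_N0 data).
        by rewrite !mulr_ge0// ltW.
      apply: (le_trans _ Nw); apply: (@le_trans _ _ (m0 + L * m0 / 2)).
        apply: le_normD; first exact: data_dinit.
        have /andP[? ?] := coef_a _ _ _ _ _ _ coefs 0 x (lexx _).
        apply: le_normM; last by rewrite ger0_norm.
        apply: le_normM; first by rewrite ger0_norm.
        by apply: le_eta => b'; exact: data_init.
      have : m0 <= L * m0 by rewrite ler_peMl.
      by lra.
    move=> y xr yr xy; rewrite /en expr0 mulr1; apply: da_mod.
    - by rewrite (le_trans xr)// radle// mul0r.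
    - by rewrite (le_trans yr)// radle// mul0r.
    - by rewrite (le_trans xy)// (le_trans (dn_d0 _)).
  have nT' : n%:R * h <= T by apply: le_trans nT; rewrite natS_mul lerDl.
  have nh0 : 0 <= n%:R * h by rewrite mulr_ge0.
  have [HY HM] := IH nT'.
  have stP := Jst n HY.
  split=> b x; rewrite radiusS => xr.
    rewrite natS_mul.
    have dn4 : 4 * h <= dn n.
      by rewrite (le_trans _ (dn_ge n nT'))// mulrC -ler_pdivlMr// (le_trans hhs).
    apply: (le_trans (dampedY_step coefs h0 hL nh0 stP _ _ (dnen n) HM (dn_ge0 n) b x xr dn4)).
    set y := foot _ _ _ _ _.
    have yr : `|y| <= radius h T X n.
      by apply: (foot_in coefs h0 (data_eta0 data) (U_bnd h n h0 hL)).
    have et0 : `|eta (approx h n) x| <= eta0 by exact: eta_bnd (data_eta0 data) (U_bnd h n h0 hL) x.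
    have hh1 : 0 < h <= h1 by rewrite hp (le_trans hhs).
    have Hw := data_step data h b (n%:R * h) x _ hh1 nh0 (coef_c _ _ _ _ _ _ coefs _ et0).
    rewrite -/(foot c h (approx h n) b x) -/y in Hw.
    have /andP[w1 w2] := data_w data b _ x (addr_ge0 nh0 h0).
    have N0 : 0 <= N by apply: le_trans (data_N0 data); rewrite !mulr_ge0// ltW.
    have nh1 : 0 <= 1 - h * a (n%:R * h) y / 2.
      have /andP[? ?] := coef_a _ _ _ _ _ _ coefs _ y nh0.
      have haL : h * a (n%:R * h) y <= h * L by rewrite ler_wpM2l.
      by rewrite subr_ge0 ler_pdivrMr// mul1r (le_trans haL)// (le_trans hL)// ler1n.
    have A1 : (1 - h * a (n%:R * h) y / 2) * `|dampedY a (n%:R * h) (approx h n) (dapprox h n) b y|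
       <= (1 - h * mu / 4) * w b (n%:R * h + h) x * N.
      apply: (@le_trans _ _ ((1 - h * a (n%:R * h) y / 2) * (w b (n%:R * h) y * N))).
        by rewrite ler_wpM2l// HY.
      by rewrite mulrA ler_wpM2r.
    (* The source is at most h mu w N / 4, exactly what the factor 1 - h mu / 4 of the previous
       bound has given up, so the sum is w N again. *)
    have A2 : 4 * L ^+ 2 * (m0 + m1 ^+ 2 + en n + h) <= mu * w b (n%:R * h + h) x * N / 4.
      apply: (@le_trans _ _ (16 * L ^+ 2 * m0)).
        rewrite [X in _ <= X](_ : _ = 4 * L ^+ 2 * (4 * m0)); last by ring.
        rewrite ler_wpM2l ?mulr_ge0 ?exprn_ge0//.
        have -> : 4 * m0 = m0 + m0 + m0 + m0 by ring.
        by rewrite !lerD// ?(data_m12 data)// ?(le_trans (en_le _ nT'))// (le_trans hhs).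
      rewrite ler_pdivlMr// (_ : 16 * L ^+ 2 * m0 * 4 = 64 * L ^+ 2 * m0); last by ring.
      apply: (@le_trans _ _ (mu * W^-1 * N)).
        by rewrite [mu * W^-1 * N]mulrAC ler_pdivlMr// (data_N1 data).
      by rewrite ler_wpM2r// ler_wpM2l// ltW.
    apply: (le_trans (lerD A1 (ler_wpM2l h0 A2))); rewrite le_eqVlt; apply/orP; left.
    by apply/eqP; field.
  move=> y yr xy; rewrite /en exprS mulrCA [(_ + _) * _]mulrC mulrC -/(en n) mulrC.
  apply: (dstep_modulus coefs h0 hL nh0 stP _ _ (dnen n) HM (dn_ge0 n)) => //.
    move=> u v ur vr uv; apply: (@le_trans _ _ e0).
      apply: (db_mod (n%:R * h)); first by rewrite nh0.
      - by rewrite (le_trans ur)// radle.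
      - by rewrite (le_trans vr)// radle.
      - by rewrite (le_trans uv)// (le_trans (dn_d0 _)).
    by rewrite ler_peMr ?(ltW e0p)// exprn_ege1// lerDl !mulr_ge0.
  by move: xy; rewrite /dn exprSr invfM mulrA.
move=> nT; have [HY HM] := J nT; split; first exact: Jst.
move=> b x y xr yr xy; apply: (@le_trans _ _ (en n)).
  by apply: HM => //; rewrite (le_trans xy)// dn_ge.
by rewrite (le_trans (en_le _ nT)).
Qed.

End iteration.

Section equicontinuity.
Context {R : realType}.
Variables (a ax : R -> R -> R) (c dc : R -> R) (L eta0 : R).
Variables (init dinit : bool -> R -> R) (w : bool -> R -> R -> R).
Variables (m0 m1 mu N W h1 : R).
Implicit Types (b : bool) (h t x y T X e : R) (n j : nat).

Hypothesis coefs : coef_bounds a ax c dc L eta0.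
Hypothesis data : data_bounds a ax L eta0 init dinit w m0 m1 mu N W h1.

Local Notation U := (approx a ax c dc init dinit).
Local Notation P := (dapprox a ax c dc init dinit).

Let L1 : 1 <= L. Proof. exact: coef_L coefs. Qed.
Let L0 : 0 <= L. Proof. exact: le_trans L1. Qed.
Let m0_le := data_eta0 _ _ _ _ _ _ _ _ _ _ _ _ _ data.
Let Ubnd := U_bnd _ _ _ _ _ _ _ _ _ _ _ _ _ _ _ coefs data.

(** Local errors O(h^2) over at most T / h steps add up to O(h). The derivative bounds come from the
    finer scheme, whose cone section at step 2 n is that of the coarse one at step n. *)
Lemma scheme_cauchy T X : 0 <= T -> 0 <= X ->
  exists hs K : R, [/\ 0 < hs, 0 <= K & forall h n b x, 0 < h <= hs -> n%:R * h <= T ->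
    `|x| <= radius h T X n -> `|U (h / 2) n.*2 b x - U h n b x| <= K * h].
Proof.
move=> T0 X0.
have [hs [d [hsp hsL _ _ H]]] := cone_bounds _ _ _ _ _ _ _ _ _ _ _ _ _ _ _
  coefs data _ _ _ T0 X0 ltr01.
exists hs, (expR (10 * L ^+ 2 * T)); split; rewrite ?expR_ge0 //.
move=> h n b x /andP[hp hhs] nT xr; have h0 := ltW hp.
have hL : h * L <= 1 by apply: le_trans hsL; rewrite ler_wpM2r.
have K0 : 0 <= 10 * L ^+ 2 by rewrite mulr_ge0// exprn_ge0.
have h20 : 0 < h / 2 <= hs by lra.
have h2L : h / 2 * L <= 1 by have : 0 <= h * L; [rewrite mulr_ge0 | lra].
have dbl k : k.*2%:R * (h / 2) = k%:R * h by rewrite -muln2 natrM; field.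
(* The right-hand side is the exact solution, starting from 0, of the error recursion of
   [two_half_steps]. *)
suff E : `|U (h / 2) n.*2 b x - U h n b x| <= h * ((1 + 10 * L ^+ 2 * h) ^+ n - 1).
  apply: (le_trans E); rewrite mulrC ler_wpM2r//.
  have := expr1D_le_expR _ T n h K0 h0 nT; lra.
elim: n b x nT xr => [|n IH] b x nT xr.
  rewrite (_ : _ - U h 0 b x = 0); last exact: subrr.
  by rewrite normr0 expr0 (subrr 1) mulr0.
have nT' : n%:R * h <= T by move: nT; rewrite natS_mul; lra.
have nh0 : 0 <= n%:R * h by rewrite mulr_ge0.
have [gP _] := H (h / 2) n.*2 h20 (eq_ind_r (fun z => z <= T) nT' (dbl n)).
have rE : radius (h / 2) T X n.*2 = radius h T X n by rewrite /radius dbl.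
rewrite rE in gP; rewrite radiusS in xr.
set E := h * ((1 + 10 * L ^+ 2 * h) ^+ n - 1) in IH *.
have E0 : 0 <= E.
  rewrite mulr_ge0// subr_ge0 exprn_ege1//.
  by have := mulr_ge0 K0 h0; lra.
have -> : h * ((1 + 10 * L ^+ 2 * h) ^+ n.+1 - 1) =
  E * (1 + 10 * L ^+ 2 * h) + 10 * L ^+ 2 * h ^+ 2 by rewrite /E exprS; ring.
have := two_half_steps _ _ _ _ _ _ coefs _ _ _ _ _ _ _ _ (U h n) h0 hL nh0 gP
  (Ubnd _ n h0 hL) E0 (fun b' x' => IH b' x' nT') b x xr.
suff -> : U (h / 2) n.+1.*2 = step a c (h / 2) (n%:R * h + h / 2)
    (step a c (h / 2) (n%:R * h) (U (h / 2) n.*2)) by [].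
by rewrite doubleS /approx /= -/(U (h / 2) n.*2) natS_mul dbl.
Qed.

Lemma speed_lip y z : `|y| <= eta0 -> `|z| <= eta0 -> `|c y - c z| <= L * `|y - z|.
Proof.
move=> yr zr; apply: (lipschitz_of_derive _ dc eta0) => //.
  exact: coef_cd coefs.
exact: coef_dc coefs.
Qed.

Definition rate h n b x :=
  - (sg b * c (eta (U h n) x) * P h n b x) - a (n%:R * h) x * vel (U h n) x.

(** Following the feet back through j steps changes the derivative by O(j h) and moves the point by
    at most 2 j h; the modulus in x then leads back to the original point. The expansion in time
    sums the consistency estimates, the rate being nearly constant meanwhile. *)
Lemma scheme_time_regular T X e : 0 <= T -> 0 <= X -> 0 < e ->
  exists hs d : R, [/\ 0 < hs, 0 < d & forall h n j b x, 0 < h <= hs ->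
    (n + j)%:R * h <= T -> j%:R * h <= d -> `|x| <= radius h T X (n + j) ->
    [/\ `|U h (n + j) b x - U h n b x| <= 3 * L * (j%:R * h),
        `|P h (n + j) b x - P h n b x| <= e,
        `|rate h (n + j) b x - rate h n b x| <= e &
        `|U h (n + j) b x - U h n b x - j%:R * h * rate h n b x| <= e * (j%:R * h)]].
Proof.
move=> T0 X0 ep.
(* Each step costs at most 8 L^2 e1 h by consistency and 6 L^2 e1 h by the drift of the rate,
   together less than e h. *)
pose e1 := e / (16 * L ^+ 2).
have L2 : 1 <= L ^+ 2 by rewrite exprn_ege1.
have e1p : 0 < e1 by rewrite divr_gt0//; lra.
have [hs [d [hsp hsL dp de H]]] := cone_bounds _ _ _ _ _ _ _ _ _ _ _ _ _ _ _
  coefs data _ _ _ T0 X0 e1p.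
pose hs' := Num.min hs (Num.min e1 (d / 2)).
(* d / 2 since feet move at speed up to 2, and e1 / (5 L) since the derivative drifts along
   characteristics at rate at most 5 L. *)
pose d' := Num.min (d / 2) (e1 / (5 * L)).
have Lp : 0 < L by exact: lt_le_trans L1.
have hsp' : 0 < hs' by rewrite !lt_min hsp e1p divr_gt0.
have dp' : 0 < d' by rewrite lt_min !divr_gt0 ?mulr_gt0.
have [hs1 [hs2 hs3]] : hs' <= hs /\ (hs' <= e1 /\ hs' <= d / 2).
  by rewrite !ge_min !lexx !orbT.
have [d1 d2] : d' <= d / 2 /\ d' <= e1 / (5 * L) by rewrite !ge_min !lexx !orbT.
have d3 : 5 * L * d' <= e1 by rewrite mulrC -ler_pdivlMr// mulr_gt0.
have LL : L <= L ^+ 2 by rewrite expr2 ler_peMr.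
have e1E : 16 * (L ^+ 2 * e1) = e.
  by rewrite /e1; field; rewrite gt_eqF.
exists hs', d'; split => // h n j b x /andP[hp hhs].
have h0 := ltW hp; have hhs' : 0 < h <= hs by rewrite hp (le_trans hhs).
have hL : h * L <= 1 by apply: le_trans hsL; rewrite ler_wpM2r//; lra.
have ge0 k : 0 <= k%:R * h by rewrite mulr_ge0.
have stepT k : k.+1%:R * h <= T -> k%:R * h <= T by rewrite natS_mul; lra.
have radle k i : radius h T X (k + i) <= radius h T X k.
  by rewrite /radius natrD mulrDl; have := ge0 i; lra.
have P_bnd k b' y : k%:R * h <= T -> `|y| <= radius h T X k -> `|P h k b' y| <= 1.
  move=> kT yr; have [[_ _ m11 _ _ Hp] _] := H h k hhs' kT.
  exact: le_trans (Hp b' y yr) m11.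
have Ulip i b' y : (n + i)%:R * h <= T -> `|y| <= radius h T X (n + i) ->
    `|U h (n + i) b' y - U h n b' y| <= 3 * L * (i%:R * h).
  elim: i => [|i IH]; first by rewrite addn0 subrr normr0 mul0r mulr0.
  rewrite addnS => iT; rewrite radiusS => yr.
  have [gP _] := H h (n + i)%N hhs' (stepT _ iT).
  rewrite (natS_mul i) mulrDr [X in _ <= X]addrC.
  have -> : U h (n + i).+1 b' y - U h n b' y =
    (U h (n + i).+1 b' y - U h (n + i) b' y) + (U h (n + i) b' y - U h n b' y) by ring.
  apply: le_normD; first exact: (step_time coefs h0 (ge0 _) gP).
  by apply: IH; [exact: stepT | lra].
have Pfoot i b' y : (n + i)%:R * h <= T -> `|y| <= radius h T X (n + i) ->
    exists z, [/\ `|z| <= radius h T X n, `|z - y| <= 2 * (i%:R * h) &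
      `|P h (n + i) b' y - P h n b' z| <= 5 * L * (i%:R * h)].
  elim: i y => [|i IH] y.
    by rewrite addn0 => iT yr; exists y; rewrite !subrr normr0 mul0r !mulr0.
  rewrite addnS => iT; rewrite radiusS => yr.
  have [gP _] := H h (n + i)%N hhs' (stepT _ iT).
  have fr := foot_in coefs h0 m0_le (Ubnd _ (n + i) h0 hL) b' _ _ yr.
  have fn := foot_near coefs h0 m0_le (Ubnd _ (n + i) h0 hL) b' y.
  have [z [zr zy zP]] := IH _ (stepT _ iT) fr.
  exists z; split => //.
    have -> : z - y = (z - foot c h (U h (n + i)) b' y) + (foot c h (U h (n + i)) b' y - y) by ring.
    by rewrite (natS_mul i) mulrDr le_normD.
  rewrite (natS_mul i) mulrDr [X in _ <= X]addrC.
  have -> : P h (n + i).+1 b' y - P h n b' z =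
    (P h (n + i).+1 b' y - P h (n + i) b' (foot c h (U h (n + i)) b' y)) +
    (P h (n + i) b' (foot c h (U h (n + i)) b' y) - P h n b' z) by ring.
  by apply: le_normD => //; exact: (dstep_foot coefs h0 hL (ge0 _) gP).
have Pmod i b' y : (n + i)%:R * h <= T -> i%:R * h <= d' -> `|y| <= radius h T X (n + i) ->
    `|P h (n + i) b' y - P h n b' y| <= 2 * e1.
  move=> iT id yr; have [z [zr zy zP]] := Pfoot i b' y iT yr.
  have -> : P h (n + i) b' y - P h n b' y =
    (P h (n + i) b' y - P h n b' z) + (P h n b' z - P h n b' y) by ring.
  have nT : n%:R * h <= T by apply: le_trans iT; rewrite natrD mulrDl lerDl.
  have [_ Hm] := H h n hhs' nT.
  apply: (@le_trans _ _ (5 * L * (i%:R * h) + e1)).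
    apply: le_normD => //; apply: Hm => //; first exact: le_trans yr (radle _ _).
    by apply: (le_trans zy); lra.
  have : 5 * L * (i%:R * h) <= 5 * L * d' by rewrite ler_wpM2l// mulr_ge0.
  by lra.
have ratemod i b' y : (n + i)%:R * h <= T -> i%:R * h <= d' -> `|y| <= radius h T X (n + i) ->
    `|rate h (n + i) b' y - rate h n b' y| <= 6 * (L ^+ 2 * e1).
  move=> iT id yr.
  have nT : n%:R * h <= T by apply: le_trans iT; rewrite natrD mulrDl lerDl.
  have yr' := le_trans yr (radle _ _).
  have et k : `|eta (U h k) y| <= eta0 by exact: eta_bnd m0_le (Ubnd _ k h0 hL) y.
  have -> : rate h (n + i) b' y - rate h n b' y =
   - (sg b' * (c (eta (U h (n + i)) y) * P h (n + i) b' y - c (eta (U h n) y) * P h n b' y))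
   - (a ((n + i)%:R * h) y * vel (U h (n + i)) y - a (n%:R * h) y * vel (U h n) y).
    by rewrite /rate; ring.
  have m01 : m0 <= 1 := le_trans m0_le (coef_eta0 _ _ _ _ _ _ coefs).
  have aP k := coef_a _ _ _ _ _ _ coefs _ y (ge0 k).
  apply: (@le_trans _ _ ((2 * (2 * e1) + L * (3 * L * (i%:R * h)) * 1)
    + (L * (3 * L * (i%:R * h)) + L * (i%:R * h) * 1))).
    apply: le_normB.
      rewrite normrN; apply: le_norm_sg; apply: le_normMB.
      - have /andP[? ?] := coef_c _ _ _ _ _ _ coefs _ (et (n + i)%N).
        by rewrite ger0_norm//; lra.
      - exact: P_bnd.
      - rewrite (le_trans (speed_lip _ _ (et _) (et _)))// ler_wpM2l//.
        by apply: le_etaB => b''; exact: Ulip.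
      - exact: Pmod.
    apply: le_normMB.
    - by have /andP[? ?] := aP (n + i)%N; rewrite ger0_norm.
    - by apply: (le_trans _ m01); apply: le_vel => b''; exact: Ubnd.
    - rewrite (le_trans (coef_a_lip _ _ _ _ _ _ coefs _ _ _ _ (ge0 _) (ge0 _)))//.
      rewrite ler_wpM2l// subrr normr0 addr0 natrD mulrDl addrAC subrr add0r ger0_norm//.
    - by apply: le_velB => b''; exact: Ulip.
  have ih : 0 <= i%:R * h by [].
  have q1 : L * (i%:R * h) <= L * d' by rewrite ler_wpM2l.
  have q2 : L * (L * (i%:R * h)) <= L * (L * d') by rewrite ler_wpM2l.
  have q3 : L * (5 * L * d') <= L * e1 by rewrite ler_wpM2l.
  have q4 : L * e1 <= L ^+ 2 * e1 by rewrite ler_wpM2r// ltW.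
  have q5 : e1 <= L * e1 by rewrite ler_peMl// ltW.
  by lra.
have Uinc i b' y : (n + i)%:R * h <= T -> i%:R * h <= d' -> `|y| <= radius h T X (n + i) ->
    `|U h (n + i) b' y - U h n b' y - i%:R * h * rate h n b' y| <= e * (i%:R * h).
  elim: i => [|i IH]; first by rewrite addn0 subrr !mul0r subrr normr0 mulr0.
  rewrite addnS => iT; rewrite radiusS => id yr.
  have id' : i%:R * h <= d' by apply: le_trans id; rewrite natS_mul lerDl.
  have yr' : `|y| <= radius h T X (n + i) by lra.
  have [gP Hm] := H h (n + i)%N hhs' (stepT _ iT).
  have -> : U h (n + i).+1 b' y - U h n b' y - i.+1%:R * h * rate h n b' y =
    (U h (n + i) b' y - U h n b' y - i%:R * h * rate h n b' y) +
    ((U h (n + i).+1 b' y - U h (n + i) b' y - h * rate h (n + i) b' y)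
     + h * (rate h (n + i) b' y - rate h n b' y)).
    by rewrite (natS_mul i); ring.
  rewrite (natS_mul i) [e * (_ + _)]mulrDr; apply: le_normD; first exact: IH (stepT _ iT) id' yr'.
  apply: (@le_trans _ _ (4 * L * h * (e1 + h) + h * (6 * (L ^+ 2 * e1)))).
    apply: le_normD.
      by apply: (step_increment coefs h0 (ge0 _) gP _ _ de Hm) => //; lra.
    apply: le_normMl => //; exact: ratemod (stepT _ iT) id' yr'.
  rewrite -e1E.
  have q1 : L * h * (e1 + h) <= L ^+ 2 * h * (e1 + e1).
    have he1 : h <= e1 := le_trans hhs hs2.
    apply: ler_pM; rewrite ?mulr_ge0 ?ler_wpM2r ?lerD2l//.
    by rewrite addr_ge0// (ltW e1p).
  have q2 : 0 <= L ^+ 2 * h * e1.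
    by apply: mulr_ge0 (ltW e1p); apply: mulr_ge0 h0; rewrite exprn_ge0.
  by lra.
move=> jT jd xr; split.
- exact: Ulip.
- have q5 : e1 <= L ^+ 2 * e1 by rewrite ler_peMl// ltW.
  by apply: (le_trans (Pmod _ _ _ jT jd xr)); lra.
- have q5 : e1 <= L ^+ 2 * e1 by rewrite ler_peMl// ltW.
  by apply: (le_trans (ratemod _ _ _ jT jd xr)); lra.
- exact: Uinc.
Qed.

End equicontinuity.

(** * Limit of the scheme *)

Section sequences_of_reals.
Context {R : realType}.
Implicit Types (u v : nat -> R) (x y e : R).

Lemma cauchy_seq_cvg u :
  (forall e, 0 < e -> exists N, forall n m, (N <= n)%N -> (N <= m)%N -> `|u n - u m| <= e) ->
  cvg (u @ \oo).
Proof.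
move=> H; apply: cauchy_cvg; apply: cauchy_exP => e e0.
have [N HN] := H (e / 2) (divr_gt0 e0 (ltr0n _ 2)).
exists (u N); exists N => // n /= Nn; rewrite /ball/=.
apply: le_lt_trans (HN _ _ (leqnn N) Nn) _; lra.
Qed.

Lemma cvg_norm_le u x e N : u @ \oo --> x ->
  (forall n, (N <= n)%N -> `|u n| <= e) -> `|x| <= e.
Proof.
move=> ux H; apply: (ler_cvg_to (cvg_norm ux) (cvg_cst e)).
by exists N.
Qed.

Definition dyadic k : R := 2^-1 ^+ k.

Lemma dyadic_gt0 k : 0 < dyadic k.
Proof. by rewrite exprn_gt0. Qed.

Lemma dyadicS k : dyadic k.+1 = dyadic k / 2.
Proof. by rewrite /dyadic exprSr. Qed.

Lemma dyadic_small e : 0 < e -> exists N, forall k, (N <= k)%N -> dyadic k <= e.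
Proof.
move=> e0; exists (Num.trunc e^-1) => k Nk.
have e1 : 0 <= e^-1 by rewrite invr_ge0 ltW.
have /andP[_ He] := truncn_itv e1.
rewrite /dyadic exprVn -[e]invrK lef_pV2 ?posrE ?invr_gt0 ?exprn_gt0//.
apply: (le_trans (ltW He)); rewrite -natrX ler_nat.
by apply: (leq_ltn_trans Nk); apply: ltn_expl.
Qed.

Lemma geometric_cauchy u K N : 0 <= K ->
  (forall k, (N <= k)%N -> `|u k.+1 - u k| <= K * dyadic k) -> cvg (u @ \oo).
Proof.
move=> K0 H.
have E k i : (N <= k)%N -> `|u (k + i)%N - u k| <= 2 * K * (dyadic k - dyadic (k + i)).
  move=> Nk; elim: i => [|i IH]; first by rewrite addn0 !subrr normr0 mulr0.
  have -> : u (k + i.+1)%N - u k = (u (k + i).+1 - u (k + i)%N) + (u (k + i)%N - u k).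
    by rewrite addnS; ring.
  apply: (le_trans (le_normD _ _ _ _ (H _ (leq_trans Nk (leq_addr i k))) IH)).
  by rewrite addnS dyadicS; lra.
have E2 k i : (N <= k)%N -> `|u (k + i)%N - u k| <= 2 * K * dyadic k.
  move=> Nk; apply: (le_trans (E k i Nk)); rewrite ler_wpM2l ?mulr_ge0//.
  by have := dyadic_gt0 (k + i); lra.
apply: cauchy_seq_cvg => e e0.
have K4 : 0 < 4 * K + 1 by lra.
have [N2 HN2] := dyadic_small (e / (4 * K + 1)) (divr_gt0 e0 K4).
exists (maxn N N2) => n m Nn Nm.
have NN : (N <= maxn N N2)%N by rewrite leq_maxl.
have -> : u n - u m = (u n - u (maxn N N2)) - (u m - u (maxn N N2)) by ring.
apply: (@le_trans _ _ (2 * K * dyadic (maxn N N2) + 2 * K * dyadic (maxn N N2))).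
  by apply: le_normB; [rewrite -(subnKC Nn) | rewrite -(subnKC Nm)]; apply: E2.
have d2 := HN2 _ (leq_maxr N N2); have dp := dyadic_gt0 (maxn N N2).
have : dyadic (maxn N N2) * (4 * K + 1) <= e by rewrite -ler_pdivlMr//; lra.
by lra.
Qed.

Definition tick k (t : R) : nat := Num.trunc (t / dyadic k).

Lemma tick_itv k t : 0 <= t ->
  (tick k t)%:R * dyadic k <= t /\ t < (tick k t)%:R * dyadic k + dyadic k.
Proof.
move=> t0; have h0 := dyadic_gt0 k.
have /andP[] := @truncn_itv R (t / dyadic k) (divr_ge0 t0 (ltW h0)).
rewrite -/(tick k t) ler_pdivlMr// ltr_pdivrMr// => ? ?; split=> //.
by rewrite -natS_mul.
Qed.

Lemma tick0 k : tick k 0 = 0%N.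
Proof. by rewrite /tick mul0r; apply: truncn0. Qed.

Lemma tick_mono k (t t' : R) : t <= t' -> (tick k t <= tick k t')%N.
Proof. by move=> tt; apply: le_truncn; rewrite ler_wpM2r// invr_ge0 ltW// dyadic_gt0. Qed.

(** Rounding down to the finer grid may gain one half step over the coarse grid; convergence has to
    pay for that extra step. *)
Lemma tick_double k t : 0 <= t ->
  exists2 i, (i <= 1)%N & tick k.+1 t = ((tick k t).*2 + i)%N.
Proof.
move=> t0; have h0 := dyadic_gt0 k.
have [A B] := tick_itv k t t0; have [C D] := tick_itv k.+1 t t0.
set n := tick k t in A B *; set m := tick k.+1 t in C D *.
move: C D; rewrite dyadicS => C D.
have nm : (n.*2 < m.+1)%N.
  rewrite -(ltr_nat R) -muln2 natrM -(ltr_pM2r h0) -[m.+1%:R]natr1.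
  have -> : n%:R * 2 * dyadic k = 2 * (n%:R * dyadic k) by ring.
  have -> : (m%:R + 1) * dyadic k = 2 * (m%:R * (dyadic k / 2) + dyadic k / 2) by field.
  by lra.
have mn : (m < n.*2.+2)%N.
  rewrite -doubleS -(ltr_nat R) -muln2 natrM -(ltr_pM2r h0) -[n.+1%:R]natr1.
  have -> : (n%:R + 1) * 2 * dyadic k = 2 * (n%:R * dyadic k + dyadic k) by ring.
  have -> : m%:R * dyadic k = 2 * (m%:R * (dyadic k / 2)) by field.
  by lra.
exists (m - n.*2)%N; last by rewrite subnKC.
by rewrite leq_subLR addn1.
Qed.

Lemma tick_cvg t : 0 <= t -> (tick k t)%:R * dyadic k @[k --> \oo] --> t.
Proof.
move=> t0; apply/cvgrPdist_le => e e0; have [N HN] := dyadic_small e e0.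
exists N => // k /= Nk; have [A B] := tick_itv k t t0.
by have := HN k Nk; rewrite ger0_norm; lra.
Qed.

End sequences_of_reals.

Section limit_of_scheme.
Context {R : realType}.
Variables (a ax : R -> R -> R) (c dc : R -> R) (L eta0 : R).
Variables (init dinit : bool -> R -> R) (w : bool -> R -> R -> R).
Variables (m0 m1 mu N W h1 : R).
Implicit Types (b : bool) (h t x y T X e : R) (n j k : nat).

Hypothesis coefs : coef_bounds a ax c dc L eta0.
Hypothesis data : data_bounds a ax L eta0 init dinit w m0 m1 mu N W h1.

Let L1 : 1 <= L. Proof. exact: coef_L coefs. Qed.
Let L0 : 0 <= L. Proof. exact: le_trans L1. Qed.

Definition approx_at k b t x := approx a ax c dc init dinit (dyadic k) (tick k t) b x.
Definition dapprox_at k b t x := dapprox a ax c dc init dinit (dyadic k) (tick k t) b x.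
Definition rate_at k b t x := rate a ax c dc init dinit (dyadic k) (tick k t) b x.

(** Everything that passes to the limit, at real times and uniformly in k >= M. The time increment s
    is measured on the grid and tends to t' - t. *)
Lemma scheme_dyadic_bounds T X e : 0 <= T -> 0 <= X -> 0 < e ->
  exists (M : nat) (d : R), 0 < d /\ forall k t b x, (M <= k)%N -> 0 <= t <= T -> `|x| <= X ->
    [/\ `|approx_at k b t x| <= m0, `|dapprox_at k b t x| <= m1,
      (forall y, `|y| <= X -> `|y - x| <= d ->
         `|dapprox_at k b t y - dapprox_at k b t x| <= e /\
         `|approx_at k b t y - approx_at k b t x - (y - x) * dapprox_at k b t x| <= e * `|y - x|),
      (forall t', t <= t' <= T -> t' - t <= d ->
         [/\ `|dapprox_at k b t' x - dapprox_at k b t x| <= e, `|rate_at k b t' x - rate_at k b t x| <= e &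
         let s := (tick k t')%:R * dyadic k - (tick k t)%:R * dyadic k in
         `|approx_at k b t' x - approx_at k b t x - s * rate_at k b t x| <= e * s]) &
      eta0 >= `|eta (fun b => approx_at k b t) x|].
Proof.
move=> T0 X0 e0.
have [hs [d [hsp hsL dp _ H]]] := cone_bounds _ _ _ _ _ _ _ _ _ _ _ _ _ _ _
  coefs data _ _ _ T0 X0 e0.
have [hs' [d' [hsp' dp' H']]] := scheme_time_regular _ _ _ _ _ _ _ _ _ _ _ _ _ _ _
  coefs data _ _ _ T0 X0 e0.
(* Rounding both times to the grid can lengthen the interval by one step; steps below d' / 2 and
   intervals below d' / 2 leave room for that. *)
have hm : 0 < Num.min (Num.min hs hs') (d' / 2) by rewrite !lt_min hsp hsp' divr_gt0.
have [M HM] := dyadic_small _ hm.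
exists M, (Num.min d (d' / 2)); split; first by rewrite lt_min dp divr_gt0.
move=> k t b x Mk /andP[t0 tT] xX.
have h0 := dyadic_gt0 (R := R) k.
have [hhs hhs' hd'] : [/\ dyadic k <= hs, dyadic k <= hs' & dyadic k <= d' / 2].
  by have := HM k Mk; rewrite !le_min => /andP[/andP[? ?] ?].
have hin : 0 < (dyadic k : R) <= hs by apply/andP.
have hin' : 0 < (dyadic k : R) <= hs' by apply/andP.
have [tk1 tk2] := tick_itv k t t0.
have nT : (tick k t)%:R * dyadic k <= T by lra.
have rad n y : n%:R * dyadic k <= T -> `|y| <= X -> `|y| <= radius (dyadic k) T X n.
  by move=> ? ?; rewrite /radius; lra.
have [stP Hm] := H _ _ hin nT.
have [? ? m11 Ubnd Ud Pbnd] := stP.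
split.
- exact: Ubnd.
- by apply: Pbnd; exact: rad.
- move=> y yX; rewrite le_min => /andP[yx _].
  split; first by apply: Hm => //; exact: rad.
  have [z [zX zx ->]] := mean_value _ _ _ _ _ (fun z _ => Ud b z) xX yX.
  have -> : dapprox a ax c dc init dinit (dyadic k) (tick k t) b z * (y - x) - (y - x) * dapprox_at k b t x =
    (dapprox a ax c dc init dinit (dyadic k) (tick k t) b z - dapprox_at k b t x) * (y - x) by ring.
  apply: le_normM => //; apply: Hm; [exact: rad|exact: rad|exact: le_trans yx].
- move=> t' /andP[tt' t'T]; rewrite le_min => /andP[_ td].
  have t'0 := le_trans t0 tt'.
  have [tk1' tk2'] := tick_itv k t' t'0.
  have jE := subnKC (tick_mono k _ _ tt').
  set j := (tick k t' - tick k t)%N in jE.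
  have sE : (tick k t')%:R * dyadic k - (tick k t)%:R * dyadic k = j%:R * dyadic k :> R.
    have -> : (tick k t')%:R = (tick k t)%:R + j%:R :> R by rewrite -natrD jE.
    by ring.
  have n'T : (tick k t')%:R * dyadic k <= T by exact: le_trans t'T.
  have jd : j%:R * dyadic k <= d' by rewrite -sE; lra.
  rewrite sE /approx_at /dapprox_at /rate_at -jE in n'T *.
  by have [_ ? ? ?] := H' _ _ _ b x hin' n'T jd (rad _ _ n'T xX).
- exact: eta_bnd (data_eta0 _ _ _ _ _ _ _ _ _ _ _ _ _ data) Ubnd x.
Qed.

(** Consecutive dyadic approximations differ by the halving error at a common grid time plus at most
    one further half step, both O(2^-k), hence summable. *)
Lemma V_cvg b t x : 0 <= t -> cvg (approx_at k b t x @[k --> \oo]).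
Proof.
move=> t0; have X0 := normr_ge0 x.
have [hs [K [hsp K0 H]]] := scheme_cauchy _ _ _ _ _ _ _ _ _ _ _ _ _ _ _
  coefs data _ _ t0 X0.
have [hs' [d' [hsp' dp' H']]] := scheme_time_regular _ _ _ _ _ _ _ _ _ _ _ _ _ _ _
  coefs data _ _ _ t0 X0 ltr01.
have hm : 0 < Num.min (Num.min hs hs') d' by rewrite !lt_min hsp hsp'.
have [M HM] := dyadic_small _ hm.
apply: (@geometric_cauchy _ _ (3 * L + K) M); first by rewrite addr_ge0 ?mulr_ge0.
move=> k Mk.
have h0 := dyadic_gt0 (R := R) k; have h20 := dyadic_gt0 (R := R) k.+1.
have [hhs hhs' hd'] : [/\ dyadic k <= hs, dyadic k.+1 <= hs' & dyadic k.+1 <= d'].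
  have := HM k Mk; have := HM k.+1 (leqW Mk).
  by rewrite !le_min => /andP[/andP[? ?] ?] /andP[/andP[? ?] ?].
have hin : 0 < (dyadic k : R) <= hs by apply/andP.
have hin' : 0 < (dyadic k.+1 : R) <= hs' by apply/andP.
have [i i1 iE] := tick_double k t t0.
have [tk1 _] := tick_itv k t t0; have [tk1' _] := tick_itv k.+1 t t0.
have rad h n : n%:R * h <= t -> `|x| <= radius h t `|x| n.
  by move=> ?; rewrite /radius; lra.
have ih : i%:R * dyadic k.+1 <= dyadic k.+1 :> R.
  by rewrite ler_piMl ?(ltW h20)// lern1.
have A : `|approx a ax c dc init dinit (dyadic k / 2) (tick k t).*2 b x - approx_at k b t x| <= K * dyadic k.
  by apply: H => //; exact: rad.
rewrite -dyadicS in A; rewrite iE in tk1'.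
have [B _ _ _] := H' _ _ _ b x hin' tk1' (le_trans ih hd') (rad _ _ tk1').
rewrite /approx_at iE.
have -> : approx a ax c dc init dinit (dyadic k.+1) ((tick k t).*2 + i) b x -
  approx a ax c dc init dinit (dyadic k) (tick k t) b x =
  (approx a ax c dc init dinit (dyadic k.+1) ((tick k t).*2 + i) b x -
   approx a ax c dc init dinit (dyadic k.+1) (tick k t).*2 b x) +
  (approx a ax c dc init dinit (dyadic k.+1) (tick k t).*2 b x - approx_at k b t x) by rewrite /approx_at; ring.
rewrite mulrDl; apply: le_normD => //; apply: (le_trans B).
rewrite ler_wpM2l ?mulr_ge0//; apply: (le_trans ih).
by rewrite dyadicS; lra.
Qed.

(** The comparison of steps controls the approximations, not their derivatives. By equicontinuity,
    however, each derivative is close to the difference quotient over one fixed increment s, and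
    these quotients converge. *)
Lemma Q_cvg b t x : 0 <= t -> cvg (dapprox_at k b t x @[k --> \oo]).
Proof.
move=> t0; apply: cauchy_seq_cvg => e e0.
have X0 : 0 <= `|x| + 1 by rewrite addr_ge0.
have e4 : 0 < e / 4 by rewrite divr_gt0.
have [M [d [dp H]]] := scheme_dyadic_bounds _ _ _ t0 X0 e4.
pose s := Num.min d 1.
have sp : 0 < s by rewrite lt_min dp ltr01.
have [sd s1] : s <= d /\ s <= 1 by rewrite !ge_min !lexx orbT.
have yX : `|x + s| <= `|x| + 1 by apply: le_normD => //; rewrite ger0_norm// ltW.
have xX : `|x| <= `|x| + 1 by rewrite lerDl.
have sE : x + s - x = s by ring.
have C1 := V_cvg b t x t0; have C2 := V_cvg b t (x + s) t0.
(* Two such errors and the expansion error s e / 4 make s e / 2; comparing two indices gives s e. *)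
have se : 0 < s * (e / 8) by rewrite mulr_gt0// divr_gt0.
have [M1 _ HM1] : \forall k \near \oo, `|lim (approx_at k b t x @[k --> \oo]) - approx_at k b t x| <= s * (e / 8).
  by have /cvgrPdist_le/(_ _ se) := C1.
have [M2 _ HM2] : \forall k \near \oo, `|lim (approx_at k b t (x + s) @[k --> \oo]) - approx_at k b t (x + s)| <= s * (e / 8).
  by have /cvgrPdist_le/(_ _ se) := C2.
set l1 := lim _ in HM1; set l2 := lim _ in HM2.
have E k : (maxn M (maxn M1 M2) <= k)%N -> `|s * dapprox_at k b t x - (l2 - l1)| <= s * (e / 2).
  rewrite !geq_max => /andP[Mk /andP[M1k M2k]].
  have [_ _ HQ _ _] := H k t b x Mk (introT andP (conj t0 (lexx t))) xX.
  have [|_ HV] := HQ _ yX; first by rewrite sE ger0_norm// ltW.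
  rewrite sE (ger0_norm (ltW sp)) in HV.
  have -> : s * dapprox_at k b t x - (l2 - l1) =
    (l1 - approx_at k b t x) - (l2 - approx_at k b t (x + s))
    - (approx_at k b t (x + s) - approx_at k b t x - s * dapprox_at k b t x) by ring.
  apply: (le_trans (le_normB _ _ _ _ (le_normB _ _ _ _ (HM1 k M1k) (HM2 k M2k)) HV)).
  by lra.
exists (maxn M (maxn M1 M2)) => n m Mn Mm.
rewrite -(ler_pM2l sp) -{1}(gtr0_norm sp) -normrM.
have -> : s * (dapprox_at n b t x - dapprox_at m b t x) =
  (s * dapprox_at n b t x - (l2 - l1)) - (s * dapprox_at m b t x - (l2 - l1)) by ring.
by apply: (le_trans (le_normB _ _ _ _ (E n Mn) (E m Mm))); lra.
Qed.

Definition lim_inv b t x := lim (approx_at k b t x @[k --> \oo]).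
Definition lim_dx b t x := lim (dapprox_at k b t x @[k --> \oo]).
(** Defined by the right-hand side of the transport equation; proving that it is the time derivative
    of [lim_inv] amounts to solving the equation. *)
Definition lim_dt b t x :=
  - (sg b * c (eta (fun b => lim_inv b t) x) * lim_dx b t x) - a t x * vel (fun b => lim_inv b t) x.

Let f_cvg b t x : 0 <= t -> approx_at k b t x @[k --> \oo] --> lim_inv b t x.
Proof. by move=> t0; exact: V_cvg. Qed.

Let p_cvg b t x : 0 <= t -> dapprox_at k b t x @[k --> \oo] --> lim_dx b t x.
Proof. by move=> t0; exact: Q_cvg. Qed.

Lemma f_bnd b t x : 0 <= t -> `|lim_inv b t x| <= m0.
Proof.
move=> t0; have [M [d [_ H]]] := scheme_dyadic_bounds _ _ _ t0 (normr_ge0 x) ltr01.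
apply: (cvg_norm_le _ _ _ M (f_cvg b t x t0)) => k Mk.
by have [] := H k t b x Mk (introT andP (conj t0 (lexx t))) (lexx _).
Qed.

Lemma p_bnd b t x : 0 <= t -> `|lim_dx b t x| <= m1.
Proof.
move=> t0; have [M [d [_ H]]] := scheme_dyadic_bounds _ _ _ t0 (normr_ge0 x) ltr01.
apply: (cvg_norm_le _ _ _ M (p_cvg b t x t0)) => k Mk.
by have [] := H k t b x Mk (introT andP (conj t0 (lexx t))) (lexx _).
Qed.

Let G_cvg b t x : 0 <= t -> rate_at k b t x @[k --> \oo] --> lim_dt b t x.
Proof.
move=> t0.
have et : `|eta (fun b => lim_inv b t) x| <= eta0.
  apply: (le_trans _ (data_eta0 _ _ _ _ _ _ _ _ _ _ _ _ _ data)).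
  by apply: le_eta => b'; exact: f_bnd.
have etc : eta (fun b => approx_at k b t) x @[k --> \oo] --> eta (fun b => lim_inv b t) x.
  by apply: cvgMr_tmp; apply: cvgB; exact: f_cvg.
have vec : vel (fun b => approx_at k b t) x @[k --> \oo] --> vel (fun b => lim_inv b t) x.
  by apply: cvgMr_tmp; apply: cvgD; exact: f_cvg.
have cc : c (eta (fun b => approx_at k b t) x) @[k --> \oo] --> c (eta (fun b => lim_inv b t) x).
  apply: continuous_cvg etc; apply/differentiable_continuous/derivable1_diffP.
  exact: (@ex_derive _ _ _ _ _ _ _ (coef_cd _ _ _ _ _ _ coefs _ et)).
have ac : a ((tick k t)%:R * dyadic k) x @[k --> \oo] --> a t x.
  apply/cvgrPdist_le => e e0.
  have eL : 0 < e / L by rewrite divr_gt0// (lt_le_trans _ L1).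
  have /cvgrPdist_le/(_ _ eL)[M _ HM] := tick_cvg t t0.
  exists M => // k /= Mk.
  have h0 := dyadic_gt0 (R := R) k.
  rewrite (le_trans (coef_a_lip _ _ _ _ _ _ coefs _ _ _ _ t0 _))//.
    by rewrite mulr_ge0// ltW.
  rewrite subrr normr0 addr0 mulrC -ler_pdivlMr ?(lt_le_trans _ L1)//.
  exact: HM.
apply: cvgB; last exact: cvgM.
apply: cvgN; apply: cvgM; last exact: p_cvg.
by apply: cvgMl_tmp.
Qed.

Lemma f_init b x : lim_inv b 0 x = init b x.
Proof.
apply/cvg_lim => //; rewrite (_ : (fun k => approx_at k b 0 x) = fun=> init b x); first exact: cvg_cst.
by apply/funext => k; rewrite /approx_at tick0.
Qed.

Lemma limit_regular T X e : 0 <= T -> 0 <= X -> 0 < e ->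
  exists2 d : R, 0 < d & forall t b x, 0 <= t <= T -> `|x| <= X ->
    (forall y, `|y| <= X -> `|y - x| <= d ->
       `|lim_dx b t y - lim_dx b t x| <= e /\
       `|lim_inv b t y - lim_inv b t x - (y - x) * lim_dx b t x| <= e * `|y - x|) /\
    (forall t', 0 <= t' <= T -> `|t' - t| <= d ->
       `|lim_dx b t' x - lim_dx b t x| <= e /\
       `|lim_inv b t' x - lim_inv b t x - (t' - t) * lim_dt b t x| <= e * `|t' - t|).
Proof.
move=> T0 X0 e0.
have e2 : 0 < e / 2 by rewrite divr_gt0.
have [M [d [dp H]]] := scheme_dyadic_bounds _ _ _ T0 X0 e2.
have fwd t t' b x : 0 <= t -> t <= t' <= T -> `|x| <= X -> t' - t <= d ->
  [/\ `|lim_dx b t' x - lim_dx b t x| <= e / 2, `|lim_dt b t' x - lim_dt b t x| <= e / 2 &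
    `|lim_inv b t' x - lim_inv b t x - (t' - t) * lim_dt b t x| <= e / 2 * (t' - t)].
  move=> t0 /andP[tt' t'T] xX td; have t'0 := le_trans t0 tt'.
  have tin : 0 <= t <= T by rewrite t0 (le_trans tt').
  have tin' : t <= t' <= T by rewrite tt'.
  have E k : (M <= k)%N -> _ := fun Mk =>
    let: And5 _ _ _ C _ := H k t b x Mk tin xX in C t' tin' td.
  split.
  - apply: (cvg_norm_le _ _ _ M (cvgB (p_cvg b t' x t'0) (p_cvg b t x t0))) => k Mk.
    by have [] := E k Mk.
  - apply: (cvg_norm_le _ _ _ M (cvgB (G_cvg b t' x t'0) (G_cvg b t x t0))) => k Mk.
    by have [] := E k Mk.
  - have sc : (tick k t')%:R * dyadic k - (tick k t)%:R * dyadic k @[k --> \oo] --> t' - t.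
      by apply: cvgB; exact: tick_cvg.
    have sc2 := cvgMl_tmp (a := e / 2) sc.
    have fc : approx_at k b t' x - approx_at k b t x - ((tick k t')%:R * dyadic k - (tick k t)%:R * dyadic k)
        * rate_at k b t x @[k --> \oo] --> lim_inv b t' x - lim_inv b t x - (t' - t) * lim_dt b t x.
      apply: cvgB; first by apply: cvgB; exact: f_cvg.
      by apply: cvgM => //; exact: G_cvg.
    refine (ler_cvg_to (cvg_norm fc) (sc2 _) _).
    by exists M => // k /= Mk; have [] := E k Mk.
exists d => // t b x /andP[t0 tT] xX; have tin : 0 <= t <= T by rewrite t0.
split.
  move=> y yX yx.
  have E k : (M <= k)%N -> _ := fun Mk =>
    let: And5 _ _ C _ _ := H k t b x Mk tin xX in C y yX yx.
  split.
    apply: (@le_trans _ _ (e / 2)); last by lra.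
    apply: (cvg_norm_le _ _ _ M (cvgB (p_cvg b t y t0) (p_cvg b t x t0))) => k Mk.
    by have [] := E k Mk.
  apply: (@le_trans _ _ (e / 2 * `|y - x|)); last by rewrite ler_wpM2r//; lra.
  apply: (cvg_norm_le _ _ _ M (cvgB (cvgB (f_cvg b t y t0) (f_cvg b t x t0))
      (cvgMl_tmp (p_cvg b t x t0)))) => k Mk.
  by have [] := E k Mk.
move=> t' /andP[t'0 t'T] td.
have [tt'|/ltW t't] := leP t t'.
  rewrite ger0_norm ?subr_ge0// in td *.
  have [|A _ B] := fwd t t' b x t0 _ xX td; first by rewrite tt'.
  split; first by apply: (le_trans A); lra.
  by apply: (le_trans B); rewrite ler_wpM2r ?subr_ge0//; lra.
(* The scheme only gives forward increments. For t' < t the expansion is taken at t', and the rate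
   there is exchanged for the one at t, which explains the tolerance e / 2 in [fwd]. *)
rewrite distrC ger0_norm ?subr_ge0// in td *.
have [|A B C] := fwd t' t b x t'0 _ xX td; first by rewrite t't.
split; first by rewrite distrC; apply: (le_trans A); lra.
have -> : lim_inv b t' x - lim_inv b t x - (t' - t) * lim_dt b t x =
  - ((lim_inv b t x - lim_inv b t' x - (t - t') * lim_dt b t' x) - (t - t') * (lim_dt b t x - lim_dt b t' x)) by ring.
rewrite normrN (_ : e * (t - t') = e / 2 * (t - t') + (t - t') * (e / 2)); last by field.
by apply: le_normB => //; apply: le_normMl; rewrite ?subr_ge0.
Qed.

End limit_of_scheme.

(** * The hodograph functions *)

Section hodograph.
Context {R : realType}.
Variable k : R.
Hypothesis k0 : 0 < k.
Implicit Types e u : R.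

(* With k = (gamma - 1) / 2: [riem u] is the integral of the sound speed
   s `^ (- (k + 1)) from 1 to u, [vol] is its inverse, and [speed] is the sound
   speed as a function of [riem u]. *)
Definition riem u := (1 - u `^ (- k)) / k.
Definition vol e := (1 - k * e) `^ (- k^-1).
Definition speed e := (1 - k * e) `^ (1 + k^-1).
Definition dspeed e := - (k + 1) * (1 - k * e) `^ k^-1.

Local Ltac lra_k := have ? := k0; lra.

Let kn0 : k != 0. Proof. exact: lt0r_neq0. Qed.

Lemma affine_derive e : is_derive e 1 (fun e => 1 - k * e) (- k).
Proof.
rewrite [X in is_derive _ _ X _](_ : _ = cst 1 - k *: id); last by apply/funext.
by apply: is_derive_eq; rewrite /GRing.scale/= mulr1 sub0r.
Qed.

Let affine_powR_derive q e : 0 < 1 - k * e ->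
  is_derive e 1 ((fun x => x `^ q) \o (fun e => 1 - k * e))
    (q * (1 - k * e) `^ (q - 1) * - k).
Proof.
move=> z0; apply: (@is_derive1_comp _ _ _ _ _ (- k)); first exact: is_derive1_powR.
exact: affine_derive.
Qed.

Lemma speed_derive e : 0 < 1 - k * e -> is_derive e 1 speed (dspeed e).
Proof.
move=> z0; have H := affine_powR_derive (1 + k^-1) e z0.
apply: (is_derive_eq H); rewrite /dspeed (_ : 1 + k^-1 - 1 = k^-1); last by ring.
by rewrite -mulrA mulrC; set y := _ `^ _; field.
Qed.

Lemma dspeed_derive e : 0 < 1 - k * e ->
  is_derive e 1 dspeed ((k + 1) * (1 - k * e) `^ (k^-1 - 1)).
Proof.
move=> z0; have H := affine_powR_derive k^-1 e z0.
rewrite /dspeed [X in is_derive _ _ X _](_ : _ =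
  - (k + 1) *: ((fun x => x `^ k^-1) \o (fun e => 1 - k * e))); last by apply/funext.
by apply: is_derive_eq; rewrite /GRing.scale/=; set y := _ `^ _; field.
Qed.

Lemma vol_gt0 e : 0 < 1 - k * e -> 0 < vol e.
Proof. by move=> z0; rewrite powR_gt0. Qed.

Lemma vol_derive e : 0 < 1 - k * e -> is_derive e 1 vol (speed e)^-1.
Proof.
move=> z0; have H := affine_powR_derive (- k^-1) e z0.
apply: (is_derive_eq H); rewrite /speed -powRN (_ : - k^-1 - 1 = - (1 + k^-1)); last by ring.
by set y := _ `^ _; field.
Qed.

Lemma riem_derive u : 0 < u -> is_derive u 1 riem (u `^ (- (k + 1))).
Proof.
move=> u0; have H := is_derive1_powR (- k) u0.
rewrite /riem [X in is_derive _ _ X _](_ : _ =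
  k^-1 *: (cst 1 - (fun x => x `^ (- k)))); last first.
  by apply/funext => x /=; rewrite mulrC.
apply: is_derive_eq; rewrite /GRing.scale/= (_ : - k - 1 = - (k + 1)); last by ring.
by set y := _ `^ _; field.
Qed.

Lemma affine_riem u : 1 - k * riem u = u `^ (- k).
Proof. by rewrite /riem; field. Qed.

Lemma affine_riem_gt0 u : 0 < u -> 0 < 1 - k * riem u.
Proof. by move=> u0; rewrite affine_riem powR_gt0. Qed.

Lemma riemK u : 0 < u -> vol (riem u) = u.
Proof.
by move=> u0; rewrite /vol affine_riem -powRrM mulrNN divff// powRr1// ltW.
Qed.

Lemma volK e : 0 < 1 - k * e -> riem (vol e) = e.
Proof.
move=> z0; rewrite /riem /vol -powRrM mulrNN mulVf// powRr1; last exact: ltW.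
by field.
Qed.

Lemma speed_riem u : 0 < u -> speed (riem u) = u `^ (- (k + 1)).
Proof.
move=> u0; rewrite /speed affine_riem -powRrM; congr (_ `^ _); by field.
Qed.

Lemma riem1 : riem 1 = 0.
Proof. by rewrite /riem powR1 subrr mul0r. Qed.

Lemma speed0 : speed 0 = 1.
Proof. by rewrite /speed mulr0 subr0 powR1. Qed.

Lemma pressure_derive u : 0 < u ->
  is_derive u 1 (pressure (2 * k + 1)) (- (u `^ (- (k + 1))) ^+ 2).
Proof.
move=> u0; have H := is_derive1_powR (- (2 * k + 1)) u0.
have g0 : 2 * k + 1 != 0 by apply: lt0r_neq0; lra_k.
rewrite /pressure [X in is_derive _ _ X _](_ : _ =
  (2 * k + 1)^-1 *: (fun x => x `^ (- (2 * k + 1)))); last first.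
  by apply/funext => x /=; rewrite mulrC.
apply: is_derive_eq; rewrite /GRing.scale/= expr2 -powRD; last by apply/implyP => _; rewrite gt_eqF.
rewrite (_ : - (2 * k + 1) - 1 = - (k + 1) - (k + 1)); last by ring.
by set y := _ `^ _; field.
Qed.

Lemma dspeed_bound e : `|k * e| <= 1 / 2 ->
  `|dspeed e| <= (k + 1) * 2 `^ k^-1.
Proof.
rewrite ler_norml => /andP[e1 e2].
apply: le_normM; first by rewrite normrN ger0_norm//; lra_k.
rewrite ger0_norm ?powR_ge0// ge0_ler_powR ?nnegrE ?invr_ge0 ?(ltW k0)//; lra_k.
Qed.

(** The exponent k^-1 - 1 may have either sign; splitting off (1 - k e)^-1 <= 2 leaves a power with
    positive exponent, which is monotone. *)
Lemma ddspeed_bound e : `|k * e| <= 1 / 2 ->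
  `|(k + 1) * (1 - k * e) `^ (k^-1 - 1)| <= 2 * ((k + 1) * 2 `^ k^-1).
Proof.
rewrite ler_norml => /andP[e1 e2].
have z0 : 0 < 1 - k * e by lra_k.
rewrite powRD; last by apply/implyP => _; rewrite gt_eqF.
rewrite powRN powRr1 ?(ltW z0)// mulrA mulrC.
apply: le_normM.
  rewrite gtr0_norm ?invr_gt0// -[leRHS]invrK lef_pV2 ?posrE//; lra_k.
apply: le_normM; first by rewrite ger0_norm; lra_k.
rewrite ger0_norm ?powR_ge0// ge0_ler_powR ?nnegrE ?invr_ge0 ?(ltW k0)//; lra_k.
Qed.

Lemma speed_bounds : exists eta0 K : R, [/\ 0 < eta0 <= 1, k * eta0 <= 1 / 2, 1 <= K &
  [/\ forall e, `|e| <= eta0 -> is_derive e 1 speed (dspeed e),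
      forall e, `|e| <= eta0 -> 1 / 2 <= speed e <= 2,
      forall e, `|e| <= eta0 -> `|dspeed e| <= K &
      forall e e', `|e| <= eta0 -> `|e'| <= eta0 ->
        `|dspeed e - dspeed e'| <= K * `|e - e'|]].
Proof.
pose K := 2 * ((k + 1) * 2 `^ k^-1).
have p2 : 1 <= 2 `^ k^-1 :> R.
  by rewrite -[X in X <= _](powRr0 2) ler_powR ?invr_ge0 ?(ltW k0)//; lra_k.
have K1 : 2 <= K by have := k0; rewrite /K; nra.
(* 1 / (2 k) keeps 1 - k e away from 0, and 1 / (2 K) keeps the speed within 1/2 of its value 1 at e
   = 0. *)
pose eta0 := Num.min 1 (Num.min (1 / (2 * k)) (1 / (2 * K))).
have K0 : 0 < K by lra_k.
have k20 : 0 < 2 * k by rewrite mulr_gt0.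
have e0 : 0 < eta0 by rewrite !lt_min ltr01 !divr_gt0// mulr_gt0.
have [e1 [e2 e3]] : eta0 <= 1 /\ (eta0 <= 1 / (2 * k) /\ eta0 <= 1 / (2 * K)).
  by rewrite !ge_min !lexx !orbT.
have ke : k * eta0 <= 1 / 2.
  by move: e2; rewrite ler_pdivlMr//; lra_k.
have Ke : K * eta0 <= 1 / 2.
  by move: e3; rewrite ler_pdivlMr ?mulr_gt0//; lra_k.
have small e : `|e| <= eta0 -> `|k * e| <= 1 / 2.
  move=> ee; apply: (le_trans _ ke); apply: le_normMl => //; exact: ltW.
have pos e : `|e| <= eta0 -> 0 < 1 - k * e.
  by move=> /small; rewrite ler_norml => /andP[? ?]; lra_k.
have dK e : `|e| <= eta0 -> `|dspeed e| <= K.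
  by move=> /small/dspeed_bound H; move: H K0; rewrite /K; lra_k.
exists eta0, K; split=> //; first by rewrite e0.
- by lra_k.
split=> //.
- by move=> e /pos; exact: speed_derive.
- move=> e ee.
  have H := lipschitz_of_derive speed dspeed eta0 K 0 e (fun z zz => speed_derive _ (pos z zz)) dK.
  have : `|speed e - speed 0| <= 1 / 2.
    apply: (le_trans (H _ ee)); first by rewrite normr0 ltW.
    by rewrite subr0 (le_trans _ Ke)// ler_wpM2l// ltW.
  by rewrite speed0 ler_norml => /andP[? ?]; lra_k.
- move=> e e' ee ee'.
  apply: (lipschitz_of_derive dspeed (fun e => (k + 1) * (1 - k * e) `^ (k^-1 - 1)) eta0).
  + by move=> z /pos; exact: dspeed_derive.
  + by move=> z /small; exact: ddspeed_bound.
  + exact: ee'.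
  + exact: ee.
Qed.

End hodograph.

(** * Partial derivatives on the half-plane *)

Section partial_derivatives.
Context {R : realType} {V : normedModType R}.
Implicit Types (A : set V) (e p q : V) (f : V -> R) (l : R).

(** The derivative relative to A with the increment multiplied out: h = 0 is harmless, and the
    expansions of the limit functions have this very form. *)
Definition has_partial A e f p l := forall eps : R, 0 < eps ->
  exists2 d : R, 0 < d & forall h : R, `|h| <= d -> A (h *: e + p) ->
    `|f (h *: e + p) - f p - h * l| <= eps * `|h|.

Lemma has_partial_cvg A e f p l :
  has_partial A e f p l <-> diff_quot f p e @ increments A p e --> l.
Proof.
have key h : h != 0 -> f (h *: e + p) - f p - h * l = - h * (l - diff_quot f p e h).
  by move=> h0; rewrite /diff_quot; field.
split=> [H|/cvgrPdist_le H].
  apply/cvgrPdist_le => eps eps0; have [d d0 Hd] := H eps eps0.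
  rewrite near_withinE near_withinE; apply/nbhs_ballP; exists d => // h.
  rewrite /ball/= sub0r normrN => hd h0 Ah.
  have := Hd h (ltW hd) Ah; rewrite key// normrM normrN mulrC.
  by rewrite ler_pM2r ?normr_gt0.
move=> eps eps0; have := H eps eps0; rewrite near_withinE near_withinE.
move=> /nbhs_ballP[d /= d0 Hd]; exists (d / 2) => [|h hd Ah]; first exact: divr_gt0.
have [->|h0] := eqVneq h 0; first by rewrite scale0r add0r mul0r !subrr normr0 mulr0.
rewrite key// normrM normrN mulrC ler_wpM2r//; apply: Hd => //.
by rewrite /ball/= sub0r normrN; lra.
Qed.

Lemma increments_proper A e p :
  (forall d : R, 0 < d -> exists h : R, [/\ h != 0, `|h| <= d & A (h *: e + p)]) ->
  ProperFilter (increments A p e).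
Proof.
move=> H; split; last exact: within_filter.
move=> /nbhs_ballP[d /= d0 Hd]; have [h [h0 hd Ah]] := H (d / 2) (divr_gt0 d0 (ltr0n _ 2)).
by apply: (Hd h) => //; rewrite /ball/= sub0r normrN; lra.
Qed.

Lemma has_partial_derive A e f p l : ProperFilter (increments A p e) ->
  has_partial A e f p l ->
  derivable_within A e f p /\ derive_within A e f p = l.
Proof.
move=> FF /has_partial_cvg H; split; first by apply/cvg_ex; exists l.
exact: cvg_lim.
Qed.

Lemma derivable_has_partial A e f p : derivable_within A e f p ->
  has_partial A e f p (derive_within A e f p).
Proof. by move=> H; apply/has_partial_cvg. Qed.

Lemma Cb_intro A f :
  (forall p, A p -> forall eps : R, 0 < eps -> exists2 d : R, 0 < d &
     forall q, A q -> `|q - p| <= d -> `|f q - f p| <= eps) ->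
  (exists M : R, forall p, A p -> `|f p| <= M) -> Cb A f.
Proof.
move=> H [M HM]; split.
  apply/subspace_continuousP => p Ap; apply/cvgrPdist_le => eps eps0.
  have [d d0 Hd] := H p Ap eps eps0.
  rewrite near_withinE; apply/nbhs_normP; exists d => // q /= qd Aq.
  by rewrite distrC; apply: Hd => //; rewrite distrC ltW.
exists M; split; first exact: num_real.
by move=> x Mx p Ap /=; rewrite (le_trans (HM p Ap))// ltW.
Qed.

Lemma Cb_bound A f : Cb A f -> exists M : R, forall p, A p -> `|f p| <= M.
Proof.
move=> [_ [M [_ HM]]]; exists (M + 1) => p Ap; apply: (HM (M + 1)) => //.
by rewrite ltrDl.
Qed.

Lemma Cb_modulus A f p (eps : R) : Cb A f -> A p -> 0 < eps ->
  exists2 d : R, 0 < d & forall q, A q -> `|q - p| <= d -> `|f q - f p| <= eps.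
Proof.
move=> [/subspace_continuousP/(_ p) H _] Ap eps0.
have /cvgrPdist_le/(_ _ eps0) := H Ap; rewrite near_withinE.
move=> /nbhs_normP[d /= d0 Hd]; exists (d / 2) => [|q Aq qp]; first exact: divr_gt0.
rewrite distrC; apply: Hd => //=; rewrite distrC; lra.
Qed.

End partial_derivatives.

Lemma is_derive_expansion {R : realType} (phi : R -> R) (x dphi eps : R) :
  is_derive x 1 phi dphi -> 0 < eps ->
  exists2 d : R, 0 < d & forall y, `|y - x| <= d ->
    `|phi y - phi x - (y - x) * dphi| <= eps * `|y - x|.
Proof.
move=> dp eps0.
have H : derivable_within setT (1 : R) phi x.
  by rewrite derivable_withinT; exact: ex_derive.
have [d d0 Hd] := derivable_has_partial _ _ _ _ H eps eps0.
exists d => // y yd; have := Hd (y - x) yd I.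
by rewrite derive_withinT derive_val /GRing.scale/= mulr1 subrK.
Qed.

Section partial_derivatives_operations.
Context {R : realType} {V : normedModType R}.
Implicit Types (A : set V) (e p q : V) (f : V -> R) (l : R).

(** Chain rule for derivatives relative to A, valid also on the line t = 0, where the inner
    derivative is one-sided. *)
Lemma has_partial_comp A e f p l (phi : R -> R) (dphi : R) :
  is_derive (f p) 1 phi dphi -> has_partial A e f p l ->
  has_partial A e (phi \o f) p (dphi * l).
Proof.
move=> dp H eps eps0.
have Hphi (eps' : R) (eps'0 : 0 < eps') := is_derive_expansion phi _ _ eps' dp eps'0.
(* A Lipschitz constant of f at p along e, once the expansion error is at most |h|. The added 1,
   here and with |dphi|, avoids division by zero. *)
pose K := `|l| + 1.
have K0 : 0 < K by rewrite ltr_wpDl.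
have e1 : 0 < eps / (2 * K) by rewrite divr_gt0// mulr_gt0.
have [d1 d10 Hd1] := Hphi _ e1.
pose e2 := Num.min 1 (eps / (2 * (`|dphi| + 1))).
have D0 : 0 < `|dphi| + 1 by rewrite ltr_wpDl.
have e20 : 0 < e2 by rewrite lt_min ltr01 divr_gt0// mulr_gt0.
have [e21 e22] : e2 <= 1 /\ e2 <= eps / (2 * (`|dphi| + 1)) by rewrite !ge_min !lexx orbT.
have [d2 d20 Hd2] := H _ e20.
exists (Num.min d2 (d1 / K)) => [|h]; first by rewrite lt_min d20 divr_gt0.
rewrite le_min => /andP[hd2 hd1] Ah; have B := Hd2 h hd2 Ah.
set y := f (h *: e + p) in B *.
have yK : `|y - f p| <= K * `|h|.
  have -> : y - f p = (y - f p - h * l) + h * l by ring.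
  apply: (@le_trans _ _ (1 * `|h| + `|h| * `|l|)); last by rewrite /K; lra.
  apply: le_normD; last by rewrite normrM.
  by apply: (le_trans B); rewrite ler_wpM2r.
have yd1 : `|y - f p| <= d1.
  by apply: (le_trans yK); rewrite mulrC -ler_pdivlMr.
have C := Hd1 y yd1.
have -> : phi y - phi (f p) - h * (dphi * l) =
  (phi y - phi (f p) - (y - f p) * dphi) + dphi * (y - f p - h * l) by ring.
apply: (@le_trans _ _ (eps / (2 * K) * (K * `|h|) + `|dphi| * (e2 * `|h|))).
  apply: le_normD; last by apply: le_normM.
  by apply: (le_trans C); rewrite ler_wpM2l// ltW.
have -> : eps / (2 * K) * (K * `|h|) = eps / 2 * `|h| by field; rewrite gt_eqF.
rewrite mulrA -mulrDl ler_wpM2r//.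
have : `|dphi| * e2 <= eps / 2; last by lra.
apply: (@le_trans _ _ ((`|dphi| + 1) * (eps / (2 * (`|dphi| + 1))))).
  by apply: ler_pM => //; [exact: ltW | rewrite lerDl].
rewrite le_eqVlt; apply/orP; left; apply/eqP; field.
by rewrite gt_eqF.
Qed.

Lemma has_partialD A e f g p l m (a b : R) : has_partial A e f p l ->
  has_partial A e g p m ->
  has_partial A e (fun q => a * f q + b * g q) p (a * l + b * m).
Proof.
move=> Hf Hg eps eps0.
pose K := `|a| + `|b| + 1.
have K0 : 0 < K by rewrite ltr_wpDl// addr_ge0.
have e1 : 0 < eps / K by rewrite divr_gt0.
have [d1 d10 H1] := Hf _ e1; have [d2 d20 H2] := Hg _ e1.
exists (Num.min d1 d2) => [|h]; first by rewrite lt_min d10.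
rewrite le_min => /andP[hd1 hd2] Ah.
set F := f _; set G := g _.
have -> : a * F + b * G - (a * f p + b * g p) - h * (a * l + b * m) =
  a * (F - f p - h * l) + b * (G - g p - h * m) by ring.
apply: (@le_trans _ _ (`|a| * (eps / K * `|h|) + `|b| * (eps / K * `|h|))).
  by apply: le_normD; apply: le_normM; rewrite ?H1 ?H2.
rewrite -mulrDl mulrA ler_wpM2r//.
apply: (@le_trans _ _ (K * (eps / K))); last by rewrite mulrCA divff ?mulr1// gt_eqF.
by rewrite ler_wpM2r ?(ltW e1)// /K lerDl.
Qed.

End partial_derivatives_operations.

Section halfplane_derivatives.
Context {R : realType}.
Implicit Types (f : R * R -> R) (t x l : R).

Lemma shift_t (h t x : R) : h *: ((1, 0) : R * R) + (t, x) = (h + t, x).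
Proof.
apply: injective_projections => /=.
  by rewrite [h *: _]mulr1.
by rewrite [h *: _]mulr0 add0r.
Qed.

Lemma shift_x (h t x : R) : h *: ((0, 1) : R * R) + (t, x) = (t, h + x).
Proof.
apply: injective_projections => /=.
  by rewrite [h *: _]mulr0 add0r.
by rewrite [h *: _]mulr1.
Qed.

Lemma halfplane_t_proper t x : 0 <= t ->
  ProperFilter (increments (@halfplane R) (t, x) (1, 0)).
Proof.
move=> t0; apply: increments_proper => d d0; exists d; split.
- by rewrite gt_eqF.
- by rewrite gtr0_norm.
- by rewrite shift_t /halfplane/= addr_ge0// ltW.
Qed.

Lemma halfplane_x_proper t x : 0 <= t ->
  ProperFilter (increments (@halfplane R) (t, x) (0, 1)).
Proof.
move=> t0; apply: increments_proper => d d0; exists d; split.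
- by rewrite gt_eqF.
- by rewrite gtr0_norm.
- by rewrite shift_x.
Qed.

Lemma has_partial_t f t x l : has_partial halfplane (1, 0) f (t, x) l <->
  forall eps : R, 0 < eps -> exists2 d : R, 0 < d & forall t' : R, 0 <= t' -> `|t' - t| <= d ->
    `|f (t', x) - f (t, x) - (t' - t) * l| <= eps * `|t' - t|.
Proof.
split=> H eps eps0; have [d d0 Hd] := H _ eps0; exists d => //.
  move=> t' t'0 t'd; have := Hd (t' - t) t'd; rewrite shift_t subrK; exact.
move=> h hd; rewrite shift_t => A; have := Hd (h + t) A; rewrite addrK; exact.
Qed.

Lemma has_partial_x f t x l : 0 <= t -> has_partial halfplane (0, 1) f (t, x) l <->
  forall eps : R, 0 < eps -> exists2 d : R, 0 < d & forall x' : R, `|x' - x| <= d ->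
    `|f (t, x') - f (t, x) - (x' - x) * l| <= eps * `|x' - x|.
Proof.
move=> t0; split=> H eps eps0; have [d d0 Hd] := H _ eps0; exists d => //.
  move=> x' x'd; have := Hd (x' - x) x'd; rewrite shift_x subrK; exact.
move=> h hd _; rewrite shift_x; have := Hd (h + x); rewrite addrK; exact.
Qed.

Lemma prod_norm_le (p q : R * R) (d : R) :
  (`|q - p| <= d) = (`|q.1 - p.1| <= d) && (`|q.2 - p.2| <= d).
Proof. by rewrite prod_normE ge_max. Qed.

End halfplane_derivatives.

(** * Norms and damping *)

Section sup_norms.
Context {R : realType}.

(** A violation at one point persists on a ball, which has positive measure. *)
Lemma ae_le_continuous (g : R -> R) (y : R) : continuous g ->
  (\forall x \ae lebesgue_measure, (`|g x|%:E <= y%:E)%E) -> forall x, `|g x| <= y.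
Proof.
move=> gc [N [mN N0 HN]] x; rewrite leNgt; apply/negP => yg.
have yg' : 0 < `|g x| - y by rewrite subr_gt0.
have gx : `|g z| @[z --> x] --> `|g x| by apply: cvg_norm; exact: gc.
have /cvgrPdist_lt/(_ _ yg')/nbhs_normP[d /= d0 Hd] := gx.
have sub : ball x d `<=` N.
  move=> z xz; apply: HN => /=; rewrite lee_fin => zy.
  by have := Hd z xz; rewrite /= ltr_norml => /andP[_ H]; clear -zy H; lra.
have : (lebesgue_measure (ball x d) = 0)%E := @subset_measure0 _ _ _ (@lebesgue_measure R) _ _ (measurable_ball x d) mN sub N0.
rewrite lebesgue_measure_ball ?ltW// => /eqP; rewrite eqe mulrn_eq0/= => /eqP dE.
by move: d0; rewrite dE ltxx.
Qed.

(** Turns the essential supremum into a real pointwise bound: M excludes the value +oo, and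
    non-negativity of |g| excludes -oo. *)
Lemma Linfty_continuous (g : R -> R) (M : R) : continuous g -> (forall x, `|g x| <= M) ->
  exists s : R, ('N[lebesgue_measure]_+oo[(fun x : measurableTypeR R => (g x)%:E)] = s%:E)%E /\
    forall x, `|g x| <= s.
Proof.
move=> gc gM; rewrite unlock.
have -> : (0 < lebesgue_measure [set: measurableTypeR R])%E.
  by rewrite -set_itvNyy lebesgue_measure_itv/= ltry.
set E := ess_sup _ _.
have aeE : (\forall x \ae lebesgue_measure, (`|g x|%:E <= E)%E) := ess_sup_ge _ _.
have EM : (E <= M%:E)%E.
  by apply/ess_supP; apply: aeW => x; rewrite lee_fin.
have EN : ~ (E <= (-1)%:E)%E.
  move=> /ess_supP/(ae_le_continuous _ _ gc)/(_ 0) H.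
  by have := le_trans (normr_ge0 _) H; clear; lra.
case: E aeE EM EN => [s aeE _ _| | _ _] //.
  by exists s; split => //; exact: ae_le_continuous.
by move=> /(_ (leNye _)).
Qed.

Lemma C1b_derivable (f : R -> R) (x : R) : C1b setT f -> is_derive x 1 f (derive1 f x).
Proof.
move=> [_ [H _]]; apply: DeriveDef; first by rewrite -derivable_withinT; exact: H.
by rewrite derive1E.
Qed.

Lemma C1b_derive1 (f : R -> R) : C1b setT f -> derive_within setT (1 : R) f = derive1 f.
Proof. by move=> _; apply/funext => x; rewrite derive_withinT derive1E. Qed.

Lemma Cb_continuous (g : R -> R) : Cb setT g -> continuous g.
Proof.
move=> gC x; apply/cvgrPdist_le => eps e0.
have [d d0 H] := Cb_modulus _ _ x eps gC I e0.
apply/nbhs_normP; exists d => // y /= yd.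
by rewrite distrC; apply: H => //; rewrite distrC ltW.
Qed.

Lemma C1b_norm_bound (f : R -> R) : C1b setT f ->
  exists s : R, [/\ C1b_norm f = s%:E, 0 <= s, forall x, `|f x| <= s &
    forall x, `|derive1 f x| <= s].
Proof.
move=> fC; have [Cf [_ Cd]] := fC; rewrite C1b_derive1// in Cd.
have [M1 H1] := Cb_bound _ _ Cf; have [M2 H2] := Cb_bound _ _ Cd.
have [s1 [E1 B1]] := Linfty_continuous _ _ (Cb_continuous _ Cf) (fun x => H1 x I).
have [s2 [E2 B2]] := Linfty_continuous _ _ (Cb_continuous _ Cd) (fun x => H2 x I).
have s10 := le_trans (normr_ge0 _) (B1 0); have s20 := le_trans (normr_ge0 _) (B2 0).
exists (s1 + s2); split.
- by rewrite /C1b_norm E1 E2.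
- exact: addr_ge0.
- by move=> x; rewrite (le_trans (B1 x))// lerDl.
- by move=> x; rewrite (le_trans (B2 x))// lerDr.
Qed.

Lemma Linfty_halfplane_le {W : normedModType R} (F : R * R -> W) (s : R) : 0 <= s ->
  (forall p, halfplane p -> `|F p| <= s) -> (Linfty_halfplane F <= s%:E)%E.
Proof.
move=> s0 H; rewrite /Linfty_halfplane unlock.
(* The second branch is the value 0 that the norm has by convention on a space of measure zero. *)
case: ifPn => [_|_]; last by rewrite lee_fin.
apply/ess_supP; apply: aeW => p /=.
rewrite patchE; case: ifPn => [|_]; last by rewrite abse0 lee_fin.
by rewrite inE => /H; rewrite lee_fin normr_id.
Qed.

End sup_norms.

Section real_functions.
Context {R : realType}.
Implicit Types (phi dphi : R -> R) (x y t : R).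

Lemma expansion_is_derive phi x (l : R) :
  (forall eps : R, 0 < eps -> exists2 d : R, 0 < d & forall y, `|y - x| <= d ->
     `|phi y - phi x - (y - x) * l| <= eps * `|y - x|) ->
  is_derive x 1 phi l.
Proof.
move=> H.
have HP : has_partial setT (1 : R) phi x l.
  move=> eps eps0; have [d d0 Hd] := H eps eps0; exists d => // h hd _.
  have := Hd (h + x); rewrite addrK; rewrite [h *: _]mulr1; exact.
move/has_partial_cvg: HP; rewrite incrementsT => HP.
apply: DeriveDef; first by apply/cvg_ex; exists l.
exact: cvg_lim HP.
Qed.

(** At the end point 0 the derivative is one-sided, so the mean value theorem is used with
    derivatives in the open interval and continuity up to its ends. *)
Lemma halfline_lipschitz phi dphi (M : R) :
  (forall t, 0 <= t -> forall eps : R, 0 < eps -> exists2 d : R, 0 < d &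
     forall t', 0 <= t' -> `|t' - t| <= d ->
     `|phi t' - phi t - (t' - t) * dphi t| <= eps * `|t' - t|) ->
  (forall t, 0 <= t -> `|dphi t| <= M) ->
  forall t t', 0 <= t -> 0 <= t' -> `|phi t - phi t'| <= M * `|t - t'|.
Proof.
move=> H dM t t' t0 t'0; wlog tt' : t t' t0 t'0 / t <= t'.
  move=> W; have [/W|/ltW/W] := leP t t'; first exact.
  by rewrite distrC [`|t' - t|]distrC; exact.
have der x : x \in `]t, t'[ -> is_derive x 1 phi (dphi x).
  rewrite in_itv/= => /andP[tx _]; have x0 : 0 < x by exact: le_lt_trans tx.
  apply: expansion_is_derive => eps eps0; have [d d0 Hd] := H x (ltW x0) eps eps0.
  exists (Num.min d x) => [|y]; first by rewrite lt_min d0.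
  rewrite le_min => /andP[yd yx]; apply: Hd => //.
  by move: yx; rewrite ler_norml => /andP[]; lra.
have cont : {within `[t, t'], continuous phi}.
  apply/subspace_continuousP => x; rewrite /= in_itv/= => /andP[tx xt'].
  have x0 : 0 <= x by exact: le_trans tx.
  apply/cvgrPdist_le => eps eps0; have [d d0 Hd] := H x x0 1 ltr01.
  pose K := 1 + `|dphi x|.
  have K0 : 0 < K by rewrite ltr_wpDr.
  rewrite near_withinE; apply/nbhs_normP; exists (Num.min d (eps / K)) => /=.
    by rewrite lt_min d0 divr_gt0.
  move=> y /=; rewrite lt_min distrC => /andP[yd ye] /=; rewrite in_itv/= => /andP[ty _].
  rewrite distrC.
  have -> : phi y - phi x = (phi y - phi x - (y - x) * dphi x) + (y - x) * dphi x by ring.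
  apply: (@le_trans _ _ (1 * `|y - x| + `|y - x| * `|dphi x|)).
    apply: le_normD; last by rewrite normrM.
    by apply: Hd; [exact: le_trans ty | exact: ltW].
  rewrite mul1r -{1}[`|y - x|]mulr1 -mulrDr -ler_pdivlMr//; exact: ltW.
have [z] := MVT_segment tt' der cont.
rewrite in_itv/= => /andP[tz _] E.
by rewrite distrC E [`|t - t'|]distrC normrM ler_wpM2r// dM// (le_trans t0).
Qed.

(** Uniform continuity on a compact box, from the covering form of compactness with the radius d
    tending to 0. *)
Lemma halfplane_uniform_modulus (g : R * R -> R) (T X eps : R) :
  Cb halfplane g -> 0 < eps ->
  exists2 d : R, 0 < d & forall t x y, 0 <= t <= T -> `|x| <= X -> `|y| <= X ->
    `|x - y| <= d -> `|g (t, x) - g (t, y)| <= eps.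
Proof.
move=> gC e0.
have cK : compact (`[0, T] `*` `[- X, X] : set (R * R)).
  by apply: compact_setX; exact: segment_compact.
pose P d (p : R * R) := forall y, `|p.2 - y| <= d -> 0 <= p.1 -> `|g p - g (p.1, y)| <= eps.
have : \forall d \near 0^'+, `[0, T] `*` `[- X, X] `<=` P d.
  apply: (iffLR (compact_near_coveringP _) cK) => -[t x] [/=].
  rewrite in_itv/= => /andP[t0 tT] _.
  have [d d0 Hd] := Cb_modulus _ _ (t, x) (eps / 2) gC t0 (divr_gt0 e0 (ltr0n _ 2)).
  have d2 : 0 < d / 2 by rewrite divr_gt0.
  exists (ball (t, x) (d / 2), [set s | s < d / 2]) => /=.
    by split; [exact: nbhsx_ballx | exact: nbhs_right_lt].
  move=> [[t' x'] s] /= [[]]; rewrite /ball/= => tt' xx' sd y xy t'0.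
  have near z : `|x' - z| <= d / 2 -> `|(t', z) - (t, x)| <= d.
    move=> x'z; rewrite prod_norm_le/=; apply/andP; split; first by rewrite distrC; lra.
    have -> : z - x = (x' - x) - (x' - z) by ring.
    by rewrite (_ : d = d / 2 + d / 2); [apply: le_normB => //; rewrite distrC ltW | field].
  have -> : g (t', x') - g (t', y) = (g (t', x') - g (t, x)) - (g (t', y) - g (t, x)) by ring.
  rewrite (_ : eps = eps / 2 + eps / 2); last by field.
  apply: le_normB; apply: Hd => //; apply: near; first by rewrite subrr normr0 ltW.
  by rewrite (le_trans xy)// ltW.
move=> /(filterI (nbhs_right_gt 0)) /filter_ex[d [d0 Hd]].
exists d => // t x y /andP[t0 tT]; rewrite ler_norml => xX yX xy.
by apply: (Hd (t, x)) => //; split; rewrite /= in_itv/= ?t0.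
Qed.

(** Integrability of a1 and a2 is exploited through this bounded primitive, B x being the integral
    of g over the part of D up to x. Its increments are only needed from below. *)
Lemma cumulative (D : set R) (g : R -> R) (I : R) : measurable D ->
  measurable_fun D g -> (forall x, D x -> 0 <= g x) ->
  (\int[lebesgue_measure]_(x in D) (g x)%:E = I%:E)%E ->
  exists B : R -> R, (forall x, 0 <= B x <= I) /\
    forall x y (l : R), x <= y -> `]x, y] `<=` D -> 0 <= l ->
      (forall z, x < z <= y -> l <= g z) -> B x + l * (y - x) <= B y.
Proof.
move=> mD mg g0 gI.
have mDx x : measurable (D `&` `]-oo, x]) by apply: measurableI => //; exact: measurable_itv.
have mgE : measurable_fun D (EFin \o g) by exact/measurable_EFinP.
have g0E x : D x -> (0 <= (g x)%:E)%E by move=> /g0; rewrite lee_fin.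
pose F x := (\int[lebesgue_measure]_(z in D `&` `]-oo, x]) (g z)%:E)%E.
have F0 x : (0 <= F x)%E by apply: integral_ge0 => z [Dz _]; exact: g0E.
have FI x : (F x <= I%:E)%E.
  by rewrite -gI; apply: ge0_subset_integral; [exact: mDx|exact: mD|exact: mgE|exact: g0E|move=> z []].
have Ffin x : (fine (F x))%:E = F x.
  by apply: fineK; rewrite ge0_fin_numE// (le_lt_trans (FI x))// ltry.
exists (fine \o F); split=> [x|x y l xy sub l0 lg] /=.
  by rewrite -!lee_fin Ffin F0 FI.
rewrite -lee_fin EFinD !Ffin.
have E : D `&` `]-oo, y] = (D `&` `]-oo, x]) `|` `]x, y].
  rewrite eqEsubset; split=> z /=; rewrite !in_itv/=.
    move=> [Dz zy]; have [zx|xz] := leP z x; first by left.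
    by right; rewrite zy.
  move=> [[Dz zx]|zxy]; first by split=> //; exact: le_trans xy.
  by split; [apply: sub; rewrite /= in_itv | case/andP: zxy].
have mU : measurable_fun ((D `&` `]-oo, x]) `|` `]x, y]) (EFin \o g).
  by apply: measurable_funS mgE => // z [[]//|/sub].
rewrite /F E ge0_integral_setU//; last 2 first.
- by move=> z [[Dz _]|/sub Dz]; exact: g0E.
- apply/eqP; rewrite -subset0 => z [[_ /=]]; rewrite !in_itv/= => zx /andP[xz _].
  by move: zx; rewrite leNgt xz.
apply: leeD => //.
have -> : (l * (y - x))%:E = (\int[lebesgue_measure]_(z in `]x, y]) (cst l%:E) z)%E.
  transitivity (l%:E * lebesgue_measure `]x, y])%E; last first.
    by apply/esym/integral_cst; exact: measurable_itv.
  rewrite lebesgue_measure_itv/= lte_fin.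
  by case: ltgtP xy => // -> _; rewrite subrr mulr0 mule0.
apply: ge0_le_integral => //=.
- by apply: measurable_funS mgE.
- exact: mDx.
Qed.

End real_functions.

(** * The weight that replaces the damping a by a constant *)

Section damping.
Context {R : realType}.
Implicit Types (t x h : R).

(** The factor 2/3 turns the exponent 3 h mu / 8 of the weight estimate into the decay h mu / 4. *)
Lemma expRN_le (y : R) : 0 <= y <= 1 / 2 -> expR (- y) <= 1 - 2 / 3 * y.
Proof.
move=> /andP[y0 y1]; rewrite expRN.
apply: (@le_trans _ _ (1 + y)^-1).
  rewrite lef_pV2 ?posrE ?expR_gt0 ?expR_ge1Dx//; lra.
by rewrite -[X in X <= _]mul1r ler_pdivrMr; [nra | lra].
Qed.

(* Along a characteristic of family b, with slope sg b * k, the logarithm of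
   the weight grows at least like (a1 + a2) / 2, which absorbs mu - a. *)
Lemma weight_exists (a : R -> R -> R) (a1 a2 B1 B2 : R -> R) (mu K I : R) :
  0 < mu -> 0 <= K -> 0 <= I ->
  (forall t x, 0 <= t -> `|a t x - mu| <= a1 t + a2 x) ->
  (forall t, 0 <= t -> 0 <= a1 t) -> (forall x, 0 <= a2 x) ->
  (forall t t', 0 <= t -> 0 <= t' -> `|a1 t - a1 t'| <= K * `|t - t'|) ->
  (forall x x', `|a2 x - a2 x'| <= K * `|x - x'|) ->
  (forall x, 0 <= B1 x <= I) -> (forall x, 0 <= B2 x <= I) ->
  (forall x y (l : R), 0 <= x -> x <= y -> 0 <= l ->
      (forall z, x < z <= y -> l <= a1 z) -> B1 x + l * (y - x) <= B1 y) ->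
  (forall x y (l : R), x <= y -> 0 <= l ->
      (forall z, x < z <= y -> l <= a2 z) -> B2 x + l * (y - x) <= B2 y) ->
  exists (w : bool -> R -> R -> R) (W h1 : R), [/\ 0 < W, 0 < h1,
    forall b t x, 0 <= t -> W^-1 <= w b t x <= W &
    forall h b t x k, 0 < h <= h1 -> 0 <= t -> 1 / 2 <= k <= 2 ->
    (1 - h * a t (x - sg b * h * k) / 2) * w b t (x - sg b * h * k) <=
    (1 - h * mu / 4) * w b (t + h) x].
Proof.
move=> mu0 K0 I0 amu a10 a20 a1L a2L B1I B2I B1inc B2inc.
(* B1 needs the factor 1/2 and B2 none: in time h the point moves by h k >= h / 2 in the direction
   sg b, so sg b B2 already gains h a2 / 2 to first order. *)
pose S b t x := B1 t / 2 + sg b * B2 x.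
have S_le b t x : - (2 * I) <= S b t x <= 2 * I.
  by have := B1I t; have := B2I x; rewrite /S /sg; case: b => /andP[? ?] /andP[? ?]; lra.
(* The second-order losses are K h^2 / 2 from B1 and 4 K h^2 from B2. The second term keeps them
   below h mu / 8, so that h mu / 2 decreases to no less than 3 h mu / 8; the first term makes
   [expRN_le] applicable. *)
pose h1 := Num.min mu^-1 (mu / (40 * (K + 1))).
have K1 : 0 < K + 1 by lra.
have h10 : 0 < h1 by rewrite lt_min invr_gt0 mu0 divr_gt0// mulr_gt0.
have inc1 t h : 0 <= t -> 0 <= h -> B1 t + h * a1 t - K * h ^+ 2 <= B1 (t + h).
  move=> t0 h0.
  (* The lower bound a1 t - K h on the interval is usable if it is non-negative; otherwise
     monotonicity of B1 is enough. *)
  have [l0|l0] := leP 0 (a1 t - K * h).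
    have := B1inc t (t + h) _ t0 _ l0 _; rewrite addrAC subrr add0r.
    have -> : B1 t + (a1 t - K * h) * h = B1 t + h * a1 t - K * h ^+ 2 by ring.
    apply; first by rewrite lerDl.
    move=> z /andP[tz zt]; have z0 : 0 <= z by lra.
    have := a1L t z t0 z0; rewrite ler_norml => /andP[_].
    have : K * `|t - z| <= K * h by rewrite ler_wpM2l// distrC gtr0_norm; lra.
    by lra.
  have := B1inc t (t + h) 0 t0 _ (lexx _) _; rewrite mul0r addr0 => H.
  apply: le_trans (H _ _); last first.
  - by move=> z /andP[tz _]; apply: a10; lra.
  - by rewrite lerDl.
  - have -> : B1 t + h * a1 t - K * h ^+ 2 = B1 t + h * (a1 t - K * h) by ring.
    by rewrite gerDl mulr_ge0_le0// ltW.
have inc2 x y (x' : R) : x <= y -> x <= x' <= y -> (y - x) * a2 x' - K * (y - x) ^+ 2 <= B2 y - B2 x.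
  move=> xy /andP[xx' x'y].
  have [l0|l0] := leP 0 (a2 x' - K * (y - x)).
    have : B2 x + (a2 x' - K * (y - x)) * (y - x) <= B2 y.
      apply: B2inc => // z /andP[xz zy].
      have := a2L x' z; rewrite ler_norml => /andP[_].
      have : K * `|x' - z| <= K * (y - x) by rewrite ler_wpM2l// ler_norml; lra.
      by lra.
    by lra.
  have : B2 x + 0 * (y - x) <= B2 y by apply: B2inc.
  have -> : (y - x) * a2 x' - K * (y - x) ^+ 2 = (y - x) * (a2 x' - K * (y - x)) by ring.
  have : (y - x) * (a2 x' - K * (y - x)) <= 0 by rewrite mulr_ge0_le0 ?subr_ge0// ltW.
  by lra.
exists (fun b t x => expR (S b t x)), (expR (2 * I)), h1; split => //.
- exact: expR_gt0.
- by move=> b t x _; rewrite -expRN !ler_expR.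
move=> h b t x k /andP[h0 hh1] t0 /andP[k1 k2].
set x' := x - sg b * h * k.
have [hm1 hm2] : h * mu <= 1 /\ 40 * (K + 1) * h <= mu.
  move: hh1; rewrite le_min => /andP[ha hb]; split.
    by rewrite -ler_pdivlMr// div1r.
  by rewrite mulrC -ler_pdivlMr// mulr_gt0.
have hk0 : 0 <= h * k by rewrite mulr_ge0; lra.
have i1 := inc1 t h t0 (ltW h0).
have i2 : h * a2 x' / 2 - 4 * K * h ^+ 2 <= sg b * (B2 x - B2 x').
  have E : (h * k) * a2 x' - K * (h * k) ^+ 2 <= sg b * (B2 x - B2 x').
    rewrite /x' /sg; case: (b) => /=; rewrite ?mul1r ?mulN1r.
      have := inc2 (x - h * k) x (x - h * k); rewrite opprB addrCA subrr addr0.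
      by apply; lra.
    have := inc2 x (x + h * k) (x + h * k); rewrite mulNr opprK opprB (addrC x) addrK.
    by apply; lra.
  apply: le_trans E; apply: lerB.
    have -> : h * a2 x' / 2 = h * (1 / 2) * a2 x' by field.
    by rewrite ler_wpM2r// ler_wpM2l// ltW.
  have -> : 4 * K * h ^+ 2 = K * h ^+ 2 * 4 by ring.
  have -> : K * (h * k) ^+ 2 = K * h ^+ 2 * k ^+ 2 by ring.
  rewrite ler_wpM2l ?mulr_ge0 ?sqr_ge0//; nra.
have SS : S b t x' - h * a t x' / 2 <= S b (t + h) x - 3 / 8 * (h * mu).
  have := amu t x' t0; rewrite ler_norml => /andP[am _].
  have am2 : h * (mu - (a1 t + a2 x')) <= h * a t x' by apply: ler_wpM2l; [exact: ltW | lra].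
  have kh : 40 * (K * h ^+ 2) <= h * mu.
    have : h * (40 * (K + 1) * h) <= h * mu by rewrite ler_wpM2l// ltW.
    have : 0 <= h ^+ 2 by rewrite sqr_ge0.
    by lra.
  have hm : 0 <= h * mu by rewrite mulr_ge0// ltW.
  by rewrite /S; lra.
have y12 : 0 <= 3 / 8 * (h * mu) <= 1 / 2.
  have : 0 <= h * mu by rewrite mulr_ge0// ltW.
  by lra.
apply: (@le_trans _ _ (expR (- (h * a t x' / 2)) * expR (S b t x'))).
  by rewrite ler_wpM2r ?expR_ge0// expR_ge1Dx.
rewrite -expRD addrC; apply: (@le_trans _ _ (expR (- (3 / 8 * (h * mu)) + S b (t + h) x))).
  by rewrite ler_expR; lra.
rewrite expRD ler_wpM2r ?expR_ge0//; apply: (le_trans (expRN_le _ y12)); lra.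
Qed.

Lemma damping_coefs (mu : R) (a : R * R -> R) : 0 < mu -> admissible_damping mu a ->
  let at_ t x := a (t, x) in let ax t x := d_x a (t, x) in
  exists (L : R) (w : bool -> R -> R -> R) (W h1 : R),
  [/\ 1 <= L /\ 0 < W /\ 0 < h1,
    [/\ forall t x, 0 <= t -> 0 <= at_ t x <= L,
      forall t x, 0 <= t -> `|ax t x| <= L,
      forall t x t' x', 0 <= t -> 0 <= t' ->
        `|at_ t x - at_ t' x'| <= L * (`|t - t'| + `|x - x'|) &
      forall t x, 0 <= t -> is_derive x 1 (at_ t) (ax t x)],
    forall T X (e : R), 0 < e -> exists2 d : R, 0 < d & forall t x y, 0 <= t <= T ->
      `|x| <= X -> `|y| <= X -> `|x - y| <= d -> `|ax t x - ax t y| <= e,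
    forall b t x, 0 <= t -> W^-1 <= w b t x <= W &
    forall h b t x k, 0 < h <= h1 -> 0 <= t -> 1 / 2 <= k <= 2 ->
    (1 - h * at_ t (x - sg b * h * k) / 2) * w b t (x - sg b * h * k) <=
    (1 - h * mu / 4) * w b (t + h) x].
Proof.
move=> mu0 [[aC [atd atC] [axd axC]] a0 [a1 [a2 [Ca [[a1C a2C] [a10 a20] amu aI _]]]]] /=.
have [M1 HM1] := Cb_bound _ _ aC; have [M2 HM2] := Cb_bound _ _ atC.
have [M3 HM3] := Cb_bound _ _ axC.
pose L := 1 + (`|M1| + (`|M2| + `|M3|)).
have [L1 LM1 LM2 LM3] : [/\ 1 <= L, M1 <= L, M2 <= L & M3 <= L].
  have := ler_norm M1; have := ler_norm M2; have := ler_norm M3.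
  have := normr_ge0 M1; have := normr_ge0 M2; have := normr_ge0 M3.
  by clear; rewrite /L => *; split; lra.
have axder t x : 0 <= t -> is_derive x 1 (fun x => a (t, x)) (d_x a (t, x)).
  move=> t0; apply: expansion_is_derive; apply/(has_partial_x _ _ _ _ t0).
  exact: derivable_has_partial (axd (t, x) t0).
have axL t x : 0 <= t -> `|d_x a (t, x)| <= L.
  by move=> t0; exact: le_trans (HM3 (t, x) t0) LM3.
have alip t x t' x' : 0 <= t -> 0 <= t' ->
    `|a (t, x) - a (t', x')| <= L * (`|t - t'| + `|x - x'|).
  move=> t0 t'0.
  have -> : a (t, x) - a (t', x') = (a (t, x) - a (t', x)) + (a (t', x) - a (t', x')) by ring.
  rewrite mulrDr; apply: le_normD.
    apply: (halfline_lipschitz (fun t => a (t, x)) (fun t => d_t a (t, x))) => //.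
      by move=> s s0; apply/has_partial_t; exact: derivable_has_partial (atd (s, x) s0).
    by move=> s s0; exact: le_trans (HM2 (s, x) s0) LM2.
  apply: (@lipschitz_of_derive _ (fun x => a (t', x)) (fun x => d_x a (t', x)) (Num.max `|x| `|x'|)).
  - by move=> z _; exact: axder.
  - by move=> z _; exact: axL.
  - by rewrite le_max lexx orbT.
  - by rewrite le_max lexx.
have [a1c [a1d a1b]] := a1C; have [a2c [a2d a2b]] := a2C.
have [N1 HN1] := Cb_bound _ _ a1b; have [N2 HN2] := Cb_bound _ _ a2b.
pose K := `|N1| + `|N2|.
have [K0 KN1 KN2] : [/\ 0 <= K, N1 <= K & N2 <= K].
  have := ler_norm N1; have := ler_norm N2; have := normr_ge0 N1; have := normr_ge0 N2.
  by clear; rewrite /K => *; split; lra.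
have a1L t t' : 0 <= t -> 0 <= t' -> `|a1 t - a1 t'| <= K * `|t - t'|.
  apply: (halfline_lipschitz a1 (derive_within time_halfline (1 : R) a1)) => s s0.
    have sT : time_halfline s by rewrite /time_halfline/= in_itv/= s0.
    move=> eps eps0; have [d d0 Hd] := derivable_has_partial _ _ _ _ (a1d s sT) eps eps0.
    exists d => // s' s'0 s'd; have := Hd (s' - s) s'd.
    rewrite [_ *: 1]mulr1 subrK; apply.
    by rewrite /time_halfline/= in_itv/= s'0.
  by apply: le_trans KN1; apply: HN1; rewrite /time_halfline/= in_itv/= s0.
have a2L x x' : `|a2 x - a2 x'| <= K * `|x - x'|.
  apply: (@lipschitz_of_derive _ a2 (derive1 a2) (Num.max `|x| `|x'|)).
  - by move=> z _; exact: C1b_derivable.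
  - move=> z _; apply: le_trans KN2; rewrite -C1b_derive1//; exact: HN2.
  - by rewrite le_max lexx orbT.
  - by rewrite le_max lexx.
have mT : measurable (time_halfline : set R) by exact: measurable_itv.
have i10 : (0 <= \int[lebesgue_measure]_(t in time_halfline) (a1 t)%:E)%E.
  by apply: integral_ge0 => t; rewrite /time_halfline/= in_itv/= andbT lee_fin; exact: a10.
have i20 : (0 <= \int[lebesgue_measure]_x (a2 x)%:E)%E.
  by apply: integral_ge0 => t _; rewrite lee_fin.
(* Only the sum is given to be finite; non-negativity of both integrals makes each of them
   finite. *)
have [I1 E1] : exists I1 : R, (\int[lebesgue_measure]_(t in time_halfline) (a1 t)%:E = I1%:E)%E.
  by move: aI i10 i20; case: integral => [r _ _ _| | ] //; [exists r | case: integral].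
have [I2 E2] : exists I2 : R, (\int[lebesgue_measure]_x (a2 x)%:E = I2%:E)%E.
  by move: aI i20; rewrite E1; case: integral => [r _ _| | ] //; exists r.
rewrite E1 in i10; rewrite E2 in i20; rewrite !lee_fin in i10 i20.
have m1 : measurable_fun time_halfline a1.
  by apply: subspace_continuous_measurable_fun => //; case: a1c.
have m2 : measurable_fun setT a2.
  exact: continuous_measurable_fun (Cb_continuous _ a2c).
have a1T t : time_halfline t -> 0 <= a1 t.
  by rewrite /time_halfline/= in_itv/= andbT; exact: a10.
have [B1 [B1I B1inc]] := cumulative _ _ _ mT m1 a1T E1.
have [B2 [B2I B2inc]] := cumulative _ _ _ measurableT m2 (fun x _ => a20 x) E2.
have I0 : 0 <= I1 + I2 by lra.
have am t x : 0 <= t -> `|a (t, x) - mu| <= a1 t + a2 x.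
  move=> t0; apply: le_trans (amu t x t0).
  by rewrite -addrA lerDl addr_ge0.
have B1I' x : 0 <= B1 x <= I1 + I2 by have := B1I x; lra.
have B2I' x : 0 <= B2 x <= I1 + I2 by have := B2I x; lra.
have B1inc' x y (l : R) : 0 <= x -> x <= y -> 0 <= l ->
    (forall z, x < z <= y -> l <= a1 z) -> B1 x + l * (y - x) <= B1 y.
  move=> x0 xy; apply: B1inc => // z; rewrite /time_halfline/= !in_itv/= => /andP[xz _].
  by rewrite (le_trans x0)// ltW.
have B2inc' x y (l : R) : x <= y -> 0 <= l ->
    (forall z, x < z <= y -> l <= a2 z) -> B2 x + l * (y - x) <= B2 y.
  by move=> xy; apply: B2inc.
have [w [W [h1 [W0 h10 wW wstep]]]] := weight_exists (fun t x => a (t, x)) a1 a2 B1 B2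
  mu K _ mu0 K0 I0 am a10 a20 a1L a2L B1I' B2I' B1inc' B2inc'.
exists L, w, W, h1; split => //.
  split=> // t x t0; rewrite a0//=.
  by apply: le_trans LM1; apply: le_trans (ler_norm _) _; exact: (HM1 (t, x) t0).
move=> T X e e0; exact: halfplane_uniform_modulus.
Qed.

End damping.

(** * Uniqueness *)

Section transport_uniqueness.
Context {R : realType}.
Implicit Types (t x : R) (b : bool).

Lemma fst_cvg (A : set (R * R)) (p : R * R) : q.1 @[q --> within A (nbhs p)] --> p.1.
Proof.
apply/cvgrPdist_le => e e0; rewrite near_withinE; apply/nbhs_ballP; exists e => // q [pq _] _.
exact: ltW.
Qed.

Lemma snd_cvg (A : set (R * R)) (p : R * R) : q.2 @[q --> within A (nbhs p)] --> p.2.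
Proof.
apply/cvgrPdist_le => e e0; rewrite near_withinE; apply/nbhs_ballP; exists e => // q [_ pq] _.
exact: ltW.
Qed.

(* Maximum principle: |F| / ((1 + lam (t - T)) (1 + x^2)) cannot have a positive
   maximum on the strip, because (1 + x^2) (1 + lam (t - T)) is a strict
   supersolution; the weight in x brings the maximum into a compact box. *)
Lemma transport_uniqueness (F Ft Fx c : bool -> R * R -> R) (T tau K c1 B : R) :
  0 < tau -> 0 <= K -> 0 <= c1 -> 4 * (K + c1 + 1) * tau <= 1 ->
  let strip := [set p : R * R | T <= p.1 <= T + tau] in
  (forall b p, strip p -> F b q @[q --> within strip (nbhs p)] --> F b p) ->
  (forall b p, strip p -> `|F b p| <= B) ->
  (forall b x, F b (T, x) = 0) ->
  (forall b t x, T <= t <= T + tau -> forall eps : R, 0 < eps ->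
     exists2 d : R, 0 < d & forall x', `|x' - x| <= d ->
     `|F b (t, x') - F b (t, x) - (x' - x) * Fx b (t, x)| <= eps * `|x' - x|) ->
  (forall b t x, T <= t <= T + tau -> forall eps : R, 0 < eps ->
     exists2 d : R, 0 < d & forall t', T <= t' <= t -> `|t' - t| <= d ->
     `|F b (t', x) - F b (t, x) - (t' - t) * Ft b (t, x)| <= eps * `|t' - t|) ->
  (forall b p, strip p -> `|c b p| <= c1) ->
  (forall b p (m : R), strip p -> (forall b', `|F b' p| <= m) ->
     `|Ft b p + c b p * Fx b p| <= K * m) ->
  forall b p, strip p -> F b p = 0.
Proof.
move=> tau0 K0 c10 Ktau strip Fc FB FT FxP FtP cB Feq b0 p0 sp0.
apply/eqP; apply: contraT => F0.
(* The time factor of g stays below 3/2 on the strip, and lam exceeds 3/2 (K + c1): this is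
   strictness of the supersolution. *)
pose lam := 2 * (K + c1 + 1).
have lam0 : 0 < lam by rewrite /lam; lra.
have lamtau : lam * tau <= 1 / 2 by rewrite /lam; lra.
pose g (p : R * R) := (1 + lam * (p.1 - T)) * (1 + p.2 ^+ 2).
have g1 p : strip p -> 1 <= 1 + lam * (p.1 - T) <= 3 / 2.
  move=> /andP[Tp pT]; have : 0 <= lam * (p.1 - T) by rewrite mulr_ge0 ?subr_ge0// ltW.
  have : lam * (p.1 - T) <= lam * tau by rewrite ler_wpM2l ?(ltW lam0)//; lra.
  by lra.
have g2 p : strip p -> 1 + p.2 ^+ 2 <= g p.
  by move=> /g1/andP[H _]; rewrite /g ler_peMl// addr_ge0// sqr_ge0.
have g0 p : strip p -> 0 < g p.
  by move=> /g2; apply: lt_le_trans; rewrite ltr_pwDl// sqr_ge0.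
have B0 : 0 < B by apply: lt_le_trans (FB b0 p0 sp0); rewrite normr_gt0.
pose H b p := `|F b p| / g p.
pose eta := H b0 p0.
have eta0 : 0 < eta by rewrite divr_gt0 ?normr_gt0// g0.
(* On |x| = X the quotient is at most B / (1 + X^2) < eta, so the maximum, which is at least eta, is
   attained at an interior x. *)
pose X := Num.max (`|p0.2| + 1) (B / eta + 1).
have X1 : 1 <= X by rewrite le_max lerDr normr_ge0.
have X0 : 0 <= X by lra.
have XB : B < eta * (1 + X ^+ 2).
  rewrite mulrC -ltr_pdivrMr//; have : B / eta + 1 <= X by rewrite le_max lexx orbT.
  have : X <= X ^+ 2 by rewrite expr2 ler_peMr.
  by lra.
pose box : set (R * R) := `[T, T + tau] `*` `[- X, X].
have boxP p : box p <-> strip p /\ `|p.2| <= X.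
  rewrite /box/= !in_itv/= ler_norml; split=> [[? ?]|[? ?]]; by split.
have cbox : compact box by apply: compact_setX; exact: segment_compact.
have bp0 : box p0.
  by apply/boxP; split=> //; rewrite le_max lerDl ler01.
have Hc b : {within box, continuous (H b)}.
  apply/subspace_continuousP => p /boxP[sp _].
  have Fbox : F b q @[q --> within box (nbhs p)] --> F b p.
    move=> A hA; have hA' : nbhs p [set q | strip q -> A (F b q)] := Fc b p sp A hA.
    suff : nbhs p [set q | box q -> A (F b q)] by [].
    by apply: filterS hA' => q h /boxP[sq _]; exact: h.
  apply: cvgM; first exact: cvg_norm.
  apply: cvgV; first by rewrite gt_eqF// g0.
  apply: cvgM.
    apply: cvgD; first exact: cvg_cst.
    apply: cvgMl_tmp; apply: cvgB; [exact: fst_cvg | exact: cvg_cst].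
  apply: cvgD; first exact: cvg_cst.
  rewrite expr2; under eq_fun do rewrite expr2; apply: cvgM; exact: snd_cvg.
have maxb b := compact_EVT_max (ex_intro _ p0 bp0) cbox (Hc b).
(* The right-hand side of one equation involves both families, so the maximum has to be taken over b
   as well. *)
have [b [p [bp [Hp Hpe]]]] : exists b p, box p /\ (forall b' q, box q -> H b' q <= H b p) /\ eta <= H b p.
  have [pt + mt] := maxb true; have [pf + mf] := maxb false; rewrite !inE => bf bt.
  have mt' q : box q -> H true q <= H true pt by move=> bq; apply: mt; rewrite inE.
  have mf' q : box q -> H false q <= H false pf by move=> bq; apply: mf; rewrite inE.
  have et : forall b1 p1, (forall b' q, box q -> H b' q <= H b1 p1) -> eta <= H b1 p1.
    by move=> b1 p1 /(_ b0 p0 bp0).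
  have [le|/ltW le] := leP (H true pt) (H false pf).
    have A b' q : box q -> H b' q <= H false pf.
      by case: b' => [/mt' h|/mf'//]; exact: le_trans le.
    by exists false, pf; split=> //; split=> //; exact: et.
  have A b' q : box q -> H b' q <= H true pt.
    by case: b' => [/mt'//|/mf' h]; exact: le_trans le.
  by exists true, pt; split=> //; split=> //; exact: et.
have [sp pX] := (iffLR (boxP p)) bp.
case: p sp pX bp Hp Hpe => t x sp pX bp Hp Hpe.
pose m := H b (t, x).
have m0 : 0 < m by exact: lt_le_trans Hpe.
have Fm b' q : box q -> `|F b' q| <= m * g q.
  move=> bq; have [sq _] := (iffLR (boxP q)) bq.
  by rewrite -ler_pdivrMr ?g0//; exact: Hp.
have Fme : `|F b (t, x)| = m * g (t, x) by rewrite /m /H divfK// gt_eqF// g0.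
(* s F lies below |F| everywhere and equals it at the maximum, so the first-order conditions are
   derived for s F instead of the non-smooth |F|. *)
pose s : R := Num.sg (F b (t, x)).
have sF q : s * F b q <= `|F b q|.
  apply: le_trans (ler_norm _) _; rewrite normrM ler_piMl// /s normr_sg.
  by case: eqP => // _; rewrite ler01.
have sFe : s * F b (t, x) = m * g (t, x) by rewrite -Fme /s -normrEsg.
have s1 : `|s| <= 1 by rewrite /s normr_sg; case: eqP => //; rewrite ler01.
have xX : `|x| < X.
  rewrite lt_neqAle pX andbT; apply/eqP => xE.
  have : m * g (t, x) <= B by rewrite -Fme FB.
  have : eta * (1 + X ^+ 2) <= m * g (t, x).
    apply: ler_pM => //; [exact: ltW | by rewrite addr_ge0// sqr_ge0|].
    have := g2 _ sp; rewrite /= -(real_normK (num_real x)) xE; exact.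
  by clear -XB; lra.
have /andP[Tt tT] := sp; rewrite /= in Tt tT.
have tgt : T < t.
  rewrite lt_neqAle Tt andbT; apply/eqP => TE.
  move: Fme; rewrite -TE FT normr0 => /esym/eqP; rewrite gt_eqF//.
  by rewrite mulr_gt0// g0// /strip/= lexx lerDl ltW.
pose G t := 1 + lam * (t - T).
have gE t' x' : g (t', x') = G t' * (1 + x' ^+ 2) by [].
(* first-order conditions at the maximum *)
have DX : s * Fx b (t, x) = m * G t * (2 * x).
  apply/eqP; rewrite -subr_eq0 -normr_le0; apply/ler_addgt0Pr => e e0.
  rewrite add0r.
  have [d d0 Hd] := FxP b t x sp (e / 2) (divr_gt0 e0 (ltr0n _ 2)).
  have mG : 0 < m * G t + 1.
    by have /andP[h _] := g1 _ sp; rewrite ltr_wpDl// mulr_ge0 ?(ltW m0)// (le_trans ler01).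
  pose r := Num.min (Num.min d (X - `|x|)) (e / 2 / (m * G t + 1)).
  have r0 : 0 < r by rewrite !lt_min d0 subr_gt0 xX !divr_gt0.
  have [rd [rX re]] : r <= d /\ (r <= X - `|x| /\ r <= e / 2 / (m * G t + 1)).
    by rewrite !ge_min !lexx !orbT.
  have key (z : R) : `|z| = r -> z * (s * Fx b (t, x) - m * G t * (2 * x)) <= e * r.
    move=> zr.
    have bz : box (t, x + z).
      by apply/boxP; split=> //=; apply: (le_trans (ler_normD _ _)); rewrite zr; clear -rX; lra.
    have := Hd (x + z); rewrite addrAC subrr add0r zr => /(_ rd) A.
    have B1 : s * F b (t, x + z) <= m * g (t, x + z) := le_trans (sF _) (Fm b _ bz).
    have : `|s * (F b (t, x + z) - F b (t, x) - z * Fx b (t, x))| <= 1 * (e / 2 * r) by exact: le_normM.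
    rewrite ler_norml mul1r => /andP[C _].
    have z2 : z ^+ 2 = r * r by rewrite -(real_normK (num_real z)) zr expr2.
    have gz : m * g (t, x + z) = m * g (t, x) + z * (m * G t * (2 * x)) + m * G t * (r * r).
      by rewrite -z2 !gE; ring.
    have : m * G t * (r * r) <= e / 2 * r.
      rewrite mulrA ler_wpM2r ?(ltW r0)//.
      apply: (@le_trans _ _ ((m * G t + 1) * r)).
        by rewrite mulrDl mul1r lerDl ltW.
      by rewrite mulrC -ler_pdivlMr.
    by clear -C B1 gz sFe; lra.
  have k1 := key r (gtr0_norm r0).
  have k2 := key (- r); rewrite normrN mulNr -mulrN in k2; have {}k2 := k2 (gtr0_norm r0).
  by clear -r0 k1 k2; rewrite ler_norml; apply/andP; split; rewrite -(ler_pM2l r0); lra.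
(* Only an inequality in time: t may be the final time of the strip, so increments go backwards, and
   t > T leaves room for them. *)
have DT : m * lam * (1 + x ^+ 2) <= s * Ft b (t, x).
  apply/ler_addgt0Pr => e e0.
  have [d d0 Hd] := FtP b t x sp e e0.
  pose r := Num.min d (t - T).
  have r0 : 0 < r by rewrite lt_min d0 subr_gt0.
  have [rd rT] : r <= d /\ r <= t - T by rewrite !ge_min !lexx orbT.
  have tr : T <= t - r <= t by clear -r0 rT; apply/andP; split; lra.
  have br : box (t - r, x).
    apply/boxP; split=> //; have [Tr tr'] := andP tr.
    by rewrite /strip/= Tr (le_trans tr').
  have := Hd (t - r) tr; rewrite addrAC subrr sub0r normrN gtr0_norm// => /(_ rd) A.
  have B1 : s * F b (t - r, x) <= m * g (t - r, x) := le_trans (sF _) (Fm b _ br).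
  have : `|s * (F b (t - r, x) - F b (t, x) - - r * Ft b (t, x))| <= 1 * (e * r) by exact: le_normM.
  rewrite ler_norml mul1r => /andP[C _].
  have gr : m * g (t - r, x) = m * g (t, x) - r * (m * lam * (1 + x ^+ 2)).
    by rewrite !gE /G; ring.
  by rewrite -(ler_pM2l r0); clear -C B1 gr sFe; lra.
have := Feq b (t, x) (m * g (t, x)) sp (fun b' => Fm b' _ bp).
move=> FF.
have : `|s * (Ft b (t, x) + c b (t, x) * Fx b (t, x))| <= 1 * (K * (m * g (t, x))) by exact: le_normM.
rewrite ler_norml mul1r => /andP[_].
have -> : s * (Ft b (t, x) + c b (t, x) * Fx b (t, x)) =
   s * Ft b (t, x) + c b (t, x) * (s * Fx b (t, x)) by ring.
rewrite DX.
have /andP[G1 G2] := g1 _ sp; rewrite /= -/(G t) in G1 G2.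
have x21 : `|2 * x| <= 1 + x ^+ 2.
  have p1 := sqr_ge0 (1 + x); have p2 := sqr_ge0 (1 - x).
  by clear -p1 p2; rewrite ler_norml; lra.
have : `|c b (t, x) * (m * G t * (2 * x))| <= c1 * (m * G t * (1 + x ^+ 2)).
  apply: le_normM; first exact: cB.
  by apply: le_normMl => //; rewrite mulr_ge0 ?(ltW m0)// (le_trans ler01).
rewrite ler_norml => /andP[C1 _].
rewrite gE => U.
have q0 : 0 < m * (1 + x ^+ 2) by rewrite mulr_gt0// ltr_pwDl// sqr_ge0.
have : m * (1 + x ^+ 2) * (lam - (K + c1) * G t) <= 0 by clear -DT U C1; lra.
rewrite pmulr_rle0//.
have : (K + c1) * G t <= (K + c1) * (3 / 2) by rewrite ler_wpM2l ?addr_ge0.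
by clear -K0 c10; rewrite /lam; lra.
Qed.

End transport_uniqueness.

Section uniqueness.
Context {R : realType}.
Variable k : R.
Hypothesis k0 : 0 < k.
Implicit Types (t x : R) (b : bool) (u v a : R * R -> R) (p q : R * R).

Definition rinv u v b p := v p - sg b * riem k (u p).
Definition sound u p := u p `^ (- (k + 1)).
Definition rinv_dt u v b p := d_t v p - sg b * (sound u p * d_t u p).
Definition rinv_dx u v b p := d_x v p - sg b * (sound u p * d_x u p).

Lemma rinv_partial u v b (e p : R * R) : 0 < u p ->
  derivable_within halfplane e u p -> derivable_within halfplane e v p ->
  has_partial halfplane e (rinv u v b) p
    (derive_within halfplane e v p - sg b * (sound u p * derive_within halfplane e u p)).
Proof.
move=> up du dv.
have -> : rinv u v b = fun q => 1 * v q + (- sg b) * (riem k \o u) q.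
  by apply/funext => q; rewrite /rinv /=; ring.
have -> : derive_within halfplane e v p - sg b * (sound u p * derive_within halfplane e u p) =
  1 * derive_within halfplane e v p + (- sg b) * (sound u p * derive_within halfplane e u p) by ring.
apply: has_partialD; first exact: derivable_has_partial.
apply: has_partial_comp; first exact: riem_derive.
exact: derivable_has_partial.
Qed.

Section riemann_invariants_of_a_solution.
Variables (a u v : R * R -> R) (u0 v0 : R -> R).
Hypothesis sol : C1b_solution (2 * k + 1) a u0 v0 u v.

Lemma rinv_t b t x : 0 <= t ->
  has_partial halfplane (1, 0) (rinv u v b) (t, x) (rinv_dt u v b (t, x)).
Proof.
move=> t0; have [[[_ [ut _] _] [_ [vt _] _]] up _ _] := sol.
by apply: rinv_partial; [exact: up|exact: ut|exact: vt].
Qed.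

Lemma rinv_x b t x : 0 <= t ->
  has_partial halfplane (0, 1) (rinv u v b) (t, x) (rinv_dx u v b (t, x)).
Proof.
move=> t0; have [[[_ _ [ux _]] [_ _ [vx _]]] up _ _] := sol.
by apply: rinv_partial; [exact: up|exact: ux|exact: vx].
Qed.

Lemma rinv_eq b p : halfplane p ->
  rinv_dt u v b p + sg b * sound u p * rinv_dx u v b p = - a p * v p.
Proof.
case: p => t x t0; have [[[_ _ [ux _]] _] up eqs _] := sol.
have [E1 E2] := eqs (t, x) t0.
have PX := halfplane_x_proper t x t0.
have D := has_partial_comp halfplane (0, 1) u (t, x) _ _ _
  (pressure_derive k k0 _ (up _ t0)) (derivable_has_partial _ _ _ _ (ux _ t0)).
have [_ DE] := has_partial_derive _ _ _ _ _ PX D.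
rewrite -E2 [X in _ = _ + X]DE /rinv_dt /rinv_dx -/(sound u (t, x)) -/d_x.
have -> : d_t u (t, x) = d_x v (t, x) by apply/eqP; rewrite -subr_eq0 E1.
rewrite -/(d_x u (t, x)); have ss := sgM (R := R) b.
set s := sg b in ss *; set c := sound _ _; set du := d_x u _; set dv := d_x v _.
apply/eqP; rewrite -subr_eq0; apply/eqP.
by transitivity ((1 - s * s) * (c * c * du)); [ring | rewrite ss subrr mul0r].
Qed.

Lemma rinv_cvg b p : halfplane p ->
  rinv u v b q @[q --> within halfplane (nbhs p)] --> rinv u v b p.
Proof.
move=> hp; have [[[[uc _] _ _] [[vc _] _ _]] up _ _] := sol.
move/subspace_continuousP/(_ p hp): uc => uc; move/subspace_continuousP/(_ p hp): vc => vc.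
apply: cvgB; first exact: vc.
apply: cvgMl_tmp; apply: continuous_cvg uc.
apply/differentiable_continuous/derivable1_diffP.
exact: (@ex_derive _ _ _ _ _ _ _ (riem_derive k k0 _ (up p hp))).
Qed.

End riemann_invariants_of_a_solution.

Lemma rinv_vel u v p : v p = (rinv u v true p + rinv u v false p) / 2.
Proof. by rewrite /rinv /sg; field. Qed.

Lemma rinv_riem u v p : riem k (u p) = (rinv u v false p - rinv u v true p) / 2.
Proof. by rewrite /rinv /sg; field. Qed.

Let kn0 : k != 0. Proof. exact: lt0r_neq0. Qed.

Lemma powRN_anti (e y z : R) : 0 <= e -> 0 < y -> y <= z -> z `^ (- e) <= y `^ (- e).
Proof.
move=> e0 y0 yz; rewrite !powRN lef_pV2 ?posrE ?powR_gt0//; last exact: lt_le_trans yz.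
by rewrite ge0_ler_powR// nnegrE ltW// (lt_le_trans y0).
Qed.

(** As a function of [riem u] the sound speed has derivative - (k + 1) / u, which is bounded
    wherever u >= d, without an upper bound on u. *)
Lemma sound_riem_lip (d y z : R) : 0 < d -> d <= y -> d <= z ->
  `|z `^ (- (k + 1)) - y `^ (- (k + 1))| <= (k + 1) / d * `|riem k z - riem k y|.
Proof.
move=> d0 dy dz; have k00 := k0.
have y0 : 0 < y by exact: lt_le_trans dy.
have z0 : 0 < z by exact: lt_le_trans dz.
rewrite -!(speed_riem k k0)//.
pose lo := Num.min (riem k y) (riem k z); pose hi := Num.max (riem k y) (riem k z).
have zeta w : lo <= w <= hi -> 0 < 1 - k * w <= d `^ (- k).
  move=> /andP[low whi]; apply/andP; split.
    have hi1 : k * hi < 1.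
      have zy := affine_riem_gt0 k k0 _ y0; have zz := affine_riem_gt0 k k0 _ z0.
      by rewrite /hi maxEle; case: ifP => _; lra.
    have : k * w <= k * hi by rewrite ler_wpM2l// ltW.
    by lra.
  have lo1 : 1 - k * lo <= d `^ (- k).
    rewrite /lo minEle; case: ifP => _; rewrite affine_riem//; apply: powRN_anti => //; exact: ltW.
  have : k * lo <= k * w by rewrite ler_wpM2l// ltW.
  by lra.
apply: (lipschitz_itv (speed k) (dspeed k) lo hi).
- by move=> w /zeta/andP[w0 _]; exact: speed_derive.
- move=> w /zeta/andP[w0 w1]; apply: le_normM.
    by rewrite normrN ger0_norm//; lra.
  rewrite ger0_norm ?powR_ge0//; apply: (@le_trans _ _ ((d `^ (- k)) `^ k^-1)).
    by rewrite ge0_ler_powR ?nnegrE ?powR_ge0 ?invr_ge0// ltW.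
  by rewrite -powRrM mulNr divff// powRN powRr1// ltW.
- by rewrite /lo /hi ge_min le_max !lexx.
- by rewrite /lo /hi ge_min le_max !lexx !orbT.
Qed.

Lemma riem_bound (d y : R) : 0 < d -> d <= y -> `|riem k y| <= (1 + d `^ (- k)) / k.
Proof.
move=> d0 dy; rewrite /riem normrM (gtr0_norm (x := k^-1)) ?invr_gt0//.
rewrite ler_wpM2r ?invr_ge0 ?(ltW k0)//; apply: le_normB; first by rewrite normr1.
by rewrite ger0_norm ?powR_ge0// powRN_anti// ltW.
Qed.

(** The competing solution is only known to be positive, which leaves its sound speed unbounded. At
    the start of a strip it equals u >= 2 d, and its bounded time derivative keeps it above d on a
    strip of fixed length; strips of that length then reach every time. *)
Lemma solution_unique a u v u' v' (u0 v0 : R -> R) (d : R) :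
  C1b_halfplane a ->
  C1b_solution (2 * k + 1) a u0 v0 u v -> 0 < d -> (forall p, halfplane p -> 2 * d <= u p) ->
  C1b_solution (2 * k + 1) a u0 v0 u' v' ->
  forall p, halfplane p -> u' p = u p /\ v' p = v p.
Proof.
move=> [aC _ _] sol d0 ud sol'; have k00 := k0.
have [[[_ _ [_ uxC]] [vC _ [_ vxC]]] up _ init] := sol.
have [[[_ [utd utC] _] [vC' _ _]] up' _ init'] := sol'.
have [Ma HMa] := Cb_bound _ _ aC; have [Mux HMux] := Cb_bound _ _ uxC.
have [Mvx HMvx] := Cb_bound _ _ vxC; have [Mut HMut] := Cb_bound _ _ utC.
have [Mv HMv] := Cb_bound _ _ vC; have [Mv' HMv'] := Cb_bound _ _ vC'.
have h00 : halfplane ((0, 0) : R * R) by rewrite /halfplane/=.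
have Ma0 := le_trans (normr_ge0 _) (HMa _ h00).
have Mux0 := le_trans (normr_ge0 _) (HMux _ h00).
have Mvx0 := le_trans (normr_ge0 _) (HMvx _ h00).
have Mut0 := le_trans (normr_ge0 _) (HMut _ h00).
pose c1 := d `^ (- (k + 1)).
have c10 : 0 < c1 by exact: powR_gt0.
pose Lc := (k + 1) / d.
have Lc0 : 0 <= Lc by rewrite divr_ge0 ?(ltW d0)//; lra.
pose K := Ma + Lc * (Mvx + c1 * Mux).
have K0 : 0 <= K.
  by rewrite addr_ge0// mulr_ge0// addr_ge0// mulr_ge0// ltW.
(* The first term keeps u' from falling from 2 d below d, the second is the length condition of the
   maximum principle; neither depends on the strip. *)
pose tau := Num.min (d / (Mut + 1)) ((4 * (K + c1 + 1))^-1).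
have Kc0 : 0 < 4 * (K + c1 + 1) by lra.
have Mut1 : 0 < Mut + 1 by lra.
have tau0 : 0 < tau by rewrite lt_min divr_gt0// invr_gt0.
have [tau1 tau2] : (Mut + 1) * tau <= d /\ 4 * (K + c1 + 1) * tau <= 1.
  split.
    by rewrite mulrC -ler_pdivlMr// ge_min lexx.
  by rewrite mulrC -ler_pdivlMr// div1r ge_min lexx orbT.
have H n : forall t x, 0 <= t <= n%:R * tau -> u' (t, x) = u (t, x) /\ v' (t, x) = v (t, x).
  elim: n => [|n IH] t x.
    rewrite mul0r => /le_anti <-.
    have [E1 E2] := init x; have [E1' E2'] := init' x.
    by rewrite E1 E2 E1' E2'.
  have nt0 : 0 <= n%:R * tau by rewrite mulr_ge0// ltW.
  rewrite -natr1 mulrDl mul1r => /andP[t0 tn].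
  have [tn'|/ltW Tt] := leP t (n%:R * tau); first by apply: IH; rewrite t0.
  set T := n%:R * tau in IH nt0 tn Tt.
  have low p : T <= p.1 <= T + tau -> d <= u' p.
    case: p => s y /= /andP[Ts sT]; have s0 := le_trans nt0 Ts.
    have := halfline_lipschitz (fun s => u' (s, y)) (fun s => d_t u' (s, y)) Mut _ _ s T s0 nt0.
    have [-> _] := IH T y (introT andP (conj nt0 (lexx T))).
    rewrite (ger0_norm (x := s - T)) ?subr_ge0// => /(_ _ _) A.
    have : `|u' (s, y) - u (T, y)| <= Mut * (s - T).
      apply: A => r r0; last exact: HMut.
      by apply/has_partial_t; exact: derivable_has_partial (utd (r, y) r0).
    rewrite ler_norml => /andP[A1 _].
    have : Mut * (s - T) <= Mut * tau by rewrite ler_wpM2l//; lra.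
    have := ud (T, y) nt0; lra.
  pose F b p := rinv u' v' b p - rinv u v b p.
  pose Ft b p := rinv_dt u' v' b p - rinv_dt u v b p.
  pose Fx b p := rinv_dx u' v' b p - rinv_dx u v b p.
  pose c b p := sg b * sound u' p.
  have inH (p : R * R) : T <= p.1 <= T + tau -> halfplane p.
    by move=> /andP[Tp _]; exact: le_trans Tp.
  have Fpart b (e : R * R) p l l' : has_partial halfplane e (rinv u' v' b) p l' ->
      has_partial halfplane e (rinv u v b) p l -> has_partial halfplane e (F b) p (l' - l).
    move=> P' P; have -> : F b = fun q => 1 * rinv u' v' b q + (- 1) * rinv u v b q.
      by apply/funext => q; rewrite /F; ring.
    have -> : l' - l = 1 * l' + (- 1) * l by ring.
    exact: has_partialD.
  have FB b p : T <= p.1 <= T + tau ->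
      `|F b p| <= (Mv' + (1 + d `^ (- k)) / k) + (Mv + (1 + d `^ (- k)) / k).
    move=> sp; have hp := inH p sp.
    apply: le_normB; apply: le_normB; [exact: HMv'| |exact: HMv|];
      apply: le_norm_sg; apply: (riem_bound d _ d0); first exact: low.
    by apply: le_trans (ud p hp); lra.
  have sound_le p : T <= p.1 <= T + tau -> 0 <= sound u' p <= c1.
    move=> sp; rewrite powR_ge0/=; apply: powRN_anti => //; last exact: low.
    by rewrite addr_ge0// ltW.
  have F0 := transport_uniqueness F Ft Fx c T tau K c1 _ tau0 K0 (ltW c10) tau2 _ FB.
  have {F0} : forall b p, T <= p.1 <= T + tau -> F b p = 0.
    apply: F0.
    - move=> b p sp; have hp := inH p sp.
      have sub (g : R * R -> R) : g q @[q --> within halfplane (nbhs p)] --> g p ->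
          g q @[q --> within [set q : R * R | T <= q.1 <= T + tau] (nbhs p)] --> (g p : R).
        move=> G A /G hA; have hA' : nbhs p [set q | halfplane q -> A (g q)] := hA.
        suff : nbhs p [set q | T <= q.1 <= T + tau -> A (g q)] by [].
        by apply: filterS hA' => q h /inH hq; exact: h.
      apply: cvgB; apply: sub.
        exact: (rinv_cvg _ _ _ _ _ sol').
      exact: (rinv_cvg _ _ _ _ _ sol).
    - move=> b y; have [E1 E2] := IH T y (introT andP (conj nt0 (lexx T))).
      by rewrite /F /rinv E1 E2 subrr.
    - move=> b s y sp; have s0 : 0 <= s := inH (s, y) sp.
      apply/(has_partial_x _ _ _ _ s0); apply: Fpart.
        exact: (rinv_x _ _ _ _ _ sol').
      exact: (rinv_x _ _ _ _ _ sol).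
    - move=> b s y sp eps eps0; have s0 : 0 <= s := inH (s, y) sp.
      have P : has_partial halfplane (1, 0) (F b) (s, y) (Ft b (s, y)).
        apply: Fpart.
          exact: (rinv_t _ _ _ _ _ sol').
        exact: (rinv_t _ _ _ _ _ sol).
      have [r r0 Hr] := iffLR (has_partial_t _ _ _ _) P eps eps0.
      by exists r => // s' /andP[Ts' _]; apply: Hr; exact: le_trans Ts'.
    - move=> b p sp; rewrite normrM norm_sg mul1r.
      by have /andP[? ?] := sound_le p sp; rewrite ger0_norm.
    - move=> b p m sp Fm; have hp := inH p sp.
      have E' := rinv_eq _ _ _ _ _ sol' b p hp; have E := rinv_eq _ _ _ _ _ sol b p hp.
      (* Transporting the difference with the speed of u' leaves the difference of the speeds
         multiplied by the x-derivative of the given invariant, which is bounded; the right-hand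
         side is thus linear in F. *)
      have -> : Ft b p + c b p * Fx b p = - (a p * (v' p - v p))
          - sg b * ((sound u' p - sound u p) * rinv_dx u v b p).
        have -> : - (a p * (v' p - v p)) = (- a p * v' p) - (- a p * v p) by ring.
        by rewrite -E' -E /Ft /Fx /c; ring.
      have m0 := le_trans (normr_ge0 _) (Fm true).
      have dv : `|v' p - v p| <= m.
        rewrite (rinv_vel u' v') (rinv_vel u v).
        have := Fm true; have := Fm false; rewrite /F !ler_norml.
        by clear => /andP[? ?] /andP[? ?]; lra.
      have dr : `|riem k (u' p) - riem k (u p)| <= m.
        rewrite (rinv_riem u' v') (rinv_riem u v).
        have := Fm true; have := Fm false; rewrite /F !ler_norml.
        by clear => /andP[? ?] /andP[? ?]; lra.
      have dp : d <= u p by apply: le_trans (ud p hp); clear -d0; lra.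
      apply: (@le_trans _ _ (Ma * m + (Lc * m) * (Mvx + c1 * Mux))); last first.
        by clear; rewrite /K; lra.
      apply: le_normB.
        by rewrite normrN; apply: le_normM => //; exact: HMa.
      apply: le_norm_sg; apply: le_normM.
        apply: (le_trans (sound_riem_lip d _ _ d0 dp (low p sp))).
        by rewrite ler_wpM2l.
      apply: le_normB; first exact: HMvx.
      apply: le_norm_sg; apply: le_normM; last exact: HMux.
      by rewrite ger0_norm ?powR_ge0//; apply: powRN_anti => //; clear -k00; lra.
  move=> F0; have sp : T <= (t, x).1 <= T + tau by rewrite /= Tt.
  have hp := inH _ sp.
  have F0' b : rinv u' v' b (t, x) = rinv u v b (t, x).
    by apply/eqP; rewrite -subr_eq0; apply/eqP; exact: F0.
  split; last by rewrite (rinv_vel u' v') (rinv_vel u v) !F0'.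
  rewrite -(riemK k k0 (u' (t, x)) (up' _ hp)) -(riemK k k0 (u (t, x)) (up _ hp)).
  by rewrite (rinv_riem u' v') (rinv_riem u v) !F0'.
case=> t x t0; apply: (H (Num.trunc (t / tau)).+1).
have /andP[_ lt] := truncn_itv (divr_ge0 t0 (ltW tau0)).
by rewrite t0/= -ler_pdivrMr// ltW.
Qed.

End uniqueness.

Lemma invariants_exist {R : realType} (a ax : R -> R -> R) (c dc : R -> R) (L eta0 : R)
    (init dinit : bool -> R -> R) (w : bool -> R -> R -> R) (m0 m1 mu N W h1 : R) :
  coef_bounds a ax c dc L eta0 ->
  data_bounds a ax L eta0 init dinit w m0 m1 mu N W h1 ->
  exists r rx : bool -> R -> R -> R,
    let rt b t x := - (sg b * c (eta (fun b => r b t) x) * rx b t x)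
                    - a t x * vel (fun b => r b t) x in
    [/\ forall b t x, 0 <= t -> `|r b t x| <= m0,
        forall b t x, 0 <= t -> `|rx b t x| <= m1,
        forall b x, r b 0 x = init b x &
        forall T X e : R, 0 <= T -> 0 <= X -> 0 < e ->
          exists2 d : R, 0 < d & forall t b x, 0 <= t <= T -> `|x| <= X ->
            (forall y, `|y| <= X -> `|y - x| <= d ->
               `|rx b t y - rx b t x| <= e /\
               `|r b t y - r b t x - (y - x) * rx b t x| <= e * `|y - x|) /\
            (forall t', 0 <= t' <= T -> `|t' - t| <= d ->
               `|rx b t' x - rx b t x| <= e /\
               `|r b t' x - r b t x - (t' - t) * rt b t x| <= e * `|t' - t|)].
Proof.
move=> coefs data.
exists (lim_inv a ax c dc init dinit), (lim_dx a ax c dc init dinit); split.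
- by move=> b t x; exact: (f_bnd _ _ _ _ _ _ _ _ _ _ _ _ _ _ _ coefs data).
- by move=> b t x; exact: (p_bnd _ _ _ _ _ _ _ _ _ _ _ _ _ _ _ coefs data).
- by move=> b x; exact: f_init.
- by move=> T X e; exact: (limit_regular _ _ _ _ _ _ _ _ _ _ _ _ _ _ _ coefs data).
Qed.

(** * The solution (u, v) rebuilt from its Riemann invariants *)

Section bounded_continuous_functions.
Context {R : realType} {V : normedModType R}.
Implicit Types (A : set V) (f g : V -> R).

Lemma Cb_ext A f g : (forall q, A q -> f q = g q) -> Cb A f -> Cb A g.
Proof.
move=> fg fC; apply: Cb_intro.
  move=> q Aq e e0; have [d d0 Hd] := Cb_modulus _ _ q e fC Aq e0.
  by exists d => // q' Aq' qd; rewrite -!fg//; exact: Hd.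
have [M HM] := Cb_bound _ _ fC; exists M => q Aq; rewrite -fg//; exact: HM.
Qed.

Lemma bounded_cvg_Cb A f (M : R) :
  (forall q, A q -> f x @[x --> within A (nbhs q)] --> f q) ->
  (forall q, A q -> `|f q| <= M) -> Cb A f.
Proof.
move=> fc fM; split; first exact/subspace_continuousP.
exists M; split; first exact: num_real.
by move=> x Mx q Aq /=; rewrite (le_trans (fM q Aq))// ltW.
Qed.

Lemma Cb_cvg A f q : Cb A f -> A q -> f x @[x --> within A (nbhs q)] --> f q.
Proof. by move=> [/subspace_continuousP H _]; exact: H. Qed.

Lemma CbD A f g (r s : R) : Cb A f -> Cb A g -> Cb A (fun q => r * f q + s * g q).
Proof.
move=> fC gC; have [M HM] := Cb_bound _ _ fC; have [N HN] := Cb_bound _ _ gC.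
apply: (@bounded_cvg_Cb _ _ (`|r| * M + `|s| * N)) => q Aq.
  by apply: cvgD; apply: cvgMl_tmp; exact: Cb_cvg.
by apply: le_normD; apply: le_normM => //; [exact: HM | exact: HN].
Qed.

Lemma CbM A f g : Cb A f -> Cb A g -> Cb A (fun q => f q * g q).
Proof.
move=> fC gC; have [M HM] := Cb_bound _ _ fC; have [N HN] := Cb_bound _ _ gC.
apply: (@bounded_cvg_Cb _ _ (M * N)) => q Aq.
  by apply: cvgM; exact: Cb_cvg.
by apply: le_normM; [exact: HM | exact: HN].
Qed.

Lemma Cb_comp A f (phi : R -> R) (M : R) : Cb A f ->
  (forall q, A q -> {for f q, continuous phi}) -> (forall q, A q -> `|phi (f q)| <= M) ->
  Cb A (phi \o f).
Proof.
move=> fC phic phiM; apply: (@bounded_cvg_Cb _ _ M) => // q Aq.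
have h := Cb_cvg _ _ _ fC Aq.
by apply: continuous_cvg h; exact: phic.
Qed.

End bounded_continuous_functions.

Section solution_from_invariants.
Context {R : realType}.
Variables (k : R) (a : R * R -> R) (L eta0 m0 m1 : R).
Variables (r rx : bool -> R -> R -> R).
Hypotheses (k0 : 0 < k) (L0 : 0 <= L).
Hypothesis eta0_k : k * eta0 <= 1 / 2.
Hypothesis speedP : forall e, `|e| <= eta0 -> 1 / 2 <= speed k e <= 2.
Hypothesis aC : Cb halfplane a.
Hypothesis aL : forall p, halfplane p -> `|a p| <= L.
Hypothesis m0_eta0 : m0 <= eta0.
Hypothesis rB : forall b t x, 0 <= t -> `|r b t x| <= m0.
Hypothesis rxB : forall b t x, 0 <= t -> `|rx b t x| <= m1.

Let rt b t x := - (sg b * speed k (eta (fun b => r b t) x) * rx b t x)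
                - a (t, x) * vel (fun b => r b t) x.

Hypothesis rreg : forall T X e : R, 0 <= T -> 0 <= X -> 0 < e ->
  exists2 d : R, 0 < d & forall t b x, 0 <= t <= T -> `|x| <= X ->
    (forall y, `|y| <= X -> `|y - x| <= d ->
       `|rx b t y - rx b t x| <= e /\
       `|r b t y - r b t x - (y - x) * rx b t x| <= e * `|y - x|) /\
    (forall t', 0 <= t' <= T -> `|t' - t| <= d ->
       `|rx b t' x - rx b t x| <= e /\
       `|r b t' x - r b t x - (t' - t) * rt b t x| <= e * `|t' - t|).

Definition Eta (p : R * R) := eta (fun b => r b p.1) p.2.
Definition sol_u (p : R * R) := vol k (Eta p).
Definition sol_v (p : R * R) := vel (fun b => r b p.1) p.2.

Let Eta_bnd p : halfplane p -> `|Eta p| <= m0.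
Proof. by move=> hp; apply: le_eta => b; exact: rB. Qed.

Let Eta_eta0 p : halfplane p -> `|Eta p| <= eta0.
Proof. by move=> hp; apply: le_trans m0_eta0; exact: Eta_bnd. Qed.

Let zeta_itv p : halfplane p -> 1 / 2 <= 1 - k * Eta p <= 3 / 2.
Proof.
move=> hp; have : `|k * Eta p| <= 1 / 2.
  apply: le_trans eta0_k; apply: le_normMl; [exact: ltW | exact: Eta_eta0].
by rewrite ler_norml => /andP[? ?]; lra.
Qed.

Let zeta_gt0 p : halfplane p -> 0 < 1 - k * Eta p.
Proof. by move=> /zeta_itv/andP[? _]; lra. Qed.

Let speed_itv p : halfplane p -> 1 / 2 <= speed k (Eta p) <= 2.
Proof. by move=> hp; apply: speedP; exact: Eta_eta0. Qed.

Let rt_bnd b p : halfplane p -> `|rt b p.1 p.2| <= 2 * m1 + L * m0.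
Proof.
move=> hp; apply: le_normB.
  rewrite normrN -mulrA; apply: le_norm_sg; apply: le_normM; last exact: rxB.
  by have /andP[? ?] := speed_itv p hp; rewrite ger0_norm//; lra.
apply: le_normM; first by case: p hp => t x hp; exact: aL.
by apply: le_vel => b'; exact: rB.
Qed.

Lemma invariant_x b t x : 0 <= t ->
  has_partial halfplane (0, 1) (fun p => r b p.1 p.2) (t, x) (rx b t x).
Proof.
move=> t0; apply/(has_partial_x _ _ _ _ t0) => e e0 /=.
have X0 : 0 <= `|x| + 1 by rewrite addr_ge0.
have [d d0 Hd] := rreg t (`|x| + 1) e t0 X0 e0.
exists (Num.min d 1) => [|y]; first by rewrite lt_min d0 ltr01.
rewrite le_min => /andP[yd y1].
have [] := Hd t b x _ _; first by rewrite t0 lexx.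
  by rewrite lerDl.
have yX : `|y| <= `|x| + 1.
  by rewrite (_ : y = x + (y - x)); [exact: le_normD | ring].
by move=> /(_ y yX yd)[].
Qed.

Lemma invariant_t b t x : 0 <= t ->
  has_partial halfplane (1, 0) (fun p => r b p.1 p.2) (t, x) (rt b t x).
Proof.
move=> t0; apply/has_partial_t => e e0 /=.
have T0 : 0 <= t + 1 by rewrite addr_ge0.
have [d d0 Hd] := rreg (t + 1) `|x| e T0 (normr_ge0 _) e0.
exists (Num.min d 1) => [|t' t'0]; first by rewrite lt_min d0 ltr01.
rewrite le_min => /andP[td t1].
have [] := Hd t b x _ (lexx _); first by rewrite t0 lerDl ler01.
have tT : 0 <= t' <= t + 1.
  by rewrite t'0; move: t1; rewrite ler_norml => /andP[_ ?]; rewrite /=; lra.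
by move=> _ /(_ t' tT td)[].
Qed.

Lemma invariant_dx_Cb b : Cb halfplane (fun p => rx b p.1 p.2).
Proof.
apply: Cb_intro; last by exists m1 => p hp; exact: rxB.
move=> [t x] t0 e e0 /=.
have T0 : 0 <= t + 1 by rewrite addr_ge0.
have X0 : 0 <= `|x| + 1 by rewrite addr_ge0.
have [d d0 Hd] := rreg (t + 1) (`|x| + 1) (e / 2) T0 X0 (divr_gt0 e0 (ltr0n _ 2)).
exists (Num.min d 1) => [|[t' x'] t'0]; first by rewrite lt_min d0 ltr01.
rewrite prod_norm_le /= !le_min => /andP[/andP[td t1] /andP[xd x1]].
have tin : 0 <= t <= t + 1 by rewrite t0 lerDl ler01.
have t'in : 0 <= t' <= t + 1.
  by move: t1; rewrite ler_norml => /andP[_ ?]; rewrite t'0/=; lra.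
have x'X : `|x'| <= `|x| + 1.
  by rewrite (_ : x' = x + (x' - x)); [exact: le_normD | ring].
have xX : `|x| <= `|x| + 1 by rewrite lerDl.
have [A _] := (Hd t b x tin xX).1 x' x'X xd.
have [B _] := (Hd t b x' tin x'X).2 t' t'in td.
have -> : rx b t' x' - rx b t x = (rx b t' x' - rx b t x') + (rx b t x' - rx b t x) by ring.
by rewrite (_ : e = e / 2 + e / 2); [exact: le_normD | field].
Qed.

Lemma invariant_Cb b : Cb halfplane (fun p => r b p.1 p.2).
Proof.
apply: Cb_intro; last by exists m0 => p hp; exact: rB.
move=> [t x] t0 e e0 /=.
have T0 : 0 <= t + 1 by rewrite addr_ge0.
have X0 : 0 <= `|x| + 1 by rewrite addr_ge0.
have [d d0 Hd] := rreg (t + 1) (`|x| + 1) 1 T0 X0 ltr01.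
have m00 : 0 <= m0 := le_trans (normr_ge0 _) (rB true t x t0).
have m10 : 0 <= m1 := le_trans (normr_ge0 _) (rxB true t x t0).
pose M := 1 + (m1 + (2 * m1 + L * m0)).
have Lm0 : 0 <= L * m0 by rewrite mulr_ge0.
have M0 : 0 < M by rewrite /M; lra.
exists (Num.min (Num.min d 1) (e / (2 * M))) => [|[t' x'] t'0].
  by rewrite !lt_min d0 ltr01 divr_gt0// mulr_gt0.
rewrite prod_norm_le /= !le_min => /andP[/andP[/andP[td t1] te] /andP[/andP[xd x1] xe]].
have tin : 0 <= t <= t + 1 by rewrite t0 lerDl ler01.
have t'in : 0 <= t' <= t + 1.
  by move: t1; rewrite ler_norml => /andP[_ ?]; rewrite t'0/=; lra.
have x'X : `|x'| <= `|x| + 1.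
  by rewrite (_ : x' = x + (x' - x)); [exact: le_normD | ring].
have xX : `|x| <= `|x| + 1 by rewrite lerDl.
have [_ A] := (Hd t b x tin xX).1 x' x'X xd.
have [_ B] := (Hd t b x' tin x'X).2 t' t'in td.
have -> : r b t' x' - r b t x =
  ((r b t' x' - r b t x' - (t' - t) * rt b t x') + (t' - t) * rt b t x') +
  ((r b t x' - r b t x - (x' - x) * rx b t x) + (x' - x) * rx b t x) by ring.
have half (s : R) : `|s| <= e / (2 * M) -> `|s| * M <= e / 2.
  by move=> h; rewrite -ler_pdivlMr// -mulrA -invfM.
apply: (@le_trans _ _ (`|t' - t| * M + `|x' - x| * M)); last first.
  by rewrite (_ : e = e / 2 + e / 2); [apply: lerD; exact: half | field].
apply: le_normD.
  apply: (@le_trans _ _ (1 * `|t' - t| + `|t' - t| * (2 * m1 + L * m0))).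
    by apply: le_normD => //; apply: le_normM => //; exact: (rt_bnd b (t, x') t0).
  by have := mulr_ge0 (normr_ge0 (t' - t)) m10; rewrite /M; lra.
apply: (@le_trans _ _ (1 * `|x' - x| + `|x' - x| * m1)).
  by apply: le_normD => //; apply: le_normM => //; exact: rxB.
have h : 0 <= 2 * m1 + L * m0 by lra.
by have := mulr_ge0 (normr_ge0 (x' - x)) h; rewrite /M; lra.
Qed.

Let vol_cont p : halfplane p -> {for Eta p, continuous (vol k)}.
Proof.
move=> hp; apply/differentiable_continuous/derivable1_diffP.
exact: (@ex_derive _ _ _ _ _ _ _ (vol_derive k k0 _ (zeta_gt0 p hp))).
Qed.

Let speed_cont p : halfplane p -> {for Eta p, continuous (speed k)}.
Proof.
move=> hp; apply/differentiable_continuous/derivable1_diffP.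
exact: (@ex_derive _ _ _ _ _ _ _ (speed_derive k k0 _ (zeta_gt0 p hp))).
Qed.

Let EtaE : Eta = fun q => 1 / 2 * r false q.1 q.2 + (- (1 / 2)) * r true q.1 q.2.
Proof. by apply/funext => q; rewrite /Eta /eta; field. Qed.

Let velE : sol_v = fun q => 1 / 2 * r false q.1 q.2 + 1 / 2 * r true q.1 q.2.
Proof. by apply/funext => q; rewrite /sol_v /vel; field. Qed.

Let Eta_Cb : Cb halfplane Eta.
Proof. by rewrite EtaE; apply: CbD; exact: invariant_Cb. Qed.

Let v_Cb : Cb halfplane sol_v.
Proof. by rewrite velE; apply: CbD; exact: invariant_Cb. Qed.

Let speed_Cb : Cb halfplane (speed k \o Eta).
Proof.
apply: (@Cb_comp _ _ _ _ _ 2) => // p hp.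
by have /andP[? ?] := speed_itv p hp; rewrite ger0_norm//; lra.
Qed.

Let ispeed_Cb : Cb halfplane (fun p => (speed k (Eta p))^-1).
Proof.
apply: (@bounded_cvg_Cb _ _ _ _ 2) => p hp; have /andP[s1 s2] := speed_itv p hp.
  apply: cvgV; first by rewrite gt_eqF//; lra.
  exact: (Cb_cvg _ _ _ speed_Cb hp).
rewrite ger0_norm ?invr_ge0; last by lra.
rewrite -[leRHS]invrK lef_pV2 ?posrE//; lra.
Qed.

Let vol_le p : halfplane p -> `|sol_u p| <= (1 / 2) `^ (- k^-1).
Proof.
move=> hp; have /andP[z1 _] := zeta_itv p hp.
rewrite ger0_norm ?powR_ge0//.
by apply: powRN_anti; [rewrite invr_ge0 ltW | rewrite divr_gt0 | ].
Qed.

Lemma sol_u_ge p : halfplane p -> (3 / 2) `^ (- k^-1) <= sol_u p.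
Proof.
move=> hp; have /andP[_ z2] := zeta_itv p hp; apply: powRN_anti => //.
  by rewrite invr_ge0 ltW.
exact: zeta_gt0.
Qed.

Let u_Cb : Cb halfplane sol_u.
Proof. by apply: (@Cb_comp _ _ _ _ _ ((1 / 2) `^ (- k^-1))). Qed.

Let rt_Cb b : Cb halfplane (fun p => rt b p.1 p.2).
Proof.
apply: (Cb_ext _ (fun p => (- sg b) * (speed k (Eta p) * rx b p.1 p.2) + (- 1) * (a p * sol_v p))).
  by move=> [t x] _; rewrite /rt /sol_v /Eta/=; ring.
by apply: CbD; apply: CbM => //; exact: invariant_dx_Cb.
Qed.

Section partials.
(** The direction e and the partial derivatives s of the invariants are kept abstract, so that t and
    x are treated together. *)
Variables (e : R * R) (s : bool -> R -> R -> R).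
Hypothesis proper : forall p, halfplane p -> ProperFilter (increments (@halfplane R) p e).
Hypothesis sP : forall b p, halfplane p ->
  has_partial halfplane e (fun p => r b p.1 p.2) p (s b p.1 p.2).
Hypothesis sC : forall b, Cb halfplane (fun p => s b p.1 p.2).

Let Eta_partial p : halfplane p ->
  has_partial halfplane e Eta p (eta (fun b => s b p.1) p.2).
Proof.
move=> hp; rewrite EtaE.
have -> : eta (fun b => s b p.1) p.2 = 1 / 2 * s false p.1 p.2 + (- (1 / 2)) * s true p.1 p.2.
  by rewrite /eta; field.
by apply: has_partialD; exact: sP.
Qed.

Lemma sol_v_partial p : halfplane p ->
  derivable_within halfplane e sol_v p /\
  derive_within halfplane e sol_v p = vel (fun b => s b p.1) p.2.
Proof.
move=> hp; have PF := proper p hp; apply: has_partial_derive; rewrite velE.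
have -> : vel (fun b => s b p.1) p.2 = 1 / 2 * s false p.1 p.2 + 1 / 2 * s true p.1 p.2.
  by rewrite /vel; field.
by apply: has_partialD; exact: sP.
Qed.

Lemma sol_u_partial p : halfplane p ->
  derivable_within halfplane e sol_u p /\
  derive_within halfplane e sol_u p = (speed k (Eta p))^-1 * eta (fun b => s b p.1) p.2.
Proof.
move=> hp; have PF := proper p hp; apply: has_partial_derive.
apply: has_partial_comp; last exact: Eta_partial.
by apply: vol_derive => //; exact: zeta_gt0.
Qed.

Lemma sol_v_has_Cb_derive : has_Cb_derive halfplane e sol_v.
Proof.
split=> [p /sol_v_partial[]//|].
apply: (Cb_ext _ (fun p => 1 / 2 * s false p.1 p.2 + 1 / 2 * s true p.1 p.2)).
  by move=> p /sol_v_partial[_ ->]; rewrite /vel; field.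
exact: CbD.
Qed.

Lemma sol_u_has_Cb_derive : has_Cb_derive halfplane e sol_u.
Proof.
split=> [p /sol_u_partial[]//|].
apply: (Cb_ext _ (fun p => (speed k (Eta p))^-1 *
  (1 / 2 * s false p.1 p.2 + (- (1 / 2)) * s true p.1 p.2))).
  move=> p /sol_u_partial[_ ->]; congr (_ * _); by rewrite /eta; field.
by apply: CbM => //; exact: CbD.
Qed.

End partials.

Let px p (hp : halfplane p) : ProperFilter (increments (@halfplane R) p (0, 1)).
Proof. by case: p hp => t x; exact: halfplane_x_proper. Qed.

Let pt p (hp : halfplane p) : ProperFilter (increments (@halfplane R) p (1, 0)).
Proof. by case: p hp => t x; exact: halfplane_t_proper. Qed.

Let sx b p (hp : halfplane p) :
  has_partial halfplane (0, 1) (fun p => r b p.1 p.2) p (rx b p.1 p.2).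
Proof. by case: p hp => t x; exact: invariant_x. Qed.

Let st b p (hp : halfplane p) :
  has_partial halfplane (1, 0) (fun p => r b p.1 p.2) p (rt b p.1 p.2).
Proof. by case: p hp => t x; exact: invariant_t. Qed.

Let speed_gt0' p : halfplane p -> 0 < speed k (Eta p).
Proof. by move=> /speed_itv/andP[? _]; lra. Qed.

Let sound_speed p : halfplane p -> sol_u p `^ (- (k + 1)) = speed k (Eta p).
Proof.
move=> hp; have z0 := zeta_gt0 p hp.
by rewrite -(speed_riem k k0) ?vol_gt0// volK.
Qed.

Lemma sol_is_solution (u0 v0 : R -> R) :
  (forall x, vol k (eta (fun b => r b 0) x) = u0 x) ->
  (forall x, vel (fun b => r b 0) x = v0 x) ->
  C1b_solution (2 * k + 1) a u0 v0 sol_u sol_v.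
Proof.
move=> hu hv; split.
- split; split=> //.
  + exact: (sol_u_has_Cb_derive _ _ pt st rt_Cb).
  + exact: (sol_u_has_Cb_derive _ _ px sx invariant_dx_Cb).
  + exact: (sol_v_has_Cb_derive _ _ pt st rt_Cb).
  + exact: (sol_v_has_Cb_derive _ _ px sx invariant_dx_Cb).
- by move=> p hp; apply: vol_gt0; exact: zeta_gt0.
- move=> p hp; have c0 := lt0r_neq0 (speed_gt0' p hp).
  have [ux uxE] := sol_u_partial _ _ px sx p hp; have [_ utE] := sol_u_partial _ _ pt st p hp.
  have [_ vxE] := sol_v_partial _ _ px sx p hp; have [_ vtE] := sol_v_partial _ _ pt st p hp.
  have up : 0 < sol_u p by apply: vol_gt0; exact: zeta_gt0.
  have PX := px p hp.
  have D := has_partial_comp halfplane (0, 1) sol_u p _ _ _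
    (pressure_derive k k0 _ up) (derivable_has_partial _ _ _ _ ux).
  have [_ DE] := has_partial_derive _ _ _ _ _ PX D.
  rewrite /d_t /d_x utE vxE vtE [X in _ /\ _ + X = _]DE uxE sound_speed//.
  (* The damping is the same for both invariants: it cancels in eta_t = c v_x, which gives u_t =
     v_x, and it survives in full in v_t. *)
  rewrite /eta /vel /rt -!/(Eta _) -!/(sol_v _) -surjective_pairing /sg.
  by split; field.
- by move=> x; rewrite /sol_u /sol_v /Eta/= hu hv.
Qed.

Lemma sol_u_sub1 p : halfplane p -> `|sol_u p - 1| <= 2 * m0.
Proof.
move=> hp; have m00 := le_trans (normr_ge0 _) (Eta_bnd p hp).
have v0 : vol k 0 = 1 by rewrite /vol mulr0 subr0 powR1.
rewrite -[X in `|_ - X|]v0.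
have z (e : R) : `|e| <= eta0 -> 0 < 1 - k * e.
  move=> ee; have : `|k * e| <= 1 / 2.
    by apply: le_trans eta0_k; apply: le_normMl => //; exact: ltW.
  by rewrite ler_norml => /andP[? ?]; lra.
apply: (@le_trans _ _ (2 * `|Eta p - 0|)); last by rewrite subr0 ler_wpM2l// Eta_bnd.
apply: (@lipschitz_of_derive _ (vol k) (fun e => (speed k e)^-1) eta0).
- by move=> e /z; exact: vol_derive.
- move=> e /speedP/andP[s1 s2]; rewrite ger0_norm ?invr_ge0; last by lra.
  rewrite -[leRHS]invrK lef_pV2 ?posrE//; lra.
- by rewrite normr0; apply: le_trans m0_eta0.
- exact: Eta_eta0.
Qed.

Lemma sol_v_bnd p : halfplane p -> `|sol_v p| <= m0.
Proof. by move=> hp; apply: le_vel => b; exact: rB. Qed.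

Let ispeed_le p (y Y : R) : halfplane p -> `|y| <= Y -> `|(speed k (Eta p))^-1 * y| <= 2 * Y.
Proof.
move=> hp yY; have /andP[s1 s2] := speed_itv p hp; apply: le_normM => //.
rewrite ger0_norm ?invr_ge0; last by lra.
rewrite -[leRHS]invrK lef_pV2 ?posrE//; lra.
Qed.

Lemma sol_dt_bnd p : halfplane p ->
  `|d_t sol_u p| <= 4 * m1 + 2 * (L * m0) /\ `|d_t sol_v p| <= 4 * m1 + 2 * (L * m0).
Proof.
move=> hp; have m10 := le_trans (normr_ge0 _) (rxB true p.1 p.2 hp).
have m00 := le_trans (normr_ge0 _) (rB true p.1 p.2 hp).
have Lm0 : 0 <= L * m0 by rewrite mulr_ge0.
have [_ uE] := sol_u_partial _ _ pt st p hp; have [_ vE] := sol_v_partial _ _ pt st p hp.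
rewrite /d_t uE vE; split.
  have -> : 4 * m1 + 2 * (L * m0) = 2 * (2 * m1 + L * m0) by ring.
  by apply: ispeed_le => //; apply: le_eta => b; exact: rt_bnd.
apply: (@le_trans _ _ (2 * m1 + L * m0)); last by lra.
by apply: le_vel => b; exact: rt_bnd.
Qed.

Lemma sol_dx_bnd p : halfplane p -> `|d_x sol_u p| <= 2 * m1 /\ `|d_x sol_v p| <= 2 * m1.
Proof.
move=> hp; have m10 := le_trans (normr_ge0 _) (rxB true p.1 p.2 hp).
have [_ uE] := sol_u_partial _ _ px sx p hp; have [_ vE] := sol_v_partial _ _ px sx p hp.
rewrite /d_x uE vE; split.
  by apply: ispeed_le => //; apply: le_eta => b; exact: rxB.
apply: (@le_trans _ _ m1); last by lra.
by apply: le_vel => b; exact: rxB.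
Qed.

Lemma sol_pressure_bnd p : halfplane p -> `|derive1 (pressure (2 * k + 1)) (sol_u p)| <= 4.
Proof.
move=> hp; have up : 0 < sol_u p by apply: vol_gt0; exact: zeta_gt0.
have D := pressure_derive k k0 _ up.
rewrite derive1E derive_val sound_speed// normrN normrX.
have /andP[s1 s2] := speed_itv p hp; rewrite ger0_norm; last by lra.
have -> : 4 = 2 ^+ 2 :> R by rewrite expr2; ring.
by rewrite lerXn2r ?nnegrE//; lra.
Qed.

End solution_from_invariants.

(** * Proof of the theorem *)

Section initial_data.
Context {R : realType}.
Variables (k eps S : R) (phi psi : R -> R).
Hypotheses (k0 : 0 < k) (eps0 : 0 < eps) (S1 : 1 <= S) (epsS : eps * S <= 1 / 2).
Hypotheses (phiC : C1b setT phi) (psiC : C1b setT psi).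
Hypothesis phiS : forall x, `|phi x| <= S.
Hypothesis dphiS : forall x, `|derive1 phi x| <= S.
Hypothesis psiS : forall x, `|psi x| <= S.
Hypothesis dpsiS : forall x, `|derive1 psi x| <= S.

Definition init_inv b x := eps * psi x - sg b * riem k (1 + eps * phi x).
Definition dinit_inv b x := eps * derive1 psi x
  - sg b * ((1 + eps * phi x) `^ (- (k + 1)) * (eps * derive1 phi x)).

Let Kr := (1 / 2 : R) `^ (- (k + 1)).

Let u0_itv x : 1 / 2 <= 1 + eps * phi x <= 3 / 2.
Proof.
have : `|eps * phi x| <= eps * S by apply: le_normMl => //; exact: ltW.
by have h := epsS; rewrite ler_norml => /andP[? ?]; lra.
Qed.

Let u0_gt0 x : 0 < 1 + eps * phi x.
Proof. by have := u0_itv x; lra. Qed.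

Let sound_le (y : R) : 1 / 2 <= y -> `|y `^ (- (k + 1))| <= Kr.
Proof.
move=> y1; rewrite ger0_norm ?powR_ge0//; apply: powRN_anti => //.
  by rewrite addr_ge0// ltW.
Qed.

Lemma init_inv_bnd b x : `|init_inv b x| <= (1 + Kr) * S * eps.
Proof.
have -> : (1 + Kr) * S * eps = eps * S + Kr * (eps * S) by ring.
apply: le_normB; first by apply: le_normMl => //; exact: ltW.
apply: le_norm_sg.
have -> : riem k (1 + eps * phi x) = riem k (1 + eps * phi x) - riem k 1.
  by rewrite riem1 subr0.
have := @lipschitz_itv _ (riem k) (fun u => u `^ (- (k + 1))) (1 / 2) (3 / 2) Kr 1 (1 + eps * phi x).
move=> H; apply: (le_trans (H _ _ _ (u0_itv x))).
- by move=> z /andP[z1 _]; apply: riem_derive => //; lra.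
- by move=> z /andP[z1 _]; exact: sound_le.
- by apply/andP; split; lra.
rewrite addrAC subrr add0r ler_wpM2l ?powR_ge0//.
by apply: le_normMl => //; exact: ltW.
Qed.

Lemma dinit_inv_bnd b x : `|dinit_inv b x| <= (1 + Kr) * S * eps.
Proof.
have -> : (1 + Kr) * S * eps = eps * S + Kr * (eps * S) by ring.
apply: le_normB; first by apply: le_normMl => //; exact: ltW.
apply: le_norm_sg; apply: le_normM.
  by apply: sound_le; have /andP[] := u0_itv x.
by apply: le_normMl => //; exact: ltW.
Qed.

Let u0_derive (x : R) : is_derive x 1 (fun x => 1 + eps * phi x) (eps * derive1 phi x).
Proof.
have H := C1b_derivable _ x phiC.
rewrite [X in is_derive _ _ X _](_ : _ = cst 1 + eps *: phi); last by apply/funext.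
have -> : eps * derive1 phi x = 0 + eps *: derive1 phi x by rewrite add0r.
exact: is_deriveD.
Qed.

Lemma init_inv_derive b (x : R) : is_derive x 1 (init_inv b) (dinit_inv b x).
Proof.
have H1 := C1b_derivable _ x psiC.
have H2 : is_derive x 1 (riem k \o (fun x => 1 + eps * phi x))
    ((1 + eps * phi x) `^ (- (k + 1)) * (eps * derive1 phi x)).
  apply: (@is_derive1_comp _ _ _ _ _ (eps * derive1 phi x)); last exact: u0_derive.
  exact: riem_derive.
rewrite /init_inv [X in is_derive _ _ X _](_ : _ =
  eps *: psi - sg b *: (riem k \o (fun x => 1 + eps * phi x))); last by apply/funext.
exact: is_derive_eq.
Qed.

Lemma dinit_inv_modulus (X e : R) : 0 < e -> exists2 d : R, 0 < d & forall b x y,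
  `|x| <= X -> `|y| <= X -> `|x - y| <= d -> `|dinit_inv b x - dinit_inv b y| <= e.
Proof.
move=> e0.
have dphi_Cb : Cb setT (derive1 phi) by rewrite -(C1b_derive1 _ phiC); have [_ [_ ]] := phiC.
have dpsi_Cb : Cb setT (derive1 psi) by rewrite -(C1b_derive1 _ psiC); have [_ [_ ]] := psiC.
have u0_Cb : Cb setT (fun x => 1 + eps * phi x).
  have one_Cb : Cb setT (fun _ : R => 1 : R).
    by apply: (@bounded_cvg_Cb _ _ _ _ 1) => q _; [exact: cvg_cst | rewrite normr1].
  apply: (Cb_ext _ (fun x => 1 * 1 + eps * phi x)); first by move=> q _; rewrite mul1r.
  by apply: CbD => //; case: phiC.
have s_Cb : Cb setT (fun x => (1 + eps * phi x) `^ (- (k + 1))).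
  apply: (@Cb_comp _ _ _ _ (fun u => u `^ (- (k + 1))) Kr u0_Cb) => q _.
    apply/differentiable_continuous/derivable1_diffP.
    exact: (@ex_derive _ _ _ _ _ _ _ (is_derive1_powR _ (u0_gt0 q))).
  by apply: sound_le; have /andP[] := u0_itv q.
have g_Cb b : Cb setT (dinit_inv b).
  apply: (Cb_ext _ (fun x => eps * derive1 psi x + (- sg b * eps) *
     ((1 + eps * phi x) `^ (- (k + 1)) * derive1 phi x))).
    by move=> q _; rewrite /dinit_inv; ring.
  by apply: CbD => //; exact: CbM.
(* Extended constantly in t, the function falls under the modulus lemma of the half-plane with T =
   0. *)
have h_Cb b : Cb halfplane (fun p : R * R => dinit_inv b p.2).
  apply: Cb_intro; last by have [M HM] := Cb_bound _ _ (g_Cb b); exists M => p _; exact: HM.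
  move=> p _ e' e'0; have [d d0 Hd] := Cb_modulus _ _ p.2 e' (g_Cb b) I e'0.
  by exists d => // q _; rewrite prod_norm_le => /andP[_ qd]; exact: Hd.
have [d1 d10 H1] := halfplane_uniform_modulus _ 0 X e (h_Cb true) e0.
have [d2 d20 H2] := halfplane_uniform_modulus _ 0 X e (h_Cb false) e0.
have t0 : (0 : R) <= (0 : R) <= (0 : R) by apply/andP; split; exact: lexx.
exists (Num.min d1 d2) => [|b x y xX yX]; first by rewrite lt_min d10.
rewrite le_min => /andP[xd1 xd2].
by case: b; [exact: (H1 0 x y t0 xX yX xd1) | exact: (H2 0 x y t0 xX yX xd2)].
Qed.

Lemma init_inv_u x : vol k (eta (fun b => init_inv b) x) = 1 + eps * phi x.
Proof.
have -> : eta (fun b => init_inv b) x = riem k (1 + eps * phi x).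
  by rewrite /eta /init_inv /sg; field.
by rewrite riemK.
Qed.

Lemma init_inv_v x : vel (fun b => init_inv b) x = eps * psi x.
Proof. by rewrite /vel /init_inv /sg; field. Qed.

End initial_data.

Lemma coef_bounds_exist {R : realType} (k mu : R) (a : R * R -> R) : 0 < k -> 0 < mu ->
  admissible_damping mu a ->
  exists (L eta0 W h1 : R) (w : bool -> R -> R -> R),
  [/\ [/\ 0 < eta0, k * eta0 <= 1 / 2, 0 < W & 0 < h1],
    coef_bounds (fun t x => a (t, x)) (fun t x => d_x a (t, x)) (speed k) (dspeed k) L eta0,
    forall T X (e : R), 0 < e -> exists2 d : R, 0 < d & forall t x y, 0 <= t <= T ->
      `|x| <= X -> `|y| <= X -> `|x - y| <= d -> `|d_x a (t, x) - d_x a (t, y)| <= e,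
    forall b t x, 0 <= t -> W^-1 <= w b t x <= W &
    forall h b t x l, 0 < h <= h1 -> 0 <= t -> 1 / 2 <= l <= 2 ->
    (1 - h * a (t, x - sg b * h * l) / 2) * w b t (x - sg b * h * l) <=
    (1 - h * mu / 4) * w b (t + h) x].
Proof.
move=> k0 mu0 adm.
have [L' [w [W [h1 [[L'1 [W0 h10]] [aB axB aL ad] axM wW wS]]]]] := damping_coefs mu a mu0 adm.
have [eta0 [K [/andP[e0 e1] ke K1 [sd sB dsB dsL]]]] := speed_bounds k k0.
pose L := L' + K.
have LL : L' <= L by rewrite /L; lra.
have KL : K <= L by rewrite /L; lra.
exists L, eta0, W, h1, w; split => //.
split => //.
- by lra.
- by move=> e /dsB h; exact: le_trans KL.
- by move=> e e' he he'; apply: (le_trans (dsL _ _ he he')); rewrite ler_wpM2r.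
- exact: speed0.
- by move=> t x t0; have /andP[-> h] := aB t x t0; exact: le_trans LL.
- by move=> t x t0; exact: le_trans (axB t x t0) LL.
- move=> t x t' x' t0 t'0; apply: (le_trans (aL _ _ _ _ t0 t'0)).
  by rewrite ler_wpM2r// addr_ge0.
Qed.

Theorem theorem1p2 (R : realType) (gamma mu0 : R) (a : R * R -> R)
    (gamma_gt1 : 1 < gamma) (mu0_gt0 : 0 < mu0)
    (a_adm : admissible_damping mu0 a) :
  exists eps1 : \bar R -> \bar R -> R,
    forall phi psi : R -> R, C1b setT phi -> C1b setT psi ->
    0 < eps1 (C1b_norm phi) (C1b_norm psi) /\
    exists C : R, 0 < C /\
      forall eps : R, 0 < eps -> eps <= eps1 (C1b_norm phi) (C1b_norm psi) ->
      let u0 := fun x => 1 + eps * phi x in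
      let v0 := fun x => eps * psi x in
      exists u v : R * R -> R,
        [/\ C1b_solution gamma a u0 v0 u v,
            forall u' v' : R * R -> R, C1b_solution gamma a u0 v0 u' v' ->
              forall p, halfplane p -> u' p = u p /\ v' p = v p,
            (Linfty_halfplane (fun p => ((u p - 1)%R, v p)) +
             Linfty_halfplane (fun p => (d_t u p, d_t v p)) +
             Linfty_halfplane (fun p => (d_x u p, d_x v p))
               <= (C * eps)%:E)%E
          & (Linfty_halfplane (fun p => derive1 (pressure gamma) (u p))
               <= C%:E)%E].
Proof.
pose k := (gamma - 1) / 2.
have k0 : 0 < k by rewrite /k; lra.
have -> : gamma = 2 * k + 1 by rewrite /k; field.
have [L [eta0 [W [h1 [w [[e0 ke W0 h10] coefs axM wW wS]]]]]] :=
  coef_bounds_exist k mu0 a k0 mu0_gt0 a_adm.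
have L1 := coef_L _ _ _ _ _ _ coefs.
have Lge0 : 0 <= L by exact: le_trans ler01 L1.
(* With N = C3 m0 the two summands give [data_N0] and [data_N1]; C2 below is the resulting ratio m1
   / m0, and C4 S eps is the bound m0 of the initial invariants and their derivatives. *)
pose C3 := 2 * L * W + 64 * L ^+ 2 * W / mu0.
pose C2 := W * C3 + L.
pose C4 := 1 + (1 / 2 : R) `^ (- (k + 1)).
have C30 : 0 <= C3.
  by rewrite addr_ge0// ?divr_ge0 ?mulr_ge0 ?exprn_ge0 ?(ltW W0) ?(ltW mu0_gt0)//; lra.
have C21 : 1 <= C2.
  by have := mulr_ge0 (ltW W0) C30; rewrite /C2; lra.
have C41 : 1 <= C4 by rewrite lerDl powR_ge0.
(* The threshold is a function of the two norms alone, so it has to be defined for all extended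
   reals; the norms of the data are finite, hence [fine] loses nothing. *)
pose Sn (A B : \bar R) := `|fine A| + `|fine B| + 1.
(* The first term keeps the initial u in [1/2, 3/2]. The second means m0 <= eta0 and m0 C2^2 <= 1,
   the latter being m1^2 <= m0. *)
pose eps1 A B := Num.min (1 / 2 / Sn A B)
  (Num.min eta0 (C2 ^+ 2)^-1 / (C4 * Sn A B)).
exists eps1 => phi psi phiC psiC.
have [s1 [E1 s10 phiB dphiB]] := C1b_norm_bound _ phiC.
have [s2 [E2 s20 psiB dpsiB]] := C1b_norm_bound _ psiC.
have SnE : Sn (C1b_norm phi) (C1b_norm psi) = s1 + s2 + 1.
  by rewrite /Sn E1 E2 /= !ger0_norm.
pose S := s1 + s2 + 1.
have S1 : 1 <= S by rewrite /S; lra.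
have [s1S s2S] : s1 <= S /\ s2 <= S by rewrite /S; split; lra.
have S0 : 0 < S by lra.
have C4S : 0 < C4 * S by rewrite mulr_gt0//; lra.
have C22 : 0 < C2 ^+ 2 by rewrite exprn_gt0//; lra.
rewrite /eps1 SnE -/S; split.
  by rewrite lt_min !divr_gt0// lt_min e0 invr_gt0.
(* The three norms sum to at most 2 m0 + 6 m1 + 2 L m0; the summand 4 is for the bound of p'(u), the
   square of a speed at most 2. *)
pose C := (2 + 6 * C2 + 2 * L) * (C4 * S) + 4.
have C0 : 4 <= C.
  rewrite /C lerDr mulr_ge0 ?(ltW C4S)//; lra.
exists C; split; first by lra.
move=> eps eps_gt0 epsE.
pose u0 x := 1 + eps * phi x; pose v0 x := eps * psi x.
have [epsS m0S] : eps <= 1 / 2 / S /\ eps <= Num.min eta0 (C2 ^+ 2)^-1 / (C4 * S).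
  by apply/andP; rewrite -le_min.
move: epsS m0S; rewrite (ler_pdivlMr _ _ S0) (ler_pdivlMr _ _ C4S) => epsS.
rewrite le_min => /andP[m0_eta m0_C2].
pose m0 := C4 * S * eps.
have m0E : eps * (C4 * S) = m0 by rewrite mulrC.
rewrite m0E in m0_eta m0_C2.
have m0p : 0 < m0 by rewrite mulr_gt0.
pose m1 := C2 * m0.
have m12 : m1 ^+ 2 <= m0.
  have h : m0 * C2 ^+ 2 <= 1 by rewrite -ler_pdivlMr// div1r.
  have -> : m1 ^+ 2 = m0 * (m0 * C2 ^+ 2) by rewrite /m1; ring.
  by rewrite ler_piMr// ltW.
have m0_1 : m0 <= 1 := le_trans m0_eta (coef_eta0 _ _ _ _ _ _ coefs).
have C20 : 0 <= C2 := le_trans ler01 C21.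
have m11 : m1 <= 1.
  rewrite -(@expr_le1 _ 2)//; first exact: le_trans m0_1.
  by rewrite mulr_ge0// ltW.
have phiS x : `|phi x| <= S by exact: le_trans (phiB x) s1S.
have dphiS x : `|derive1 phi x| <= S by exact: le_trans (dphiB x) s1S.
have psiS x : `|psi x| <= S by exact: le_trans (psiB x) s2S.
have dpsiS x : `|derive1 psi x| <= S by exact: le_trans (dpsiB x) s2S.
have data : data_bounds (fun t x => a (t, x)) (fun t x => d_x a (t, x)) L eta0
    (init_inv k eps phi psi) (dinit_inv k eps phi psi) w m0 m1 mu0 (C3 * m0) W h1.
  split => //.
  - rewrite (_ : 2 * L * m0 * W = 2 * L * W * m0); last by ring.
    rewrite ler_wpM2r ?(ltW m0p)// /C3 lerDl divr_ge0 ?(ltW mu0_gt0)//.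
    by rewrite !mulr_ge0 ?exprn_ge0 ?(ltW W0).
  - rewrite (_ : mu0 * (C3 * m0) = mu0 * (2 * L * W) * m0 + 64 * L ^+ 2 * m0 * W); last first.
      by rewrite /C3; field; rewrite gt_eqF.
    rewrite lerDr; apply: mulr_ge0 (ltW m0p).
    by rewrite !mulr_ge0 ?(ltW W0) ?(ltW mu0_gt0).
  - by clear; rewrite /m1 /C2; lra.
  - by move=> b x; exact: init_inv_bnd.
  - by move=> b x; exact: dinit_inv_bnd.
  - by move=> b x; apply: (init_inv_derive _ _ S).
  - by move=> X e; apply: (dinit_inv_modulus _ _ S).
have [r [rx [rB rxB r0 rreg]]] := invariants_exist _ _ _ _ _ _ _ _ _ _ _ _ _ _ _ coefs data.
have aC : Cb halfplane a by case: a_adm => -[].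
have aL p : halfplane p -> `|a p| <= L.
  case: p => t x t0; have /andP[? ?] := coef_a _ _ _ _ _ _ coefs t x t0.
  by rewrite ger0_norm.
have speedP := coef_c _ _ _ _ _ _ coefs.
have sol : C1b_solution (2 * k + 1) a u0 v0 (sol_u k r) (sol_v r).
  apply: (sol_is_solution _ _ _ _ _ _ _ _ k0 Lge0 ke speedP aC aL m0_eta rB rxB rreg) => x.
    rewrite /u0 -(init_inv_u k eps S phi psi)//; congr vol.
    by rewrite /eta !r0.
  by rewrite /v0 -(init_inv_v k eps phi psi); rewrite /vel !r0.
exists (sol_u k r), (sol_v r); split => //.
- move=> u' v' sol'.
  (* Half of the lower bound of u that follows from |k eta| <= 1/2, as the uniqueness argument needs
     u >= 2 d. *)
  pose d := (3 / 2 : R) `^ (- k^-1) / 2.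
  have d0 : 0 < d by rewrite divr_gt0// powR_gt0.
  apply: (solution_unique k k0 a _ _ u' v' u0 v0 d) => //; first by case: a_adm.
  move=> p hp; rewrite /d mulrC divfK//.
  exact: (sol_u_ge _ _ _ _ k0 ke m0_eta rB).
- have m00 := ltW m0p; have m10 : 0 <= m1 by rewrite mulr_ge0.
  have Lm0 : 0 <= L * m0 by rewrite mulr_ge0.
  apply: (@le_trans _ _ ((2 * m0)%:E + (4 * m1 + 2 * (L * m0))%:E + (2 * m1)%:E)%E).
    apply: leeD; first apply: leeD.
    + apply: Linfty_halfplane_le => [|p hp]; first by rewrite mulr_ge0.
      rewrite prod_normE ge_max /=; apply/andP; split.
        exact: (sol_u_sub1 _ _ _ _ k0 ke speedP m0_eta rB).
      apply: (@le_trans _ _ m0); last by rewrite ler_peMl// ler1n.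
      exact: (sol_v_bnd _ _ rB).
    + apply: Linfty_halfplane_le => [|p hp]; first by rewrite addr_ge0// mulr_ge0.
      rewrite prod_normE ge_max /=; apply/andP.
      exact: (sol_dt_bnd _ _ _ _ _ _ _ _ k0 Lge0 ke speedP aL m0_eta rB rxB rreg).
    + apply: Linfty_halfplane_le => [|p hp]; first by rewrite mulr_ge0.
      rewrite prod_normE ge_max /=; apply/andP.
      exact: (sol_dx_bnd _ _ _ _ _ _ _ k0 ke speedP m0_eta rB rxB rreg).
  rewrite -!EFinD lee_fin /C /m1 /m0.
  by move: eps_gt0; clear; lra.
- apply: Linfty_halfplane_le => [|p hp]; first by lra.
  apply: (le_trans _ C0).
  exact: (sol_pressure_bnd _ _ _ _ k0 ke speedP m0_eta rB).
Qed.
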